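(* Let $\nu<1$ with $\nu\neq 0$, let $1\le p<\infty$ and $\delta\in\mathbb{R}$. Then the maximal operator $\widetilde{P}_*^{\nu}$, considered on the measure space $(\mathbb{R}_+,x^{\delta}dx)$, has the following mapping properties: (a) $\widetilde{P}_*^{\nu}$ is of strong type $(p,p)$ if and only if $p>1$ and $2\nu p-1<\delta<2p-1$; (b) $\widetilde{P}_*^{\nu}$ is of weak type $(p,p)$ if and only if $2\nu p-1\le\delta<2p-1$, with the second inequality replaced by $\delta\le 2p-1$ in case $p=1$; (c) $\widetilde{P}_*^{\nu}$ is of restricted weak type $(p,p)$ if and only if $2\nu p-1\le\delta\le 2p-1$. Moreover, $\widetilde{P}_*^{\nu}$ is of strong type $(\infty,\infty)$ if and only if $\nu<0$.
   Context: Notation: $\mathbb{R}_+=(0,\infty)$ and $d\eta_{\nu}(x)=x^{2\nu+1}dx$ on $\mathbb{R}_+$. For $\mu>-1$ let $I_{\mu}$ be the modified Bessel function of the first kind of order $\mu$ and $$W_t^{\mu}(x,y)=\frac{1}{2t}(xy)^{-\mu}e^{-(x^2+y^2)/4t}I_{\mu}\Big(\frac{xy}{2t}\Big),\qquad t,x,y>0.$$ For $\nu<1$ the exotic Bessel heat kernel is $\widetilde{W}_t^{\nu}(x,y)=(xy)^{-2\nu}W_t^{-\nu}(x,y)$. The exotic Bessel-Poisson kernel is obtained by subordination, $$\widetilde{P}_t^{\nu}(x,y)=\frac{1}{\sqrt{\pi}}\int_0^{\infty}\widetilde{W}^{\nu}_{t^2/(4u)}(x,y)\,e^{-u}\,\frac{du}{\sqrt{u}},\qquad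 t,x,y>0,$$ and $$\widetilde{P}_t^{\nu}f(x)=\int_0^{\infty}\widetilde{P}_t^{\nu}(x,y)f(y)\,d\eta_{\nu}(y),\qquad \widetilde{P}_*^{\nu}f(x)=\sup_{t>0}\big|\widetilde{P}_t^{\nu}f(x)\big|,\qquad x>0.$$ The operator is considered on its natural domain (functions for which the defining integrals converge); mapping properties include that the operator is well defined on the functions in question. Terminology, for an operator $T$ and $1\le p<\infty$: $T$ is of strong type $(p,p)$ with respect to $(\mathbb{R}_+,x^{\delta}dx)$ if it is bounded on $L^p(\mathbb{R}_+,x^{\delta}dx)$; strong type $(\infty,\infty)$ means boundedness on $L^{\infty}(\mathbb{R}_+)$. $T$ is of weak type $(p,p)$ if there is a constant $C$ such that $\lambda^p\int_{\{y>0:|Tf(y)|>\lambda\}}x^{\delta}dx\le C\int_0^{\infty}|f(x)|^px^{\delta}dx$ for all $\lambda>0$ and all $f\in L^p(\mathbb{R}_+,x^{\delta}dx)$. $T$ is of restricted weak type $(p,p)$ if this weak type inequality holds (with a uniform constant) for all $f$ that are characteristic functions of sets of finite $x^{\delta}dx$ measure. *)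

(* Defs.v *)
From HB Require Import structures.
From mathcomp Require Import all_boot all_order all_algebra.
From mathcomp Require Import all_classical all_reals all_analysis.
From mathcomp Require Import measurable_realfun.

Set Implicit Arguments.
Unset Strict Implicit.
Unset Printing Implicit Defensive.

Import Order.TTheory GRing.Theory Num.Theory.
Import numFieldNormedType.Exports.

Local Open Scope classical_set_scope.
Local Open Scope ring_scope.

Definition Rpos {R : realType} : set R := `]0, +oo[.

(* x^delta dx on (0, oo), encoded as a measure on R that is concentrated on
   Rpos.  A function on (0, oo) is represented by any of its extensions to R. *)
Definition power_measure {R : realType} (delta : R) :
    set (measurableTypeR R) -> \bar R :=
  fun A => (\int[lebesgue_measure]_(x in A `&` Rpos) (x `^ delta)%:E)%E.

Section power_measure_isMeasure.
Variables (R : realType) (delta : R).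
Local Notation mu := (power_measure delta).

Let mRpos : measurable (@Rpos R).
Proof. exact: measurable_itv. Qed.

Let power_measure0 : mu set0 = 0%E.
Proof. by rewrite /power_measure set0I integral_set0. Qed.

Let power_measure_ge0 A : (0 <= mu A)%E.
Proof. by apply: integral_ge0 => x _; rewrite lee_fin powR_ge0. Qed.

Let power_measure_sigma_additive : semi_sigma_additive mu.
Proof.
move=> A mA tA mUA.
rewrite /power_measure setI_bigcupl ge0_integral_bigcup; last 4 first.
- by move=> k; exact: (measurableI _ _ (mA k) mRpos).
- apply/measurable_EFinP; apply: measurable_funS (measurable_powR delta) => //.
- by move=> x _; rewrite lee_fin powR_ge0.
- exact: trivIset_setIr.
by apply: is_cvg_ereal_nneg_natsum_cond => n _ _; exact: power_measure_ge0.
Qed.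

HB.instance Definition _ := isMeasure.Build _ _ _ mu
  power_measure0 power_measure_ge0 power_measure_sigma_additive.

End power_measure_isMeasure.

Section kernels.
Context {R : realType}.
Implicit Types (mu nu t x y z s : R) (f : R -> R).
Local Notation leb := (@lebesgue_measure R).

(* Only meaningful for s > 0. *)
Definition Gamma s : R :=
  \int[leb]_(u in Rpos) (u `^ (s - 1) * expR (- u)).

(* Modified Bessel function of the first kind of order mu, for mu > -1 and
   z > 0, by its power series. *)
Definition bessel_I mu z : R :=
  limn (series (fun k : nat =>
    (z / 2) `^ (mu + 2 * k%:R) / (k`!%:R * Gamma (mu + k%:R + 1)))).

Definition bessel_heat mu t x y : R :=
  (2 * t)^-1 * (x * y) `^ (- mu) * expR (- ((x ^+ 2 + y ^+ 2) / (4 * t))) *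
  bessel_I mu (x * y / (2 * t)).

Definition exotic_heat nu t x y : R :=
  (x * y) `^ (- (2 * nu)) * bessel_heat (- nu) t x y.

Definition exotic_poisson nu t x y : R :=
  (Num.sqrt pi)^-1 *
  \int[leb]_(u in Rpos)
    (exotic_heat nu (t ^+ 2 / (4 * u)) x y * expR (- u) / Num.sqrt u).

Definition eta nu : {measure set (measurableTypeR R) -> \bar R} :=
  power_measure (2 * nu + 1).

Definition poisson_op nu t f x : R :=
  \int[eta nu]_(y in Rpos) (exotic_poisson nu t x y * f y).

Definition poisson_dom nu : set (R -> R) :=
  [set f | forall t x, 0 < t -> 0 < x ->
    (eta nu).-integrable Rpos (fun y => (exotic_poisson nu t x y * f y)%:E)].

(* The maximal operator; the function on (0, oo) is extended by 0 to R. *)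
Definition poisson_max nu f : R -> \bar R :=
  (fun x => ereal_sup [set `|poisson_op nu t f x|%:E | t in Rpos]) \_ Rpos.

End kernels.

(* Mapping properties of an operator T with domain D, possibly taking infinite
   values, on the measure space (X, mu). *)
Section mapping_properties.
Context {d : measure_display} {X : measurableType d} {R : realType}.
Variables (mu : {measure set X -> \bar R}) (D : set (X -> R)).
Variable T : (X -> R) -> X -> \bar R.
Local Open Scope ereal_scope.

Definition strong_type (p : \bar R) : Prop :=
  exists C : R, forall f : X -> R, f \in Lfun mu p ->
    [/\ D f, measurable_fun setT (T f) &
        'N[mu]_p[T f] <= C%:E * 'N[mu]_p[EFin \o f]].

Definition weak_bound (p C : R) (f : X -> R) : Prop :=
  forall lambda : R, (0 < lambda)%R ->
    (lambda `^ p)%:E * mu [set y | lambda%:E < `|T f y|] <=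
    C%:E * \int[mu]_x (`|f x| `^ p)%:E.

Definition weak_type (p : R) : Prop :=
  exists C : R, forall f : X -> R, f \in Lfun mu p%:E ->
    [/\ D f, measurable_fun setT (T f) & weak_bound p C f].

Definition restricted_weak_type (p : R) : Prop :=
  exists C : R, forall E : set X, measurable E -> mu E < +oo ->
    [/\ D \1_E, measurable_fun setT (T \1_E) & weak_bound p C \1_E].

End mapping_properties.

(* Main.v *)
(* By subordination and termwise integration of the Bessel series, the
   Poisson kernel times y^(2 nu + 1) is comparable with
     J = x^(-2 nu) t y / (t^2 + (x - y)^2) * (t^2 + x^2 + y^2)^(nu - 1/2).
   Off the diagonal the supremum of J over t is at most
   x^(-2) y 1_{y <= x} + x^(-2 nu) y^(2 nu - 1) 1_{y > x}, which gives two Hardy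
   operators; Schur's test bounds them on L^p(x^delta dx) for delta < 2p - 1 and
   delta > 2 nu p - 1 respectively, and at an endpoint the off-diagonal part is
   dominated by a constant times a power of x that lies in weak L^p.  Near the
   diagonal J is dominated by a Euclidean Poisson kernel plus an average over a
   dyadic block, hence by a localised Hardy-Littlewood maximal function, for
   which power weights are harmless.  Necessity is tested on 1_(1,2],
   y^(-2 + e) 1_(0,1] and 1_(1,1+s]. *)

Require Import Defs.
From mathcomp Require Import all_boot all_order all_algebra.
From mathcomp Require Import all_classical all_reals all_analysis.
From mathcomp Require Import measurable_realfun ess_sup_inf ring lra.

Set SsrOldRewriteGoalsOrder.
Set Implicit Arguments.
Unset Strict Implicit.
Unset Printing Implicit Defensive.

Import Order.TTheory GRing.Theory Num.Theory.
Import numFieldNormedType.Exports.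

Local Open Scope classical_set_scope.
Local Open Scope ring_scope.

(** The endpoints shape the far part. At [delta = 2 nu p - 1] with [p > 1], the bound by y^(2 nu -
    1) obtained after taking the supremum over [t] misses the dual space by a logarithm. Hölder's
    inequality is therefore applied at each fixed [t]; by homogeneity the dual norm does not depend
    on [t], and the supremum afterwards is free. The remaining power x^(-2 nu) is in weak L^p
    because [nu != 0]. At [delta = 2 p - 1] the divergence is at y = 0 and is genuine: only [p = 1],
    or functions bounded by 1, can avoid it, whence the gap between weak and restricted weak type.
    The types also demand membership in the domain and measurability. For different (t, x) the
    kernels are comparable as functions of y, so one point where a majorant is finite settles the
    domain, and a finite weak bound on the majorant provides that point. The supremum over [t] is
    uncountable; its measurability comes from continuity in x. *)

Lemma mRpos {R : realType} : measurable (@Rpos R).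
Proof. exact: measurable_itv. Qed.

#[local] Hint Extern 0 (measurable Rpos) => exact: mRpos : core.

Lemma RposE {R : realType} (x : R) : Rpos x <-> 0 < x.
Proof. by rewrite /Rpos /= in_itv /= andbT. Qed.

(** * Integration against the measure with density [x ^ delta] *)

Section density.
Context {R : realType}.
Variable delta : R.
Local Notation leb := (@lebesgue_measure R).
Local Notation mu := (power_measure delta).
Local Open Scope ereal_scope.
Import HBNNSimple.

Let w (x : R) : \bar R := (x `^ delta)%:E.

Let w_ge0 x : 0 <= w x. Proof. by rewrite lee_fin powR_ge0. Qed.

Let mw D : measurable_fun D w.
Proof.
apply/measurable_EFinP; apply: measurable_funS (measurable_powR delta) => //.
Qed.

Let density_nnsfun (D : set R) (mD : measurable D) (h : {nnsfun (measurableTypeR R) >-> R}) :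
  \int[mu]_(x in D) (h x)%:E = \int[leb]_(x in D `&` Rpos) ((h x)%:E * w x).
Proof.
have mDR : measurable (D `&` Rpos) by exact: measurableI.
under [LHS]eq_integral do rewrite fimfunE -fsumEFin//.
rewrite [LHS]ge0_integral_fsum//; last 2 first.
  - by move=> r; exact/measurable_EFinP/measurableT_comp.
  - by move=> n x _; rewrite EFinM nnfun_muleindic_ge0.
under [RHS]eq_integral.
  move=> x xD; rewrite fimfunE -fsumEFin// ge0_mule_fsuml; last first.
    by move=> r; rewrite EFinM nnfun_muleindic_ge0.
  over.
rewrite [RHS]ge0_integral_fsum//; last 2 first.
  - move=> r; apply: emeasurable_funM; last exact: mw.
    exact/measurable_EFinP/measurableT_comp.
  - by move=> n x _; rewrite mule_ge0// EFinM nnfun_muleindic_ge0.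
apply: eq_fsbigr => r _; rewrite integralZl_indic_nnsfun// integral_indic//.
(* A negative value has an empty fibre, so both sides vanish; only a nonnegative constant is pulled
   out of the integral. *)
have [r0|r0] := ltP r 0%R.
  rewrite preimage_nnfun0// set0I measure0 mule0 integral0_eq// => x _.
  by rewrite indic0 mulr0 mul0e.
under [RHS]eq_integral do rewrite EFinM -muleA.
rewrite ge0_integralZl//; last 2 first.
  - by apply: emeasurable_funM; [exact/measurable_EFinP|exact: mw].
  - by move=> x _; rewrite mule_ge0// lee_fin.
congr (_ * _); rewrite [LHS]/=/power_measure -setIA integral_mkcondl.
by apply: eq_integral => x _; rewrite epatch_indic muleC.
Qed.

(** [mu] is known only through its values on sets, so the density is first pulled out of simple
    functions ([density_nnsfun]), and monotone convergence does the rest. *)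
Lemma ge0_integral_power_measure (D : set (measurableTypeR R))
    (f : measurableTypeR R -> \bar R) :
  measurable D -> measurable_fun D f -> (forall x, D x -> 0 <= f x) ->
  \int[mu]_(x in D) f x =
  \int[leb]_(x in D `&` Rpos) (f x * (x `^ delta)%:E).
Proof.
move=> mD mf f0; pose f_ := nnsfun_approx mD mf.
have mDR : measurable (D `&` Rpos) by exact: measurableI.
transitivity (limn (fun n => \int[mu]_(x in D) (f_ n x)%:E)).
  rewrite -monotone_convergence//=.
  - apply: eq_integral => x /[!inE] xD; apply/esym/cvg_lim => //=.
    exact: cvg_nnsfun_approx.
  - by move=> n; exact/measurable_EFinP/measurable_funTS.
  - by move=> n x _; rewrite lee_fin.
  - by move=> x _ a b ab; rewrite lee_fin//; exact/lefP/nd_nnsfun_approx.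
under eq_fun do rewrite density_nnsfun//.
rewrite -monotone_convergence//=.
- apply: eq_integral => x /[!inE] -[xD _]; apply/cvg_lim => //=.
  by apply: cvgeZr => //; exact: cvg_nnsfun_approx.
- move=> n; apply: emeasurable_funM; last exact: mw.
  exact/measurable_EFinP/measurable_funTS.
- by move=> n x _; rewrite mule_ge0// lee_fin.
- move=> x _ a b ab; rewrite lee_wpmul2r// lee_fin//.
  exact/lefP/nd_nnsfun_approx.
Qed.

End density.

(** * Tonelli's theorem and power integrals *)

Section tonelli.
Context {R : realType}.
Local Notation leb := (@lebesgue_measure R).
Local Notation mR := (measurableTypeR R).
Local Open Scope ereal_scope.
Variables (A B : set mR) (f : mR -> mR -> \bar R).
Hypotheses (mA : measurable A) (mB : measurable B).
Hypothesis mf : measurable_fun (A `*` B) (fun z => f z.1 z.2).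
Hypothesis f0 : forall x y, A x -> B y -> 0 <= f x y.

(** Extension by zero: measurability and sign are assumed on the product of [A] and [B] only, while
    Tonelli's theorem is applied on the whole plane. *)
Let g : mR * mR -> \bar R := (fun z => f z.1 z.2) \_ (A `*` B).

Let mg : measurable_fun setT g.
Proof. by apply/(measurable_restrictT _ _).1 => //; exact: measurableX. Qed.

Let g0 z : 0 <= g z.
Proof. by apply: erestrict_ge0 => -[x y] [/= Ax By]; exact: f0. Qed.

Let gE1 x : \int[leb]_y g (x, y) =
  ((fun x => \int[leb]_(y in B) f x y) \_ A) x.
Proof.
rewrite patchE; case: ifPn => xA.
  rewrite [RHS]integral_mkcond; apply: eq_integral => y _.
  rewrite /g !patchE; congr (if _ then _ else _).
  by move: xA; rewrite !inE => Ax; apply/idP/idP; rewrite !inE => // -[].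
apply: integral0_eq => y _; rewrite /g patchE; case: ifPn => //.
by rewrite inE => -[/= Ax _]; move: xA; rewrite notin_setE.
Qed.

Let gE2 y : \int[leb]_x g (x, y) =
  ((fun y => \int[leb]_(x in A) f x y) \_ B) y.
Proof.
rewrite patchE; case: ifPn => xA.
  rewrite [RHS]integral_mkcond; apply: eq_integral => x _.
  rewrite /g !patchE; congr (if _ then _ else _).
  by move: xA; rewrite !inE => By; apply/idP/idP; rewrite !inE => // -[].
apply: integral0_eq => x _; rewrite /g patchE; case: ifPn => //.
by rewrite inE => -[/= _ By]; move: xA; rewrite notin_setE.
Qed.

Lemma ge0_tonelli : \int[leb]_(x in A) \int[leb]_(y in B) f x y =
  \int[leb]_(y in B) \int[leb]_(x in A) f x y.
Proof.
rewrite integral_mkcond [RHS]integral_mkcond.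
under eq_integral do rewrite -gE1; under [RHS]eq_integral do rewrite -gE2.
exact: fubini_tonelli.
Qed.

Lemma measurable_ge0_integral2 :
  measurable_fun A (fun x => \int[leb]_(y in B) f x y).
Proof.
apply: (iffRL (measurable_restrictT _ mA)).
have H := @measurable_fun_fubini_tonelli_F _ _ mR mR R leb g mg g0.
by apply: eq_measurable_fun H => x _; exact: gE1.
Qed.

Lemma measurable_ge0_integral1 :
  measurable_fun B (fun y => \int[leb]_(x in A) f x y).
Proof.
apply: (iffRL (measurable_restrictT _ mB)).
have H := @measurable_fun_fubini_tonelli_G _ _ mR mR R leb g mg g0.
by apply: eq_measurable_fun H => y _; exact: gE2.
Qed.

End tonelli.

Section FTC_open.
Context {R : realType}.
Local Notation leb := (@lebesgue_measure R).

(* No growth or monotonicity is assumed on [F'] beyond its sign, so that the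
   integral may be improper at [0]. *)
Lemma ge0_FTC_0x (F f : R -> R) (x : R) : 0 < x ->
  (forall y : R, 0 < y -> is_derive y 1 F (f y)) ->
  (forall y : R, 0 < y -> {for y, continuous f}) ->
  (forall y : R, 0 < y -> 0 <= f y) -> F y @[y --> 0^'+] --> 0 ->
  (\int[leb]_(y in `]0%R, x]) (f y)%:E = (F x)%:E)%E.
Proof.
move=> x0 dF cf f0 F0.
(* The shift by 2 keeps the left end strictly below [x] already for [n = 0], as the fundamental
   theorem on [D n] requires. *)
pose D n : set (measurableTypeR R) := `[x / n.+2%:R, x]%classic.
have xn n : 0 < x / n.+2%:R by rewrite divr_gt0.
have xnx n : x / n.+2%:R < x.
  by rewrite ltr_pdivrMr// ltr_pMr// ltr1n.
have DU : `]0, x]%classic = \bigcup_n D n.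
  apply/seteqP; split=> [y|y [n _]]; rewrite /D/= !in_itv/=.
    move=> /andP[y0 yx].
    have [n _ ny] : exists2 n, True & x / n.+2%:R <= y.
      exists (Num.truncn (x / y)) => //.
      rewrite ler_pdivrMr// mulrC -ler_pdivrMr//.
      apply: ltW; apply: lt_trans (truncnS_gt _) _.
      by rewrite ltr_nat.
    by exists n => //=; rewrite in_itv/= ny.
  by move=> /andP[ny ->]; rewrite andbT (lt_le_trans _ ny).
have cvg1 : (\int[leb]_(y in D n) (f y)%:E)%E @[n --> \oo] -->
    (\int[leb]_(y in `]0%R, x]) (f y)%:E)%E.
  rewrite DU; apply: ge0_nondecreasing_set_cvg_integral.
  - apply/nondecreasing_seqP => n; apply/subsetPset => y; rewrite /D/= !in_itv/=.
    move=> /andP[h ->]; rewrite andbT (le_trans _ h)//.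
    by rewrite ler_pM2l// lef_pV2 ?posrE// ler_nat.
  - by move=> i; exact: measurable_itv.
  - move=> i; apply/measurable_EFinP; apply: subspace_continuous_measurable_fun.
      exact: measurable_itv.
    apply: continuous_in_subspaceT => y; rewrite ?/D inE/= in_itv/= => /andP[h _].
    by apply: cf; exact: lt_le_trans h.
  - move=> i y; rewrite /D/= in_itv/= => /andP[h _]; rewrite lee_fin f0//.
    exact: lt_le_trans h.
have cvg2 : (\int[leb]_(y in D n) (f y)%:E)%E @[n --> \oo] --> (F x)%:E.
  have -> : (fun n => \int[leb]_(y in D n) (f y)%:E)%E =
      (fun n => (F x - F (x / n.+2%:R))%:E).
    apply/funext => n; rewrite EFinB.
    apply: continuous_FTC2 => //.
    - apply: continuous_in_subspaceT => y; rewrite ?/D inE/= in_itv/= => /andP[h _].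
      by apply: cf; exact: lt_le_trans h.
    - have cF y : 0 < y -> {for y, continuous F}.
        move=> y0; apply: differentiable_continuous; apply/derivable1_diffP.
        by have [] := dF _ y0.
      split.
      + move=> y; rewrite in_itv/= => /andP[h _].
        by have [] := dF _ (lt_trans (xn n) h).
      + by apply: cvg_at_right_filter; exact: cF.
      + by apply: cvg_at_left_filter; exact: cF.
    - move=> y; rewrite in_itv/= => /andP[h _].
      by rewrite derive1E; have [_ ->] := dF _ (lt_trans (xn n) h).
  apply/cvg_EFin; first exact: nearW.
  rewrite -[X in _ --> X]subr0; apply: cvgB; first exact: cvg_cst.
  move/cvg_at_rightP : F0; apply; split=> //.
  rewrite -[X in _ --> X](mulr0 x); apply: cvgM; first exact: cvg_cst.
  have := @cvg_harmonic R; rewrite -(@cvg_shiftS _ (@harmonic R)).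
  exact.
exact: (cvg_unique _ cvg1 cvg2).
Qed.

Lemma ge0_FTC_xy (F f : R -> R) (x l : R) : 0 < x ->
  (forall y : R, 0 < y -> is_derive y 1 F (f y)) ->
  (forall y : R, 0 < y -> {for y, continuous f}) ->
  (forall y : R, 0 < y -> 0 <= f y) -> F y @[y --> +oo] --> l ->
  (\int[leb]_(y in `]x, +oo[) (f y)%:E = (l - F x)%:E)%E.
Proof.
move=> x0 dF cf f0 Fl.
have mf : measurable_fun `]x, +oo[ f.
  apply: subspace_continuous_measurable_fun; first exact: measurable_itv.
  apply: continuous_in_subspaceT => y; rewrite inE/= in_itv/= andbT => h.
  by apply: cf; exact: lt_trans h.
rewrite integral_itv_obnd_cbnd; last exact/measurable_EFinP.
rewrite EFinB; apply: ge0_continuous_FTC2y => //.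
- by move=> y xy; apply: f0; exact: lt_le_trans xy.
- apply: continuous_in_subspaceT => y; rewrite inE/= in_itv/= andbT => h.
  by apply: cf; exact: lt_le_trans h.
- by move=> y xy; have [] := dF _ (lt_trans x0 xy).
- apply: cvg_at_right_filter.
  apply: differentiable_continuous; apply/derivable1_diffP.
  by have [] := dF _ x0.
- move=> y; rewrite in_itv/= andbT => h.
  by rewrite derive1E; have [_ ->] := dF _ (lt_trans x0 h).
Qed.

Lemma is_derive_powR (a y : R) : 0 < y ->
  is_derive y 1 (fun y => y `^ a) (a * y `^ (a - 1)).
Proof.
move=> y0; apply: DeriveDef.
  by apply: derivable_powR; rewrite in_itv/= andbT.
by rewrite -derive1E powR_derive1// in_itv/= andbT.
Qed.

Lemma continuous_powR (a y : R) : 0 < y -> {for y, continuous (fun y => y `^ a)}.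
Proof.
move=> y0; apply: differentiable_continuous; apply/derivable1_diffP.
by have [] := is_derive_powR a y0.
Qed.

Lemma powRVy (a : R) : 0 < a -> y `^ (- a) @[y --> +oo] --> 0.
Proof.
move=> a0.
have H : (y : R) `^ a @[y --> +oo] --> +oo.
  apply/cvgryPge => A; near=> y.
  have y0 : 0 <= y by near: y; exact: nbhs_pinfty_ge.
  have hy : (Num.max A 0) `^ a^-1 <= y.
    by near: y; apply: nbhs_pinfty_ge; exact: num_real.
  have := ge0_ler_powR (ltW a0) _ _ hy; rewrite !nnegrE powR_ge0 => /(_ isT y0).
  rewrite -powRrM mulVf ?gt_eqF// powRr1 ?le_max ?lexx ?orbT//.
  by apply: le_trans; rewrite le_max lexx.
under eq_fun do rewrite powRN.
apply/gtr0_cvgV0 => //; near=> y; rewrite powR_gt0//.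
Unshelve. all: by end_near. Qed.

Lemma integral_powR_0x (a x : R) : -1 < a -> 0 < x ->
  (\int[leb]_(y in `]0%R, x]) (y `^ a)%:E = (x `^ (a + 1) / (a + 1))%:E)%E.
Proof.
move=> a1 x0; have a10 : 0 < a + 1 by rewrite -ltrBlDr sub0r.
apply: (@ge0_FTC_0x (fun y => y `^ (a + 1) / (a + 1))) => //.
- move=> y y0; rewrite [X in is_derive _ _ _ X](_ : _ =
    (a + 1)^-1 *: ((a + 1) * y `^ (a + 1 - 1))); last first.
    by rewrite addrK scalerA mulVf ?gt_eqF// scale1r.
  under eq_fun do rewrite mulrC.
  by apply: is_deriveZ; exact: is_derive_powR.
- by move=> y y0; exact: continuous_powR.
- by move=> y _; exact: powR_ge0.
- rewrite -[X in _ --> X](mul0r (a + 1)^-1); apply: cvgM; last exact: cvg_cst.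
  exact: powR_cvg0.
Qed.

Lemma integral_powR_xy (a x : R) : a < -1 -> 0 < x ->
  (\int[leb]_(y in `]x, +oo[) (y `^ a)%:E = (x `^ (a + 1) / - (a + 1))%:E)%E.
Proof.
move=> a1 x0; have a10 : a + 1 < 0 by rewrite -ltrBrDr sub0r.
have -> : x `^ (a + 1) / - (a + 1) = 0 - x `^ (a + 1) / (a + 1).
  by rewrite sub0r invrN mulrN.
apply: (@ge0_FTC_xy (fun y => y `^ (a + 1) / (a + 1))) => //.
- move=> y y0; rewrite [X in is_derive _ _ _ X](_ : _ =
    (a + 1)^-1 *: ((a + 1) * y `^ (a + 1 - 1))); last first.
    by rewrite addrK scalerA mulVf ?lt_eqF// scale1r.
  under eq_fun do rewrite mulrC.
  by apply: is_deriveZ; exact: is_derive_powR.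
- by move=> y y0; exact: continuous_powR.
- by move=> y _; exact: powR_ge0.
- rewrite -[X in _ --> X](mul0r (a + 1)^-1); apply: cvgM; last exact: cvg_cst.
  by rewrite -(opprK (a + 1)); apply: powRVy; rewrite oppr_gt0.
Qed.

End FTC_open.

Section real_integrals.
Context {R : realType}.
Local Notation leb := (@lebesgue_measure R).
Variables (D : set (measurableTypeR R)).
Hypothesis mD : measurable D.
Implicit Types f g : measurableTypeR R -> R.

Lemma ge0_intZl k f : 0 <= k -> measurable_fun D f ->
  (forall x, D x -> 0 <= f x) ->
  (\int[leb]_(x in D) (k * f x)%:E = k%:E * \int[leb]_(x in D) (f x)%:E)%E.
Proof.
move=> k0 mf f0; rewrite -ge0_integralZl_EFin//.
exact/measurable_EFinP.
Qed.

Lemma ge0_le_int f g : measurable_fun D f -> measurable_fun D g ->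
  (forall x, D x -> 0 <= f x <= g x) ->
  (\int[leb]_(x in D) (f x)%:E <= \int[leb]_(x in D) (g x)%:E)%E.
Proof.
move=> mf mg fg; apply: ge0_le_integral => //.
- by move=> x /fg /andP[]; rewrite lee_fin.
- exact/measurable_EFinP.
- exact/measurable_EFinP.
- by move=> x /fg /andP[_]; rewrite lee_fin.
Qed.

End real_integrals.

Lemma measurable_fun_powR {R : realType} (a : R) (D : set (measurableTypeR R)) :
  measurable_fun D (fun y : measurableTypeR R => y `^ a).
Proof. by apply: measurable_funTS; exact: measurable_powR. Qed.

(** * The Gamma function *)

Section scaling.
Context {R : realType}.
Local Notation leb := (@lebesgue_measure R).

(** The constant [c] is free so that the two sides of a dilation by [a] can be exhausted by matching
    half-lines, starting at [a / n.+1] and at [1 / n.+1]. *)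
Lemma cvg_integral_itvcy (f : R -> R) (c : R) : 0 < c ->
  (forall y : R, 0 < y -> {for y, continuous f}) ->
  (forall y, 0 < y -> 0 <= f y) ->
  (\int[leb]_(y in `[(c / n.+1%:R)%R, +oo[) (f y)%:E)%E @[n --> \oo] -->
  (\int[leb]_(y in Rpos) (f y)%:E)%E.
Proof.
move=> c0 cf f0.
have cn n : 0 < c / n.+1%:R by rewrite divr_gt0.
pose D n : set (measurableTypeR R) := `[c / n.+1%:R, +oo[%classic.
have -> : Rpos = \bigcup_n D n.
  apply/seteqP; split=> [y /RposE y0|y [n _]]; rewrite /D/=; last first.
    by rewrite in_itv/= andbT => h; apply/RposE; exact: lt_le_trans h.
  exists (Num.truncn (c / y)) => //=; rewrite in_itv/= andbT.
  by rewrite ler_pdivrMr// mulrC -ler_pdivrMr// ltW// truncnS_gt.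
apply: ge0_nondecreasing_set_cvg_integral.
- apply/nondecreasing_seqP => n; apply/subsetPset => y; rewrite /D/= !in_itv/=.
  rewrite !andbT; apply: le_trans.
  by rewrite ler_pM2l// lef_pV2 ?posrE// ler_nat.
- by move=> i; exact: measurable_itv.
- move=> i; apply/measurable_EFinP; apply: subspace_continuous_measurable_fun.
    exact: measurable_itv.
  apply: continuous_in_subspaceT => y; rewrite inE/= in_itv/= andbT => h.
  by apply: cf; exact: lt_le_trans h.
- move=> i y; rewrite /D/= in_itv/= andbT => h; rewrite lee_fin f0//.
  exact: lt_le_trans h.
Qed.

(** [G] may blow up at 0, so the substitution is made on half-lines that stay away from 0 and the
    limit is taken on both sides. *)
Lemma ge0_integral_scale (G : R -> R) (a : R) : 0 < a ->
  (forall y : R, 0 < y -> {for y, continuous G}) ->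
  (forall y, 0 < y -> 0 <= G y) ->
  (\int[leb]_(y in Rpos) (G y)%:E = \int[leb]_(y in Rpos) (G (a * y) * a)%:E)%E.
Proof.
move=> a0 cG G0.
have H1 := cvg_integral_itvcy a0 cG G0.
have H2 : (\int[leb]_(y in `[(1 / n.+1%:R)%R, +oo[) (G (a * y) * a)%:E)%E
    @[n --> \oo] --> (\int[leb]_(y in Rpos) (G (a * y) * a)%:E)%E.
  apply: cvg_integral_itvcy => //.
  - move=> y y0; apply: cvgM; last exact: cvg_cst.
    apply: (@continuous_comp _ _ _ (fun y => a * y) G).
      by apply: cvgM; [exact: cvg_cst|exact: cvg_id].
    by apply: cG; rewrite mulr_gt0.
  - by move=> y y0; rewrite mulr_ge0 ?G0 ?mulr_gt0// ltW.
apply: (cvg_unique _ H1); rewrite //=; move: H2; apply: cvg_trans.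
apply: near_eq_cvg; apply: nearW => n.
have dF : derive1 (fun y : R => a * y) = cst a.
  by apply/funext => y; rewrite derive1E deriveM// derive_cst derive_id
    scaler0 addr0 /GRing.scale/= mulr1.
have e0 : 0 < 1 / n.+1%:R :> R by rewrite divr_gt0.
have := @increasing_ge0_integration_by_substitutiony R (fun y => a * y) G
  (1 / n.+1%:R).
rewrite dF mulrA mulr1 => ->//.
- by move=> x y _ _ xy; rewrite ltr_pM2l.
- by move=> x _; exact: cst_continuous.
- exact: is_cvg_cst.
- exact: is_cvg_cst.
- split; first by move=> y _; exact: derivableM.
  apply: cvg_at_right_filter; apply: cvgM; [exact: cvg_cst|exact: cvg_id].
- apply/cvgryPge => A; near=> y.
  suff : A / a <= y by rewrite ler_pdivrMr// mulrC.
  by near: y; apply: nbhs_pinfty_ge; exact: num_real.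
- apply: continuous_in_subspaceT => y; rewrite inE/= in_itv/= andbT => h.
  by apply: cG; apply: lt_le_trans h; rewrite divr_gt0.
- move=> y; rewrite in_itv/= andbT => h; apply: G0; apply: lt_trans h.
  by rewrite divr_gt0.
Unshelve. all: by end_near. Qed.

End scaling.

Section Gamma_facts.
Context {R : realType}.
Implicit Types s a u : R.
Local Notation leb := (@lebesgue_measure R).

Let gam s u : R := u `^ (s - 1) * expR (- u).

Let gam_ge0 s u : 0 <= gam s u.
Proof. by rewrite mulr_ge0 ?powR_ge0 ?expR_ge0. Qed.

Let gam_cont s u : 0 < u -> {for u, continuous (gam s)}.
Proof.
move=> u0; apply: cvgM; first exact: continuous_powR.
apply: (@continuous_comp _ _ _ (fun y => - y) expR).
  by apply: cvgN; exact: cvg_id.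
exact: continuous_expR.
Qed.

Let gam_meas s (D : set R) : measurable_fun D (gam s).
Proof.
apply: measurable_funTS; apply: measurable_funM; first exact: measurable_powR.
by apply: measurableT_comp.
Qed.

(** A single term of the exponential series suffices: since [u >= 1], [u ^ b] is at most [u ^ n] for
    the integer [n] just above [|b|]. *)
Lemma powR_le_expR (b u : R) : 1 <= u ->
  u `^ b <= (Num.truncn `|b|).+1`!%:R * expR u.
Proof.
move=> u1; set n := (Num.truncn _).+1.
have u0 : 0 <= u by apply: le_trans u1.
apply: (@le_trans _ _ (u ^+ n)).
  rewrite -powR_mulrn// ler_powR// (le_trans (ler_norm b))//.
  by rewrite ltW// truncnS_gt.
rewrite mulrC -ler_pdivrMr ?ltr0n ?fact_gt0//.
by apply: le_trans (expR_ge1Dxn (Num.truncn `|b|) u0); rewrite lerDr.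
Qed.

Lemma Gamma_integral_lty s : 0 < s ->
  (\int[leb]_(u in Rpos) (u `^ (s - 1) * expR (- u))%:E < +oo)%E.
Proof.
move=> s0.
have RU : Rpos = (`]0, 1] `|` `]1, +oo[)%classic :> set R.
  apply/seteqP; split=> u; rewrite /Rpos/= !in_itv/= ?andbT.
    by move=> ->; case: (leP u 1); [left|right].
  by case=> [/andP[]//|]; apply: lt_trans.
rewrite RU ge0_integral_setU//=; last 3 first.
- by apply/measurable_EFinP; exact: (@gam_meas s).
- by move=> u _; rewrite lee_fin; exact: (@gam_ge0 s).
- apply/disj_setPS => u [/=]; rewrite !in_itv/= andbT => /andP[_ u1] /lt_geF.
  by rewrite u1.
apply: lte_add_pinfty.
  apply: (@le_lt_trans _ _ (\int[leb]_(u in `]0%R, 1%R]) (u `^ (s - 1))%:E)%E).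
    apply: ge0_le_integral => //=.
    - by move=> u _; rewrite lee_fin; exact: (@gam_ge0 s).
    - by apply/measurable_EFinP; exact: (@gam_meas s).
    - by apply/measurable_EFinP/measurable_funTS; exact: measurable_powR.
    - move=> u; rewrite in_itv/= => /andP[u0 _].
      by rewrite lee_fin ler_piMr ?powR_ge0// expR_le1 oppr_le0 ltW.
  by rewrite integral_powR_0x ?ltry//; lra.
(* The constant for [u ^ (s + 1) <= C * expR u]: the two extra powers of [u] leave [u ^ (-2)], which
   is integrable at infinity. *)
pose C : R := (Num.truncn `|s + 1|).+1`!%:R.
apply: (@le_lt_trans _ _
    (\int[leb]_(u in `]1%R, +oo[) (C%:E * (u `^ (- 2%:R))%:E))%E).
  apply: ge0_le_integral => //=.
  - by move=> u _; rewrite lee_fin; exact: (@gam_ge0 s).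
  - by apply/measurable_EFinP; exact: (@gam_meas s).
  - apply: emeasurable_funM => //.
    by apply/measurable_EFinP/measurable_funTS; exact: measurable_powR.
  - move=> u; rewrite in_itv/= andbT => u1.
    rewrite -EFinM lee_fin expRN ler_pdivrMr ?expR_gt0//.
    have u0 : 0 < u by apply: lt_trans u1.
    have -> : s - 1 = (s + 1) + - 2%:R by ring.
    rewrite powRD ?(gt_eqF u0) ?implybT// mulrAC ler_pM2r ?powR_gt0//.
    by apply: powR_le_expR; exact: ltW.
rewrite ge0_integralZl//=; last 3 first.
- by apply/measurable_EFinP/measurable_funTS; exact: measurable_powR.
- by move=> u _; rewrite lee_fin powR_ge0.
- by rewrite lee_fin.
by rewrite integral_powR_xy// ?ltry//; lra.
Qed.

(** [Gamma] is a real-valued integral, which would be 0 if the extended one were infinite;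
    finiteness identifies the two. *)
Lemma GammaE s : 0 < s ->
  (\int[leb]_(u in Rpos) (u `^ (s - 1) * expR (- u))%:E = (Gamma s)%:E)%E.
Proof.
move=> s0; rewrite /Gamma /Rintegral fineK// ge0_fin_numE ?Gamma_integral_lty//.
by apply: integral_ge0 => u _; rewrite lee_fin; exact: (@gam_ge0 s).
Qed.

Lemma Gamma_gt0 s : 0 < s -> 0 < Gamma s.
Proof.
move=> s0; rewrite -lte_fin -GammaE//.
apply: (@lt_le_trans _ _ (\int[leb]_(u in `]0%R, 1%R])
    ((expR (-1))%:E * (u `^ (s - 1))%:E))%E).
  rewrite ge0_integralZl//=; last 2 first.
  - by apply/measurable_EFinP/measurable_funTS; exact: measurable_powR.
  - by move=> u _; rewrite lee_fin powR_ge0.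
  rewrite integral_powR_0x//; last by lra.
  by rewrite -EFinM lte_fin mulr_gt0 ?expR_gt0// powR1 divr_gt0// subrK.
apply: (@le_trans _ _
  (\int[leb]_(u in `]0%R, 1%R]) (u `^ (s - 1) * expR (- u))%:E)%E).
  apply: ge0_le_integral => //=.
  - by move=> u _; rewrite mule_ge0 ?lee_fin ?expR_ge0 ?powR_ge0.
  - apply: emeasurable_funM => //.
    by apply/measurable_EFinP/measurable_funTS; exact: measurable_powR.
  - by apply/measurable_EFinP; exact: (@gam_meas s).
  - move=> u; rewrite in_itv/= => /andP[_ u1].
    by rewrite -EFinM lee_fin mulrC ler_wpM2l ?powR_ge0// ler_expR lerN2.
apply: ge0_subset_integral => //=.
- by apply/measurable_EFinP; exact: (@gam_meas s).
- by move=> u _; rewrite lee_fin; exact: (@gam_ge0 s).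
- by move=> u /=; rewrite in_itv/= => /andP[u0 _]; apply/RposE.
Qed.

Lemma Gamma_scale s a : 0 < s -> 0 < a ->
  (\int[leb]_(u in Rpos) (u `^ (s - 1) * expR (- (a * u)))%:E =
   (Gamma s * a `^ (- s))%:E)%E.
Proof.
move=> s0 a0; rewrite EFinM -GammaE//.
rewrite (@ge0_integral_scale _ (gam s) a)//; last by move=> u; exact: gam_cont.
rewrite -ge0_integralZr//=; last 3 first.
- apply/measurable_EFinP; apply: measurable_funM => //.
  apply: (@measurableT_comp _ _ _ _ _ _ (gam s)); first exact: gam_meas.
  by apply: measurable_funTS; exact: mulrl_measurable.
- by move=> u _; rewrite lee_fin mulr_ge0 ?gam_ge0 ?ltW.
- by rewrite lee_fin powR_ge0.
apply: eq_integral => u /[!inE] /RposE u0; congr EFin.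
have aE : a `^ (s - 1) * a * a `^ (- s) = 1.
  by rewrite [X in X * _]mulrC mulr_powRB1 ?ltW// powRN mulfV// gt_eqF ?powR_gt0.
rewrite /gam powRM ?ltW//; move: aE; set e := s - 1 => aE.
by rewrite -[LHS]mulr1 -aE; ring.
Qed.

(* Integrate [u^s exp(-a u)] over [u > 0] and [a > 1] in both orders. *)
Lemma GammaS s : 0 < s -> Gamma (s + 1) = s * Gamma s.
Proof.
move=> s0; have s10 : 0 < s + 1 by rewrite addr_gt0.
pose f (u a : R) : \bar R := (u `^ s * expR (- (a * u)))%:E.
have f0 u a : (0 <= f u a)%E by rewrite lee_fin mulr_ge0 ?powR_ge0 ?expR_ge0.
have H : (\int[leb]_(u in Rpos) \int[leb]_(a in `]1%R, +oo[) f u a =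
    \int[leb]_(a in `]1%R, +oo[) \int[leb]_(u in Rpos) f u a)%E.
  apply: ge0_tonelli => //.
  apply/measurable_EFinP/measurable_funTS/measurable_funM.
    exact: (measurableT_comp (measurable_powR s) measurable_fst).
  apply: measurableT_comp => //; apply: measurableT_comp => //.
  by apply: measurable_funM; [exact: measurable_snd|exact: measurable_fst].
have H1 : (\int[leb]_(u in Rpos) \int[leb]_(a in `]1%R, +oo[) f u a =
    (Gamma s)%:E)%E.
  rewrite -[RHS](GammaE s0); apply: eq_integral => u /[!inE] /RposE u0.
  have -> : u `^ (s - 1) * expR (- u) =
      0 - - u `^ (s - 1) * expR (- (1 * u)).
    by rewrite mul1r sub0r mulNr opprK.
  apply: (@ge0_FTC_xy _ (fun a => - u `^ (s - 1) * expR (- (a * u)))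
    (fun a => u `^ s * expR (- (a * u))) 1 0).
  - exact: ltr01.
  - move=> a a0; have -> : u `^ s * expR (- (a * u)) =
        - u `^ (s - 1) *: (- u *: expR (- (a * u))).
      rewrite /GRing.scale/= mulrA mulrNN [X in _ = X * _]mulrC.
      by rewrite mulr_powRB1 ?ltW.
    apply: is_deriveZ.
    have h : is_derive a 1 (fun b : R => - (b * u)) (- u).
      rewrite (_ : (fun b => _) = (- u) *: (id : R -> R)); last first.
        by apply/funext => b; change (- (b * u) = - u * b); rewrite mulNr mulrC.
      by rewrite -[X in is_derive _ _ _ X]mulr1; exact: is_deriveZ.
    rewrite /GRing.scale/= mulrC.
    exact: (@is_derive1_comp _ expR (fun b => - (b * u))).
  - move=> a _; apply: cvgM; first exact: cvg_cst.
    apply: (@continuous_comp _ _ _ (fun a => - (a * u)) expR).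
      by apply: cvgN; apply: cvgM; [exact: cvg_id|exact: cvg_cst].
    exact: continuous_expR.
  - by move=> a _; exact: f0.
  - rewrite -[X in _ --> X](mulr0 (- u `^ (s - 1))).
    apply: cvgM; first exact: cvg_cst.
    apply: (@cvg_comp _ _ _ (fun a => a * u) (fun b => expR (- b)) _ +oo).
      apply/cvgryPge => A; near=> y.
      suff : A / u <= y by rewrite ler_pdivrMr.
      by near: y; apply: nbhs_pinfty_ge; exact: num_real.
    exact: cvgr_expR.
have H2 : (\int[leb]_(a in `]1%R, +oo[) \int[leb]_(u in Rpos) f u a =
    (Gamma (s + 1) / s)%:E)%E.
  transitivity (\int[leb]_(a in `]1%R, +oo[)
      ((Gamma (s + 1))%:E * (a `^ (- (s + 1)))%:E))%E.
    apply: eq_integral => a; rewrite inE/= in_itv/= andbT => a1.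
    have a0 : 0 < a by apply: lt_trans a1.
    by rewrite -EFinM -[RHS](Gamma_scale s10 a0) addrK.
  have := Gamma_gt0 s10; move: (Gamma (s + 1)) => g g0.
  under eq_integral do rewrite -EFinM.
  have -> : (\int[leb]_(a in `]1%R, +oo[) (g * a `^ (- (s + 1)))%:E =
      g%:E * \int[leb]_(a in `]1%R, +oo[) (a `^ (- (s + 1)))%:E)%E.
    apply: ge0_intZl.
    - exact: measurable_itv.
    - exact: ltW.
    - exact: measurable_fun_powR.
    - by move=> u _; exact: powR_ge0.
  rewrite integral_powR_xy; [|by lra|exact: ltr01].
  rewrite -EFinM powR1; congr (_ * _)%:E.
  by rewrite div1r; congr (_^-1); ring.
move: H; rewrite H1 H2 => -[->].
by rewrite mulrCA mulfV ?mulr1// gt_eqF.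
Unshelve. all: by end_near. Qed.

End Gamma_facts.

(** * The series of the Poisson kernel *)

Section poisson_coefficients.
Context {R : realType}.
Variable mu : R.
Hypothesis mu_gt : -1 < mu.

(** The outcome of integrating the [k]-th Bessel term, of degree [mu + 2 k] in [u], against the
    subordination density. The [3 / 2] collects 1 from the time factor of the heat kernel, -1/2 from
    [1 / sqrt u] and 1 from the shift in the Gamma integral. *)
Definition poisson_coeff (k : nat) : R :=
  Gamma (mu + 2 * k%:R + 3 / 2) / (k`!%:R * Gamma (mu + k%:R + 1)).

Lemma GammaS_arg (k : nat) : 0 < mu + k%:R + 1.
Proof. by have m := mu_gt; have k0 := ler0n R k; lra. Qed.

Lemma poisson_arg (k : nat) : 0 < mu + 2 * k%:R + 3 / 2.
Proof. by have m := mu_gt; have k0 := ler0n R k; lra. Qed.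

Lemma poisson_coeff_gt0 k : 0 < poisson_coeff k.
Proof.
rewrite divr_gt0 ?mulr_gt0 ?ltr0n ?fact_gt0// Gamma_gt0//.
- exact: poisson_arg.
- exact: GammaS_arg.
Qed.

Let b k := poisson_coeff k / 4 ^+ k.

Let b_gt0 k : 0 < b k.
Proof. by rewrite divr_gt0 ?poisson_coeff_gt0// exprn_gt0. Qed.

(** With [m = mu + 2 k + 2], the ratio of consecutive [b] is [(m^2 - 1/4) / (m^2 - mu^2)], whose
    denominator is [4 (k + 1) (k + 1 + mu)]; [kappa] is what remains after subtracting 1. *)
Let kappa := mu ^+ 2 / 4 - 1 / 16.

Let bS k : b k.+1 = b k * (1 + kappa / ((k%:R + 1) * (k%:R + 1 + mu))).
Proof.
have k0 := ler0n R k.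
have A := poisson_arg k; have B := GammaS_arg k.
have B1 : 0 < k%:R + 1 + mu by rewrite addrC addrA.
have E1 : Gamma (mu + 2 * k.+1%:R + 3 / 2) = (mu + 2 * k%:R + 3 / 2 + 1) *
    ((mu + 2 * k%:R + 3 / 2) * Gamma (mu + 2 * k%:R + 3 / 2)).
  rewrite -(GammaS A) -GammaS; last by lra.
  by congr Gamma; rewrite -natr1; ring.
have E2 : Gamma (mu + k.+1%:R + 1) = (mu + k%:R + 1) * Gamma (mu + k%:R + 1).
  by rewrite -(GammaS B); congr Gamma; rewrite -natr1; ring.
have G2 := Gamma_gt0 B.
rewrite /b /poisson_coeff E1 E2 factS natrM exprS -natr1 /kappa.
have F := fact_gt0 k; rewrite -(ltr0n R) in F.
have P4 : 0 < 4 ^+ k :> R by exact: exprn_gt0.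
move: G2 F P4; move: (Gamma _) (Gamma _) (k`!%:R) (4 ^+ k) => g1 g2 h q.
move=> g20 h0 q0.
clear E1 E2.
field.
by rewrite !gt_eqF//=; lra.
Qed.

(** Replaces the denominator by a telescoping one, using [mu > -1]. At [k = 0] the left product
    vanishes, so the estimates of [b] start from [b 1]. *)
Let den_ge (k : nat) : (0 < k)%N ->
  (0 : R) < k%:R * (k%:R + 1) <= (k%:R + 1) * (k%:R + 1 + mu).
Proof.
move=> k0; have : 1 <= k%:R :> R by rewrite ler1n.
by have m := mu_gt; move: (k%:R : R) => x x1; apply/andP; split; nra.
Qed.

(** For [k >= 1], the sum of [1 / (j (j + 1))] over [1 <= j < k] in closed form. *)
Let e_ (k : nat) : R := 1 - k%:R^-1.

Let e_S k : (0 < k)%N -> e_ k.+1 = e_ k + (k%:R * (k%:R + 1))^-1.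
Proof.
move=> k0; have k1 : 0 < k%:R :> R by rewrite ltr0n.
rewrite /e_ -natr1; field.
by rewrite !gt_eqF//=; lra.
Qed.

Let e_le1 k : e_ k <= 1.
Proof. by rewrite /e_ gerBl invr_ge0. Qed.

(* Since [kappa >= -1/16] and the sum of the [1 / (k (k + 1))] telescopes, the
   consecutive ratios multiply up to a bounded factor. *)
Let b_lower k : b 1%N * (1 - e_ k.+1 / 16) <= b k.+1.
Proof.
elim: k => [|k IH]; first by rewrite /e_ invr1 subrr mul0r subr0 mulr1.
have /andP[d0 dD] := @den_ge k.+1 isT.
rewrite (bS k.+1) (e_S (ltn0Sn k)); set d := _ * _ in d0 dD *.
set D := _ * _ in dD *.
have D0 : 0 < D by exact: lt_le_trans dD.
have H : 1 - d^-1 / 16 <= 1 + kappa / D.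
  have h1 : - (D^-1 / 16) <= kappa / D.
    rewrite mulrC -mulNr ler_pM2r ?invr_gt0// /kappa.
    by have m2 := sqr_ge0 mu; lra.
  have h2 : D^-1 <= d^-1 by rewrite lef_pV2.
  by lra.
have d1 : d^-1 <= 1.
  rewrite invf_le1// /d; have : 1 <= k.+1%:R :> R by rewrite ler1n.
  by move: (k.+1%:R : R) => x x1; nra.
have di : 0 < d^-1 by rewrite invr_gt0.
(* The product of the two lower bounds exceeds the wanted linear one by the cross term of
   [e_ k.+1 / 16] and [d^-1 / 16], which is nonnegative. *)
apply: (le_trans _ (ler_pM _ _ IH H)); last 2 first.
- by have b1 := b_gt0 1; rewrite mulr_ge0 ?ltW//; have e1 := e_le1 k.+1; lra.
- by lra.
rewrite -[leRHS]mulrA; apply: ler_wpM2l; first exact: ltW.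
have : 0 <= e_ k.+1 by rewrite /e_ subr_ge0 invf_le1// ler1n.
by move: (d^-1) (e_ _) d1 di => *; nra.
Qed.

(** Each ratio is at most [1 + |kappa| / d <= expR (|kappa| / d)], whatever the sign of [kappa], and
    the exponents telescope. *)
Let b_upper k : b k.+1 <= b 1%N * expR (`|kappa| * e_ k.+1).
Proof.
elim: k => [|k IH]; first by rewrite /e_ invr1 subrr mulr0 expR0 mulr1.
have /andP[d0 dD] := @den_ge k.+1 isT.
rewrite (bS k.+1) (e_S (ltn0Sn k)); set d := _ * _ in d0 dD *.
set D := _ * _ in dD *.
have D0 : 0 < D by exact: lt_le_trans dD.
rewrite [X in expR X]mulrDr expRD mulrA.
apply: (@le_trans _ _ (b k.+1 * expR (`|kappa| / d))); last first.
  by rewrite ler_wpM2r ?expR_ge0.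
apply: ler_wpM2l; first exact: ltW.
apply: (le_trans _ (expR_ge1Dx _)); rewrite lerD2l.
apply: (@le_trans _ _ (`|kappa| / D)).
  by rewrite ler_pM2r ?invr_gt0// ler_norm.
by rewrite ler_wpM2l// lef_pV2.
Qed.

Lemma poisson_coeff_bounds : exists c C : R, [/\ 0 < c, 0 < C &
  forall k, c * 4 ^+ k <= poisson_coeff k <= C * 4 ^+ k].
Proof.
(* [b 0] is kept apart because the telescoping starts at 1; 15/16 is [1 - e_ / 16] at the largest
   possible value 1 of [e_]. *)
exists (Num.min (b 0%N) (b 1%N * (15 / 16))).
exists (Num.max (b 0%N) (b 1%N * expR `|kappa|)); split.
- by rewrite lt_min b_gt0 mulr_gt0 ?b_gt0//; lra.
- by rewrite lt_max b_gt0.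
move=> k; have P4 : 0 < 4 ^+ k :> R by exact: exprn_gt0.
rewrite -ler_pdivlMr// -[X in _ && X]ler_pdivrMr// -/(b k).
case: k => [|k] in P4 *; first by rewrite ge_min le_max !lexx.
apply/andP; split.
- rewrite ge_min; apply/orP; right; apply: le_trans (b_lower k).
  by apply: ler_wpM2l; [exact: ltW|have e1 := e_le1 k.+1; lra].
- rewrite le_max; apply/orP; right; apply: le_trans (b_upper k) _.
  apply: ler_wpM2l; [exact: ltW|rewrite ler_expR].
  by rewrite -[leRHS]mulr1 ler_wpM2l.
Qed.

(** Up to the factor [Gamma (mu + 3/2) / Gamma (mu + 1)], the Gauss hypergeometric function with
    upper parameters [mu / 2 + 3/4] and [mu / 2 + 5/4] and lower parameter [mu + 1], at [4 r]. The
    lower parameter minus the upper ones is -1, hence the growth like [1 / (1 - 4 r)]. *)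
Definition poisson_series (r : R) : R :=
  limn (series (fun k => poisson_coeff k * r ^+ k)).

Lemma is_cvg_poisson_series (r : R) : `|r| < 1 / 4 ->
  cvgn (series (fun k => poisson_coeff k * r ^+ k)).
Proof.
move=> r14; have [c [C [_ C0 cC]]] := poisson_coeff_bounds.
apply: normed_cvg.
apply: (@series_le_cvg _ _ (fun k => C * (4 * `|r|) ^+ k)).
- by move=> k /=.
- by move=> k; rewrite mulr_ge0 ?exprn_ge0 ?mulr_ge0// ltW.
- move=> k /=; rewrite normrM normrX exprMn mulrA.
  rewrite ler_wpM2r ?exprn_ge0// gtr0_norm ?poisson_coeff_gt0//.
  by have /andP[] := cC k.
- by apply: is_cvg_geometric_series; rewrite ger0_norm ?mulr_ge0//; lra.
Qed.

Lemma poisson_series_bounds : exists c C : R, [/\ 0 < c, 0 < C &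
  forall r, 0 <= r -> r < 1 / 4 ->
  c / (1 - 4 * r) <= poisson_series r <= C / (1 - 4 * r)].
Proof.
have [c [C [c0 C0 cC]]] := poisson_coeff_bounds; exists c, C; split => // r r0 r14.
have cv := @is_cvg_poisson_series r.
rewrite ger0_norm// in cv; have {}cv := cv r14.
have n4 : `|4 * r| < 1 by rewrite ger0_norm ?mulr_ge0//; lra.
have geo (d : R) : series (fun k => d * (4 * r) ^+ k) @ \oo --> d / (1 - 4 * r).
  exact: cvg_geometric_series.
rewrite -(cvg_lim _ (geo c))// -(cvg_lim _ (geo C))//; apply/andP; split.
- apply: lim_series_le => //; first by apply/cvg_ex; eexists; exact: geo.
  move=> k; rewrite exprMn mulrA ler_wpM2r ?exprn_ge0//.
  by have /andP[] := cC k.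
- apply: lim_series_le => //; first by apply/cvg_ex; eexists; exact: geo.
  move=> k; rewrite exprMn mulrA ler_wpM2r ?exprn_ge0//.
  by have /andP[] := cC k.
Qed.

(** A Lipschitz bound for the [k]-th power in which the factor [k] is traded for the larger base
    [K']; summed against the coefficients it gives the series at [K']. *)
Let exprn_lip (r t K K' : R) (k : nat) : 0 <= r <= K -> 0 <= t <= K ->
  K < K' -> `|t ^+ k - r ^+ k| * (K' - K) <= K' ^+ k * `|t - r|.
Proof.
move=> /andP[r0 rK] /andP[t0 tK] KK'; have K0 : 0 <= K by apply: le_trans rK.
elim: k => [|k IH].
  by rewrite !expr0 subrr normr0 mul0r mul1r normr_ge0.
have -> : t ^+ k.+1 - r ^+ k.+1 = t * (t ^+ k - r ^+ k) + r ^+ k * (t - r).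
  by rewrite !exprS; ring.
have kk : 0 <= K' - K by lra.
apply: le_trans (ler_wpM2r kk (ler_normD _ _)) _.
rewrite !normrM (ger0_norm t0) (ger0_norm (exprn_ge0 _ r0)) mulrDl -mulrA.
have h1 : t * (`|t ^+ k - r ^+ k| * (K' - K)) <= K * (K' ^+ k * `|t - r|).
  by apply: ler_pM => //; rewrite mulr_ge0.
have h2 : r ^+ k * `|t - r| * (K' - K) <= K' ^+ k * `|t - r| * (K' - K).
  by rewrite ler_wpM2r// ler_wpM2r// lerXn2r// ?nnegrE; lra.
by rewrite exprS; lra.
Qed.

(** Two intermediate radii [r < K < K' < 1/4] make the series Lipschitz on [[0, K]] with constant
    [L]. This yields the continuity of the Poisson kernel in [x], on which all measurability below
    rests. *)
Lemma continuous_poisson_series (r : R) : 0 < r < 1 / 4 ->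
  {for r, continuous poisson_series}.
Proof.
move=> /andP[r0 r14].
pose K : R := (r + 1 / 4) / 2; pose K' : R := (K + 1 / 4) / 2.
have rK : r < K by rewrite /K; lra.
have KK' : K < K' by rewrite /K' /K; lra.
have K'14 : K' < 1 / 4 by rewrite /K' /K; lra.
pose L := poisson_series K' / (K' - K).
have rb : 0 <= r <= K by apply/andP; split; lra.
have lip (x y : R) : 0 <= x <= K -> 0 <= y <= K ->
    poisson_series x <= poisson_series y + `|x - y| / (K' - K) * poisson_series K'.
  move=> xK yK; have nx (z : R) : 0 <= z <= K' -> `|z| < 1 / 4.
    by move=> /andP[z0 zK]; rewrite ger0_norm//; lra.
  have cx := is_cvg_poisson_series (nx x _).
  have cy := is_cvg_poisson_series (nx y _).
  have cK := is_cvg_poisson_series (nx K' _).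
  have {}cx := cx ltac:(lra); have {}cy := cy ltac:(lra).
  have {}cK := cK ltac:(lra).
  set c := `|x - y| / (K' - K).
  have cZ := @is_cvg_seriesZ _ _ c cK.
  rewrite /poisson_series -[c * _]/(c *: _) -(@lim_seriesZ _ _ c cK).
  rewrite -(lim_seriesD cy cZ).
  apply: lim_series_le => //; first exact: is_cvg_seriesD.
  move=> k; rewrite !fctE /=.
  have a0 := ltW (poisson_coeff_gt0 k).
  have h := exprn_lip k yK xK KK'.
  have h1 : `|x ^+ k - y ^+ k| <= K' ^+ k * (`|x - y| / (K' - K)).
    by rewrite mulrA ler_pdivlMr// subr_gt0.
  have h2 := le_trans (ler_norm _) h1.
  rewrite /GRing.scale/= mulrCA -mulrDr ler_wpM2l//.
  by rewrite /c; lra.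
have PK : 0 <= poisson_series K'.
  have [c [C [c0 _ /(_ K' ltac:(lra) ltac:(lra)) /andP[h _]]]] :=
    poisson_series_bounds.
  by apply: le_trans h; rewrite divr_ge0 ?ltW//; lra.
have L0 : 0 <= L by rewrite divr_ge0//; lra.
apply/cvgrPdist_le => e e0; near=> x.
have x0 : 0 < x by near: x; exact: lt_nbhsr.
have xK : x < K by near: x; exact: lt_nbhsl.
have dx : `|r - x| <= e / (L + 1).
  near: x; apply/nbhs_ballP; exists (e / (L + 1)).
    by rewrite /= divr_gt0//; lra.
  by move=> x; rewrite /ball/= => /ltW.
have xb : 0 <= x <= K by rewrite !ltW.
have l1 := lip r x rb xb.
have l2 := lip x r xb rb.
rewrite distrC in l2.
have h : `|r - x| / (K' - K) * poisson_series K' <= e.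
  rewrite -mulrA [_^-1 * _]mulrC -/L.
  apply: le_trans (ler_wpM2r L0 dx) _.
  by rewrite mulrAC ler_pdivrMr ?ltr_wpDl// ler_pM2l// lerDl.
rewrite ler_distl lerBlDr; apply/andP; split.
  by apply: le_trans l2 _; rewrite lerD2l.
by apply: le_trans l1 _; rewrite lerD2l.
Unshelve. all: by end_near. Qed.

End poisson_coefficients.

(** * Closed form of the Poisson kernel *)

Section poisson_kernel.
Context {R : realType}.
Local Notation leb := (@lebesgue_measure R).

Lemma EFin_limn_series (f : R^nat) : cvgn (series f) ->
  (\sum_(k <oo) (f k)%:E = (limn (series f))%:E)%E.
Proof.
move=> cf; rewrite -EFin_lim//; congr (limn _); apply/funext => n.
by rewrite /= /series/= sumEFin.
Qed.

(** From index 1 on the factor in [GammaS] is at least 1, so the values no longer decrease. A crude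
    bound is enough: in the Bessel series the factorial alone forces convergence. *)
Lemma Gamma_nat_lower_bound (mu : R) : -1 < mu ->
  exists2 m : R, 0 < m & forall k : nat, m <= Gamma (mu + k%:R + 1).
Proof.
move=> mu1; have A (k : nat) : 0 < mu + k%:R + 1 by have k0 := ler0n R k; lra.
have A1 (k : nat) : 1 <= mu + k.+1%:R + 1.
  by have k0 := ler0n R k; rewrite -natr1; lra.
suff [g gE] : exists g : nat -> R, forall k : nat, Gamma (mu + k%:R + 1) = g k.
  have g0 k : 0 < g k by rewrite -gE; exact: Gamma_gt0.
  have gS k : g k.+2 = (mu + k.+1%:R + 1) * g k.+1.
    by rewrite -!gE -(GammaS (A k.+1)) -[in LHS]natr1 !addrA.
  exists (Num.min (g 0%N) (g 1%N)); first by rewrite lt_min !g0.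
  move=> k; rewrite gE ge_min; case: k => [|k]; first by rewrite lexx.
  apply/orP; right; elim: k => [//|k IH]; apply: (le_trans IH).
  by rewrite gS ler_peMl// ltW.
by exists (fun k : nat => Gamma (mu + k%:R + 1)).
Qed.

Lemma is_cvg_bessel_I (mu z : R) : -1 < mu -> 0 < z ->
  cvgn (series (fun k : nat =>
    (z / 2) `^ (mu + 2 * k%:R) / (k`!%:R * Gamma (mu + k%:R + 1)))).
Proof.
move=> mu1 z0; have z20 : 0 < z / 2 by rewrite divr_gt0.
have [m m0 mG] := Gamma_nat_lower_bound mu1.
have G0 k : 0 < Gamma (mu + k%:R + 1) by exact: lt_le_trans (mG k).
have F0 (k : nat) : 0 < k`!%:R :> R by rewrite ltr0n fact_gt0.
pose c : R := (z / 2) `^ mu / m.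
apply: (@series_le_cvg _ _ (c *: exp_coeff ((z / 2) ^+ 2))).
- by move=> k; rewrite divr_ge0 ?powR_ge0// mulr_ge0 ?ltW.
- move=> k; rewrite !fctE /GRing.scale/= mulr_ge0 ?divr_ge0 ?powR_ge0 ?ltW//.
  by rewrite !exprn_gt0.
- move=> k; rewrite !fctE /GRing.scale/= /exp_coeff/= powRD; last first.
    by rewrite (gt_eqF z20) implybT.
  have -> : (z / 2) `^ (2 * k%:R) = (z / 2) ^+ 2 ^+ k.
    by rewrite -natrM powR_mulrn ?ltW// exprM.
  rewrite /c invfM [leRHS]mulrACA [X in _ <= _ * X]mulrC -mulrA.
  rewrite -[leRHS]mulrA; apply: ler_wpM2l; first exact: powR_ge0.
  apply: ler_wpM2l; first by rewrite !exprn_ge0 ?ltW.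
  apply: ler_wpM2l; first by rewrite invr_ge0 ltW.
  by rewrite lef_pV2 ?posrE.
- exact/is_cvg_seriesZ/is_cvg_series_exp_coeff.
Qed.

(** Isolates the dependence on [u]. At time [t^2 / (4 u)] the Gaussian becomes
    [expR (- (x^2 + y^2) u / t^2)] and merges with [expR (- u)], so that every term is a Gamma
    integrand of the same scale. *)
Lemma exotic_heatE (nu t x y u : R) : nu < 1 -> 0 < t -> 0 < x -> 0 < y ->
  0 < u ->
  ((exotic_heat nu (t ^+ 2 / (4 * u)) x y * expR (- u) / Num.sqrt u)%:E =
  \sum_(k <oo)
   ((x * y) `^ (- nu) * (2 / t ^+ 2) * (x * y / t ^+ 2) `^ (- nu + 2 * k%:R) /
     (k`!%:R * Gamma (- nu + k%:R + 1)) *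
     (u `^ (- nu + 2 * k%:R + 3 / 2 - 1) *
      expR (- ((t ^+ 2 + x ^+ 2 + y ^+ 2) / t ^+ 2 * u)))) %:E)%E.
Proof.
move=> nu1 t0 x0 y0 u0; have xy0 : 0 < x * y by rewrite mulr_gt0.
have t20 : 0 < t ^+ 2 by rewrite exprn_gt0.
rewrite /exotic_heat /bessel_heat opprK.
set z := x * y / (2 * (t ^+ 2 / (4 * u))).
have zE : z / 2 = u * (x * y / t ^+ 2).
  by rewrite /z; move: (t ^+ 2) t20 => q q0; field; rewrite !gt_eqF.
have z0 : 0 < z by rewrite divr_gt0// mulr_gt0// divr_gt0// mulr_gt0.
have mu1 : -1 < - nu by rewrite ltrN2.
have cv := is_cvg_bessel_I mu1 z0.
set c := (x * y) `^ (- (2 * nu)) *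
  ((2 * (t ^+ 2 / (4 * u)))^-1 * (x * y) `^ nu *
  expR (- ((x ^+ 2 + y ^+ 2) / (4 * (t ^+ 2 / (4 * u)))))) *
  expR (- u) / Num.sqrt u.
transitivity (c * bessel_I (- nu) z)%:E; first by congr EFin; rewrite /c; ring.
rewrite /bessel_I -[c * _]/(c *: _) -(@lim_seriesZ _ _ c cv).
rewrite -EFin_limn_series; last exact: is_cvg_seriesZ.
apply: eq_eseriesr => k _; congr EFin; rewrite !fctE /GRing.scale/=.
rewrite zE (powRM _ (ltW u0)); last by rewrite ltW// divr_gt0.
have E1 : expR (- ((t ^+ 2 + x ^+ 2 + y ^+ 2) / t ^+ 2 * u)) =
    expR (- ((x ^+ 2 + y ^+ 2) / (4 * (t ^+ 2 / (4 * u))))) * expR (- u).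
  rewrite -expRD; congr expR; move: (t ^+ 2) t20 (x ^+ 2) (y ^+ 2) => q q0 a b.
  by field; rewrite !gt_eqF.
have E2 : u `^ (- nu + 2 * k%:R + 3 / 2 - 1) =
    u `^ (- nu + 2 * k%:R) * u / Num.sqrt u.
  rewrite (_ : - nu + 2 * k%:R + 3 / 2 - 1 = - nu + 2 * k%:R + 1 + - 2^-1).
    by rewrite 2?powRD ?(gt_eqF u0) ?implybT// powRr1 ?ltW// powRN powR12_sqrt ?ltW.
  by field.
have E3 : (x * y) `^ (- nu) = (x * y) `^ (- (2 * nu)) * (x * y) `^ nu.
  by rewrite -powRD ?(gt_eqF xy0) ?implybT//; congr powR; ring.
have E4 : (2 * (t ^+ 2 / (4 * u)))^-1 = 2 / t ^+ 2 * u.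
  by move: (t ^+ 2) t20 => q q0; field; rewrite !gt_eqF.
rewrite E1 E2 E3 /c E4.
move: (powR _ _) (powR _ _) (powR _ _) (powR _ _) (expR _) (expR _) => a1 a2 a3 a4 e1 e2.
move: (_^-1) (_^-1) => i1 i2; ring.
Qed.

Lemma exotic_poisson_int (nu t x y : R) : nu < 1 -> 0 < t -> 0 < x -> 0 < y ->
  (\int[leb]_(u in Rpos)
    (exotic_heat nu (t ^+ 2 / (4 * u)) x y * expR (- u) / Num.sqrt u)%:E =
  (2 * (x * y) `^ (- (2 * nu)) * t * (t ^+ 2 + x ^+ 2 + y ^+ 2) `^ (nu - 3 / 2) *
   poisson_series (- nu) ((x * y / (t ^+ 2 + x ^+ 2 + y ^+ 2)) ^+ 2))%:E)%E.
Proof.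
move=> nu1 t0 x0 y0; have xy0 : 0 < x * y by rewrite mulr_gt0.
have t20 : 0 < t ^+ 2 by rewrite exprn_gt0.
have x20 : 0 < x ^+ 2 by rewrite exprn_gt0.
have y20 : 0 < y ^+ 2 by rewrite exprn_gt0.
set S := t ^+ 2 + x ^+ 2 + y ^+ 2.
have S0 : 0 < S by rewrite !addr_gt0.
have mu1 : -1 < - nu by rewrite ltrN2.
set p := x * y / t ^+ 2; have p0 : 0 < p by rewrite divr_gt0.
set q := S / t ^+ 2; have q0 : 0 < q by rewrite divr_gt0.
pose D k := (x * y) `^ (- nu) * (2 / t ^+ 2) * p `^ (- nu + 2 * k%:R) /
     (k`!%:R * Gamma (- nu + k%:R + 1)).
have D0 k : 0 <= D k.
  rewrite !mulr_ge0 ?powR_ge0 ?invr_ge0 ?ltW ?mulr_gt0 ?ltr0n ?fact_gt0 ?divr_gt0//.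
  by apply: Gamma_gt0; have k0 := ler0n R k; lra.
pose h k u := u `^ (- nu + 2 * k%:R + 3 / 2 - 1) * expR (- (q * u)).
have mh k : measurable_fun Rpos (h k).
  apply: measurable_funM; first exact: measurable_fun_powR.
  apply: measurableT_comp => //; apply: measurableT_comp => //.
transitivity (\int[leb]_(u in Rpos) \sum_(k <oo) (D k * h k u)%:E)%E.
  by apply: eq_integral => u /[!inE] /RposE u0; exact: exotic_heatE.
rewrite integral_nneseries//=; last 2 first.
- by move=> k; apply/measurable_EFinP; exact: (measurable_funM (measurable_cst (D k)) (mh k)).
- by move=> k u _; rewrite lee_fin mulr_ge0// mulr_ge0 ?powR_ge0 ?expR_ge0.
set B := 2 * _ * t * _; set r := (_ / S) ^+ 2.
have r14 : `|r| < 1 / 4.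
  rewrite ger0_norm ?sqr_ge0// /r expr_div_n ltr_pdivrMr ?exprn_gt0//.
  have xyS : 2 * (x * y) < S by have h1 := sqr_ge0 (x - y); rewrite /S; nra.
  by nra.
have cv := is_cvg_poisson_series mu1 r14.
rewrite /poisson_series -[B * _]/(B *: _) -(@lim_seriesZ _ _ B cv).
rewrite -EFin_limn_series; last exact: is_cvg_seriesZ.
apply: eq_eseriesr => k _.
have A := poisson_arg mu1 k.
transitivity ((D k)%:E * (Gamma (- nu + 2 * k%:R + 3 / 2) *
    q `^ (- (- nu + 2 * k%:R + 3 / 2)))%:E)%E.
  rewrite -(Gamma_scale A q0).
  apply: ge0_intZl; [exact: mRpos|exact: D0|exact: mh|].
  by move=> u _; rewrite mulr_ge0 ?powR_ge0 ?expR_ge0.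
rewrite -EFinM; congr EFin; rewrite !fctE /GRing.scale/= /D /poisson_coeff.
have q_ : q `^ (- (- nu + 2 * k%:R + 3 / 2)) =
    q `^ (nu - 3 / 2) / q ^+ (2 * k).
  rewrite -powR_mulrn ?ltW// -powRN -powRD ?(gt_eqF q0) ?implybT//.
  by congr powR; rewrite natrM; ring.
have p_ : p `^ (- nu + 2 * k%:R) = p `^ (- nu) * p ^+ (2 * k).
  rewrite -powR_mulrn ?ltW// -powRD ?(gt_eqF p0) ?implybT//.
  by congr powR; rewrite natrM; ring.
have r_ : r ^+ k = p ^+ (2 * k) / q ^+ (2 * k).
  rewrite /r -exprM -expr_div_n; congr (_ ^+ _).
  by rewrite /p /q invf_div mulrA divfK// gt_eqF.
have B_ : B = (x * y) `^ (- nu) * (2 / t ^+ 2) * p `^ (- nu) * q `^ (nu - 3 / 2).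
  have -> : p `^ (- nu) = (x * y) `^ (- nu) * t `^ (2 * nu).
    rewrite /p [LHS]powRM ?ltW// ?invr_gt0//; congr (_ * _).
    by rewrite -powR_inv1 ?ltW// -powR_mulrn ?ltW// -!powRrM; congr powR; ring.
  have -> : q `^ (nu - 3 / 2) = S `^ (nu - 3 / 2) * (t `^ (- (2 * nu)) * t ^+ 3).
    rewrite /q [LHS]powRM ?ltW// ?invr_gt0//; congr (_ * _).
    rewrite -powR_inv1 ?ltW// -!powR_mulrn ?ltW// -!powRrM.
    by rewrite -powRD ?(gt_eqF t0) ?implybT//; congr powR; field.
  have E3 : (x * y) `^ (- (2 * nu)) = (x * y) `^ (- nu) * (x * y) `^ (- nu).
    by rewrite -powRD ?(gt_eqF xy0) ?implybT//; congr powR; ring.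
  (* The [nu]-dependent powers of [t] cancel; the remaining [t ^ 3 / t ^ 2] is the single factor [t]
     in [B]. *)
  have tt : t `^ (2 * nu) * t `^ (- (2 * nu)) = 1.
    by rewrite -powRD ?(gt_eqF t0) ?implybT// subrr powRr0.
  rewrite /B E3; move: tt.
  move: (t `^ (2 * nu)) (t `^ (- (2 * nu))) (powR (x * y) _) (powR S _) => c d a b.
  move=> cd; transitivity (2 * (a * a) * t * b * (c * d)); first by rewrite cd mulr1.
  by field; rewrite gt_eqF.
rewrite q_ p_ r_ B_.
move: (powR _ _) (powR _ _) (powR _ _) (Gamma _) (_^-1) (_^-1) => *; ring.
Qed.

Lemma exotic_poissonE (nu t x y : R) : nu < 1 -> 0 < t -> 0 < x -> 0 < y ->
  exotic_poisson nu t x y = (Num.sqrt pi)^-1 *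
  (2 * (x * y) `^ (- (2 * nu)) * t * (t ^+ 2 + x ^+ 2 + y ^+ 2) `^ (nu - 3 / 2) *
   poisson_series (- nu) ((x * y / (t ^+ 2 + x ^+ 2 + y ^+ 2)) ^+ 2)).
Proof.
move=> nu1 t0 x0 y0; rewrite /exotic_poisson; congr (_ * _).
by rewrite /Rintegral (exotic_poisson_int nu1 t0 x0 y0).
Qed.

End poisson_kernel.

(** * The model kernel *)

Ltac pos := solve [repeat first [done | (apply: ltW; done) | apply: powR_gt0
  | apply: powR_ge0 | apply: sqr_ge0 | apply: exprn_gt0 | apply: exprn_ge0
  | rewrite invr_gt0 | rewrite invr_ge0 | apply: ltr_pwDl | apply: addr_ge0
  | apply: mulr_gt0 | apply: mulr_ge0 | lra]].

Section power_inequalities.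
Context {R : realType}.
Implicit Types a s x y : R.

Lemma ler_powRn a x y : a <= 0 -> 0 < x -> x <= y -> y `^ a <= x `^ a.
Proof.
move=> a0 x0 xy; have y0 := lt_le_trans x0 xy.
rewrite -(opprK a) !(powRN _ (- a)) lef_pV2 ?posrE ?powR_gt0//.
by apply: ge0_ler_powR; rewrite ?nnegrE ?oppr_ge0//; exact: ltW.
Qed.

Lemma powR_sqr a x : 0 < x -> (x ^+ 2) `^ a = x `^ (2 * a).
Proof. by move=> x0; rewrite -powR_mulrn ?ltW// -powRrM. Qed.

End power_inequalities.

Section model_kernel.
Context {R : realType}.
Variable nu : R.
Hypothesis nu_lt1 : nu < 1.
Implicit Types t x y : R.

Definition model_kernel t x y : R :=
  x `^ (- (2 * nu)) * (t * y / (t ^+ 2 + (x - y) ^+ 2)) *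
  (t ^+ 2 + x ^+ 2 + y ^+ 2) `^ (nu - 1 / 2).

(** The model kernel with [t^2 + (x - y)^2] replaced by [t^2 + x^2 + y^2]. It has no singularity on
    the diagonal, bounds the model kernel below everywhere up to a factor 2, and is comparable with
    it away from the diagonal. *)
Definition far_kernel t x y : R :=
  x `^ (- (2 * nu)) * (t * y) * (t ^+ 2 + x ^+ 2 + y ^+ 2) `^ (nu - 3 / 2).

Let S_gt0 t x y : 0 < t -> 0 < t ^+ 2 + x ^+ 2 + y ^+ 2.
Proof.
move=> t0; rewrite -addrA ltr_pwDl ?exprn_gt0//.
by rewrite addr_ge0 ?sqr_ge0.
Qed.

Let d_gt0 t x y : 0 < t -> 0 < t ^+ 2 + (x - y) ^+ 2.
Proof. by move=> t0; rewrite ltr_pwDl ?exprn_gt0 ?sqr_ge0. Qed.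

Lemma model_kernel_ge0 t x y : 0 < t -> 0 <= y -> 0 <= model_kernel t x y.
Proof. by move=> t0 y0; rewrite /model_kernel; pos. Qed.

Lemma model_far t x y : 0 < t ->
  model_kernel t x y = far_kernel t x y *
    ((t ^+ 2 + x ^+ 2 + y ^+ 2) / (t ^+ 2 + (x - y) ^+ 2)).
Proof.
move=> t0; rewrite /model_kernel /far_kernel.
have S0 := S_gt0 x y t0; set S := _ + y ^+ 2 in S0 *.
rewrite (_ : nu - 1 / 2 = (nu - 3 / 2) + 1); last by field.
rewrite powRD ?(gt_eqF S0) ?implybT// powRr1 ?ltW//; ring.
Qed.

Lemma far_kernel_ge0 t x y : 0 < t -> 0 <= y -> 0 <= far_kernel t x y.
Proof. by move=> t0 y0; rewrite /far_kernel; pos. Qed.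

Lemma model_ge_far t x y : 0 < t -> 0 <= y ->
  far_kernel t x y / 2 <= model_kernel t x y.
Proof.
move=> t0 y0; rewrite model_far//; apply: ler_wpM2l; first exact: far_kernel_ge0.
rewrite ler_pdivlMr ?d_gt0//.
have h1 := sqr_ge0 (x + y); have h2 := sqr_ge0 t; nra.
Qed.

Lemma model_le_far t x y : 0 < t -> 0 <= y -> 0 <= x -> y <= x / 2 \/ 2 * x <= y ->
  model_kernel t x y <= 5 * far_kernel t x y.
Proof.
move=> t0 y0 x0 h; rewrite model_far// mulrC; apply: ler_wpM2r.
  exact: far_kernel_ge0.
(* The factor 5 is sharp for [y = x / 2]: there [x^2 + y^2] equals [5 (x - y)^2]. The case
   [2 x <= y] is symmetric. *)
rewrite ler_pdivrMr ?d_gt0//; have h2 := sqr_ge0 t.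
by case: h => h; nra.
Qed.

(** A factor [S ^ (1/2)] absorbs [t]; the remaining exponent [nu - 1] is negative, so [S] may be
    lowered to [x^2], or to [y^2] in [far_le_above]. This is where the dependence on [t] is given
    up. *)
Lemma far_le_below t x y : 0 < t -> 0 < x -> 0 <= y ->
  far_kernel t x y <= x `^ (- 2) * y.
Proof.
move=> t0 x0 y0; have nu1 := nu_lt1; have S0 := S_gt0 x y t0.
rewrite /far_kernel; set S := _ + y ^+ 2 in S0 *.
have tS : t <= S `^ (1 / 2).
  rewrite div1r (powR12_sqrt (ltW S0)) -[leLHS](ger0_norm (ltW t0)) -sqrtr_sqr.
  by apply: ler_wsqrtr; rewrite /S -addrA lerDl; pos.
have h : t * S `^ (nu - 3 / 2) <= x `^ (2 * nu - 2).
  apply: (@le_trans _ _ (S `^ (nu - 1))).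
    rewrite (_ : nu - 1 = 1 / 2 + (nu - 3 / 2)); last by field.
    rewrite [leRHS]powRD ?(gt_eqF S0) ?implybT//.
    by apply: ler_wpM2r => //; exact: powR_ge0.
  rewrite (_ : 2 * nu - 2 = 2 * (nu - 1)); last by ring.
  rewrite -powR_sqr//; apply: ler_powRn; [lra|exact: exprn_gt0|].
  by rewrite /S; have h1 := sqr_ge0 t; have h2 := sqr_ge0 y; lra.
have -> : x `^ (- 2) = x `^ (- (2 * nu)) * x `^ (2 * nu - 2).
  by rewrite -powRD ?(gt_eqF x0) ?implybT//; congr powR; ring.
have := ler_wpM2l (mulr_ge0 (powR_ge0 x (- (2 * nu))) y0) h.
by congr (_ <= _); ring.
Qed.

Lemma far_le_above t x y : 0 < t -> 0 < y ->
  far_kernel t x y <= x `^ (- (2 * nu)) * y `^ (2 * nu - 1).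
Proof.
move=> t0 y0; have nu1 := nu_lt1; have S0 := S_gt0 x y t0.
rewrite /far_kernel -[leLHS]mulrA; apply: ler_wpM2l; first exact: powR_ge0.
set S := _ + y ^+ 2 in S0 *.
have tS : t <= S `^ (1 / 2).
  rewrite div1r (powR12_sqrt (ltW S0)) -[leLHS](ger0_norm (ltW t0)) -sqrtr_sqr.
  by apply: ler_wsqrtr; rewrite /S -addrA lerDl; pos.
have h : t * S `^ (nu - 3 / 2) <= y `^ (2 * nu - 2).
  apply: (@le_trans _ _ (S `^ (nu - 1))).
    rewrite (_ : nu - 1 = 1 / 2 + (nu - 3 / 2)); last by field.
    rewrite [leRHS]powRD ?(gt_eqF S0) ?implybT//.
    by apply: ler_wpM2r => //; exact: powR_ge0.
  rewrite (_ : 2 * nu - 2 = 2 * (nu - 1)); last by ring.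
  rewrite -powR_sqr//; apply: ler_powRn; [lra|exact: exprn_gt0|].
  by rewrite /S; have h1 := sqr_ge0 t; have h2 := sqr_ge0 x; lra.
have -> : y `^ (2 * nu - 1) = y * y `^ (2 * nu - 2).
  rewrite (_ : 2 * nu - 1 = 1 + (2 * nu - 2)); last by ring.
  by rewrite powRD ?(gt_eqF y0) ?implybT// powRr1 ?ltW.
by rewrite mulrAC [leRHS]mulrC; apply: ler_wpM2r; [exact: ltW|].
Qed.

(** Together with [far_le_long] it keeps the dependence on [t], for use on [y <= t] and [y > t] at
    the endpoint [delta = 2 nu p - 1]. *)
Lemma far_le_short t x y : 0 < t -> 0 <= y ->
  far_kernel t x y <= x `^ (- (2 * nu)) * (t `^ (2 * nu - 2) * y).
Proof.
move=> t0 y0; have nu1 := nu_lt1; have S0 := S_gt0 x y t0.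
rewrite /far_kernel -[leLHS]mulrA; apply: ler_wpM2l; first exact: powR_ge0.
rewrite mulrAC; apply: ler_wpM2r => //.
have -> : t `^ (2 * nu - 2) = t * t `^ (2 * (nu - 3 / 2)).
  rewrite (_ : 2 * nu - 2 = 1 + 2 * (nu - 3 / 2)); last by field.
  by rewrite powRD ?(gt_eqF t0) ?implybT// powRr1 ?ltW.
apply: ler_wpM2l; first exact: ltW.
rewrite -powR_sqr//; apply: ler_powRn; [lra|exact: exprn_gt0|].
by have h1 := sqr_ge0 x; have h2 := sqr_ge0 y; lra.
Qed.

Lemma far_le_long t x y : 0 < t -> 0 < y ->
  far_kernel t x y <= x `^ (- (2 * nu)) * (t * y `^ (2 * nu - 2)).
Proof.
move=> t0 y0; have nu1 := nu_lt1; have S0 := S_gt0 x y t0.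
rewrite /far_kernel -[leLHS]mulrA; apply: ler_wpM2l; first exact: powR_ge0.
rewrite -mulrA; apply: ler_wpM2l; first exact: ltW.
have -> : y `^ (2 * nu - 2) = y * y `^ (2 * (nu - 3 / 2)).
  rewrite (_ : 2 * nu - 2 = 1 + 2 * (nu - 3 / 2)); last by field.
  by rewrite powRD ?(gt_eqF y0) ?implybT// powRr1 ?ltW.
apply: ler_wpM2l; first exact: ltW.
rewrite -powR_sqr//; apply: ler_powRn; [lra|exact: exprn_gt0|].
by have h1 := sqr_ge0 x; have h2 := sqr_ge0 t; lra.
Qed.

(** The sign of [nu - 1/2] is open, but it is below 1, so a ratio [S / z^2 >= 1] raised to it is at
    most the ratio itself. The 18 is [1 + 1 + 4^2]: below, [z] is the larger of [t] and [x], and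
    [y <= 4 x]. *)
Let S_pow (z S : R) : 0 < z -> z ^+ 2 <= S -> S <= 18 * z ^+ 2 ->
  S `^ (nu - 1 / 2) <= 18 * z `^ (2 * nu - 1).
Proof.
move=> z0 zS Sz; have nu1 := nu_lt1; have z20 : 0 < z ^+ 2 by rewrite exprn_gt0.
have S0 := lt_le_trans z20 zS.
rewrite (_ : 2 * nu - 1 = 2 * (nu - 1 / 2)); last by field.
rewrite -powR_sqr//.
rewrite -[X in X `^ _ <= _](@divfK _ (z ^+ 2)) ?gt_eqF//.
have D0 : 0 <= S / z ^+ 2 by pos.
rewrite (powRM _ D0 (ltW z20)); apply: ler_wpM2r; first exact: powR_ge0.
have s1 : 1 <= S / z ^+ 2 by rewrite ler_pdivlMr// mul1r.
apply: (le_trans (ler1_powR s1 _)); first by lra.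
by rewrite ler_pdivrMr.
Qed.

(** For [t <= x] the last factor is of order [x ^ (2 nu - 1)] and a Euclidean Poisson kernel is
    left. For [x < t] it is of order [t ^ (2 nu - 1)], and [nu < 1] makes large [t] harmless,
    leaving [1 / x], the density of an average. The constant is 18 times the 4 from [y <= 4 x]. *)
Lemma model_le_near t x y : 0 < t -> 0 < x -> 0 <= y <= 4 * x ->
  model_kernel t x y <= 72 * (t / (t ^+ 2 + (x - y) ^+ 2) + x^-1).
Proof.
move=> t0 x0 /andP[y0 yx]; have nu1 := nu_lt1; have D0 := d_gt0 x y t0.
have D1 : 0 <= t / (t ^+ 2 + (x - y) ^+ 2) by rewrite divr_ge0 ?ltW.
have x10 : 0 <= x^-1 by rewrite invr_ge0 ltW.
rewrite /model_kernel; have [tx|xt] := leP t x.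
  apply: (@le_trans _ _ (72 * (t / (t ^+ 2 + (x - y) ^+ 2)))); last by lra.
  have h : (t ^+ 2 + x ^+ 2 + y ^+ 2) `^ (nu - 1 / 2) <= 18 * x `^ (2 * nu - 1).
    by apply: S_pow => //; nra.
  have xE : x `^ (- (2 * nu)) * x `^ (2 * nu - 1) = x^-1.
    rewrite -powR_inv1 ?ltW// -powRD ?(gt_eqF x0) ?implybT//.
    by congr powR; ring.
  apply: (@le_trans _ _ (x `^ (- (2 * nu)) * (t * y / (t ^+ 2 + (x - y) ^+ 2)) *
    (18 * x `^ (2 * nu - 1)))).
    by apply: ler_wpM2l => //; pos.
  have -> : x `^ (- (2 * nu)) * (t * y / (t ^+ 2 + (x - y) ^+ 2)) *
    (18 * x `^ (2 * nu - 1)) = 18 * (y / x) * (t / (t ^+ 2 + (x - y) ^+ 2)).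
    by rewrite -xE; ring.
  apply: ler_wpM2r => //.
  have : y / x <= 4 by rewrite ler_pdivrMr.
  by lra.
apply: (@le_trans _ _ (72 * x^-1)); last by lra.
have h : (t ^+ 2 + x ^+ 2 + y ^+ 2) `^ (nu - 1 / 2) <= 18 * t `^ (2 * nu - 1).
  by apply: S_pow => //; nra.
have h2 : t * y / (t ^+ 2 + (x - y) ^+ 2) <= 4 * x * t^-1.
  rewrite ler_pdivrMr// mulrAC ler_pdivlMr//.
  have h3 := sqr_ge0 (x - y); have h4 := ler_wpM2l (sqr_ge0 t) yx.
  have h5 : 0 <= 4 * x * (x - y) ^+ 2 by pos.
  by rewrite mulrDr; nra.
have tE : t^-1 * t `^ (2 * nu - 1) <= x `^ (2 * nu - 2).
  rewrite -(powR_inv1 (ltW t0)) -powRD ?(gt_eqF t0) ?implybT//.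
  rewrite (_ : -1 + (2 * nu - 1) = 2 * nu - 2); last by ring.
  by apply: ler_powRn; [lra|exact: x0|exact: ltW].
have xE : x `^ (- (2 * nu)) * x `^ (2 * nu - 2) * x = x^-1.
  rewrite -[X in _ * X = _](powRr1 (ltW x0)) -(powR_inv1 (ltW x0)).
  by rewrite -!powRD ?(gt_eqF x0) ?implybT//; congr powR; ring.
apply: (@le_trans _ _ (x `^ (- (2 * nu)) * (4 * x * t^-1) * (18 * t `^ (2 * nu - 1)))).
  apply: ler_pM => //; [by pos|by pos|].
  by apply: ler_wpM2l => //; pos.
apply: (@le_trans _ _ (72 * (x `^ (- (2 * nu)) * x) * (t^-1 * t `^ (2 * nu - 1)))).
  by rewrite le_eqVlt; apply/orP; left; apply/eqP; ring.
rewrite -xE.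
apply: (@le_trans _ _ (72 * (x `^ (- (2 * nu)) * x) * x `^ (2 * nu - 2))).
  by apply: ler_wpM2l => //; pos.
by rewrite le_eqVlt; apply/orP; left; apply/eqP; ring.
Qed.

(** The profile in [y] shared by all kernels with [t] and [x] fixed: like [y] at 0 and like
    [y ^ (2 nu - 2)] at infinity. *)
Definition growth_weight y : R := y * (1 + y ^+ 2) `^ (nu - 3 / 2).

Let weight_S t x y (a : R) : 0 < a -> a <= 1 -> a <= t ^+ 2 + x ^+ 2 ->
  (t ^+ 2 + x ^+ 2 + y ^+ 2) `^ (nu - 3 / 2) <=
  a `^ (nu - 3 / 2) * (1 + y ^+ 2) `^ (nu - 3 / 2).
Proof.
move=> a0 a1 aS; have nu1 := nu_lt1; have y20 := sqr_ge0 y.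
have y1 : 0 <= 1 + y ^+ 2 by pos.
rewrite -(powRM _ (ltW a0) y1).
by apply: ler_powRn; [lra|pos|nra].
Qed.

Lemma model_le_weight t x1 x2 : 0 < t -> 0 < x1 -> exists2 C : R, 0 < C &
  forall x y, x1 <= x <= x2 -> 0 <= y -> model_kernel t x y <= C * growth_weight y.
Proof.
move=> t0 x10; have nu1 := nu_lt1.
pose a : R := Num.min 1 (t ^+ 2).
have a0 : 0 < a by rewrite lt_min ltr01 exprn_gt0.
pose M : R := 3 + 3 * x2 ^+ 2 / t ^+ 2.
have M0 : 0 < M by rewrite /M; pos.
(* The sign of [nu] is open, so the power is bounded on [[x1, x2]] by the sum of its two end
   values. *)
pose X : R := x1 `^ (- (2 * nu)) + x2 `^ (- (2 * nu)).
have X0 : 0 < X by rewrite /X; pos.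
exists (X * t * a `^ (nu - 3 / 2) * M); first by pos.
move=> x y /andP[x1x xx2] y0; have x0 := lt_le_trans x10 x1x.
have x20 := lt_le_trans x0 xx2.
have t20 : 0 < t ^+ 2 by rewrite exprn_gt0.
rewrite model_far// /far_kernel.
have XE : x `^ (- (2 * nu)) <= X.
  rewrite /X; have [n0|n0] := leP 0 (- (2 * nu)).
    apply: (@le_trans _ _ (x2 `^ (- (2 * nu)))); last by rewrite lerDr powR_ge0.
    by apply: ge0_ler_powR; rewrite ?nnegrE//; exact: ltW.
  apply: (@le_trans _ _ (x1 `^ (- (2 * nu)))); last by rewrite lerDl powR_ge0.
  by apply: ler_powRn => //; exact: ltW.
have ME : (t ^+ 2 + x ^+ 2 + y ^+ 2) / (t ^+ 2 + (x - y) ^+ 2) <= M.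
  rewrite ler_pdivrMr ?d_gt0//.
  have h1 : 3 * x ^+ 2 <= 3 * x2 ^+ 2 / t ^+ 2 * t ^+ 2.
    rewrite divfK ?gt_eqF//; nra.
  have h2 : 0 <= 3 * x2 ^+ 2 / t ^+ 2 by pos.
  have h3 := sqr_ge0 (x - y).
  have h4 : 3 * x2 ^+ 2 / t ^+ 2 * t ^+ 2 <= 3 * x2 ^+ 2 / t ^+ 2 *
      (t ^+ 2 + (x - y) ^+ 2) by apply: ler_wpM2l => //; lra.
  (* Equivalent to [y^2 <= 2 x^2 + 2 (x - y)^2], which trades [y] for the distance to the
     diagonal. *)
  have h5 := sqr_ge0 (2 * x - y).
  rewrite /M mulrDl; nra.
have SE : (t ^+ 2 + x ^+ 2 + y ^+ 2) `^ (nu - 3 / 2) <=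
  a `^ (nu - 3 / 2) * (1 + y ^+ 2) `^ (nu - 3 / 2).
  apply: weight_S => //; first by rewrite ge_min lexx.
  apply: (@le_trans _ _ (t ^+ 2)); first by rewrite ge_min lexx orbT.
  by rewrite lerDl sqr_ge0.
have -> : X * t * a `^ (nu - 3 / 2) * M * growth_weight y =
  X * (t * y) * (a `^ (nu - 3 / 2) * (1 + y ^+ 2) `^ (nu - 3 / 2)) * M.
  by rewrite /growth_weight; ring.
have ty : 0 <= t * y by pos.
apply: ler_pM => //.
- by pos.
- by pos.
apply: ler_pM => //; [by pos|by pos|].
exact: ler_wpM2r.
Qed.

Lemma model_ge_weight t x : 0 < t -> 0 < x -> exists2 c : R, 0 < c &
  forall y, 0 <= y -> c * growth_weight y <= model_kernel t x y.
Proof.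
move=> t0 x0; have nu1 := nu_lt1.
pose A : R := 1 + t ^+ 2 + x ^+ 2.
have A0 : 0 < A by rewrite /A; pos.
exists (x `^ (- (2 * nu)) * t * A `^ (nu - 3 / 2) / 2).
  by pos.
move=> y y0; apply: le_trans (model_ge_far _ t0 y0).
have y20 := sqr_ge0 y.
rewrite mulrAC ler_pM2r// /far_kernel /growth_weight.
have h : A `^ (nu - 3 / 2) * (1 + y ^+ 2) `^ (nu - 3 / 2) <=
    (t ^+ 2 + x ^+ 2 + y ^+ 2) `^ (nu - 3 / 2).
  have y1 : 0 <= 1 + y ^+ 2 by pos.
  rewrite -(powRM _ (ltW A0) y1).
  apply: ler_powRn; [lra|exact: S_gt0|].
  by have h1 := sqr_ge0 t; have h2 := sqr_ge0 x; rewrite /A; nra.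
have -> : x `^ (- (2 * nu)) * t * A `^ (nu - 3 / 2) *
    (y * (1 + y ^+ 2) `^ (nu - 3 / 2)) =
    x `^ (- (2 * nu)) * (t * y) * (A `^ (nu - 3 / 2) * (1 + y ^+ 2) `^ (nu - 3 / 2)).
  by ring.
by apply: ler_wpM2l => //; pos.
Qed.

Lemma model_ge_left : exists2 c : R, 0 < c &
  forall x y, 0 < x <= 1 -> 1 <= y <= 2 ->
  c * x `^ (- (2 * nu)) <= model_kernel 1 x y.
Proof.
have nu1 := nu_lt1.
exists (6 `^ (nu - 3 / 2) / 2); first by rewrite divr_gt0 ?powR_gt0.
move=> x y /andP[x0 x1] /andP[y1 y2].
have y0 : 0 <= y by lra.
apply: le_trans (model_ge_far _ ltr01 y0).
rewrite mulrAC ler_pM2r// /far_kernel mulrC mul1r -mulrA.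
apply: ler_wpM2l; first exact: powR_ge0.
have h : 6 `^ (nu - 3 / 2) <= (1 ^+ 2 + x ^+ 2 + y ^+ 2) `^ (nu - 3 / 2).
  by apply: ler_powRn; [lra|exact: S_gt0|nra].
have u0 := powR_ge0 6 (nu - 3 / 2); apply: (le_trans h).
by rewrite -[leLHS]mul1r; apply: ler_wpM2r => //; exact: powR_ge0.
Qed.

(** The height [t = x] realises, up to a constant, the supremum over [t] of the far kernel on
    [y <= x]; the sum of squares is then at most [3 x^2]. *)
Lemma model_ge_right : exists2 c : R, 0 < c &
  forall x y, 0 < x -> 0 <= y <= x -> c * (x `^ (- 2) * y) <= model_kernel x x y.
Proof.
have nu1 := nu_lt1.
exists (3 `^ (nu - 3 / 2) / 2); first by rewrite divr_gt0 ?powR_gt0.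
move=> x y x0 /andP[y0 yx]; apply: le_trans (model_ge_far _ x0 y0).
rewrite mulrAC ler_pM2r// /far_kernel.
have h : 3 `^ (nu - 3 / 2) * x `^ (2 * (nu - 3 / 2)) <=
    (x ^+ 2 + x ^+ 2 + y ^+ 2) `^ (nu - 3 / 2).
  rewrite -powR_sqr// -powRM ?sqr_ge0//.
  by apply: ler_powRn; [lra|exact: S_gt0|nra].
have xE : x `^ (- 2) = x `^ (- (2 * nu)) * x * x `^ (2 * (nu - 3 / 2)).
  rewrite -[X in _ * X * _](powRr1 (ltW x0)) -!powRD ?(gt_eqF x0) ?implybT//.
  by congr powR; field.
rewrite xE.
apply: (le_trans _ (ler_wpM2l _ h)); last by pos.
by rewrite le_eqVlt; apply/orP; left; apply/eqP; ring.
Qed.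

(** The height [t = x - 1] matches the distance from [x] to a mass near 1, where the Euclidean
    Poisson kernel has size [1 / t]. The 8 is 4 from [x ^ (- (2 nu))] times 2 from
    [t^2 + (x - y)^2 <= 2 t^2]. *)
Lemma model_ge_diag : exists2 c : R, 0 < c &
  forall x y, 1 < x <= 2 -> 1 <= y <= x -> c / (x - 1) <= model_kernel (x - 1) x y.
Proof.
have nu1 := nu_lt1.
exists (9 `^ (nu - 3 / 2) / 8); first by rewrite divr_gt0 ?powR_gt0.
move=> x y /andP[x1 x2] /andP[y1 yx].
have t0 : 0 < x - 1 by lra.
rewrite /model_kernel; set t := x - 1 in t0 *.
have xE : 1 / 4 <= x `^ (- (2 * nu)).
  have [n0|n0] := leP 0 nu; last first.
    apply: (@le_trans _ _ 1); first by lra.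
    by rewrite -[leLHS](powRr0 x); apply: ler_powR; lra.
  apply: (@le_trans _ _ (x `^ (- 2))); last by apply: ler_powR; lra.
  rewrite powRN powR_mulrn; last by lra.
  by rewrite div1r lef_pV2 ?posrE//; nra.
have dE : 1 / (2 * t) <= t * y / (t ^+ 2 + (x - y) ^+ 2).
  rewrite ler_pdivrMr ?mulr_gt0// mulrAC ler_pdivlMr ?d_gt0// mul1r.
  have h : (x - y) ^+ 2 <= t ^+ 2 by rewrite /t; nra.
  have h2 : 2 * t ^+ 2 <= t * y * (2 * t) by have := sqr_ge0 t; nra.
  by lra.
have S1 : 1 <= t ^+ 2 + x ^+ 2 + y ^+ 2 by nra.
(* [nu - 1/2] may have either sign. As the sum of squares is at least 1, the exponent can be lowered
   to the negative [nu - 3/2], and then the upper bound [1 + 4 + 4] applies. *)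
have SE : 9 `^ (nu - 3 / 2) <= (t ^+ 2 + x ^+ 2 + y ^+ 2) `^ (nu - 1 / 2).
  apply: (@le_trans _ _ ((t ^+ 2 + x ^+ 2 + y ^+ 2) `^ (nu - 3 / 2))).
    by apply: ler_powRn; [lra|exact: S_gt0|rewrite /t; nra].
  by apply: ler_powR => //; lra.
apply: (@le_trans _ _ (1 / 4 * (1 / (2 * t)) * 9 `^ (nu - 3 / 2))).
  by rewrite le_eqVlt; apply/orP; left; apply/eqP; field; rewrite gt_eqF.
have i0 : 0 <= 1 / (2 * t) by pos.
apply: ler_pM => //; first by pos.
by apply: ler_pM.
Qed.

End model_kernel.

(** * Comparison with the model kernel *)

Lemma continuous_at_comp {R : realType} (x : R) (h k : R -> R) :
  {for x, continuous h} -> {for h x, continuous k} ->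
  {for x, continuous (fun z => k (h z))}.
Proof. by move=> ch ck; exact: (@cvg_comp _ _ _ h k _ _ _ ch). Qed.

Lemma continuous_powR_comp {R : realType} (a x : R) (h : R -> R) :
  {for x, continuous h} -> 0 < h x -> {for x, continuous (fun z => h z `^ a)}.
Proof.
move=> ch hx; apply: (@cvg_comp _ _ _ h (fun z => z `^ a) _ _ _ ch).
exact: continuous_powR.
Qed.

Section poisson_kernel_estimates.
Context {R : realType}.
Local Notation leb := (@lebesgue_measure R).
Variable nu : R.
Hypothesis nu_lt1 : nu < 1.
Implicit Types t x y : R.

Lemma exotic_poisson_sym t x y : 0 < t -> 0 < x -> 0 < y ->
  exotic_poisson nu t x y = exotic_poisson nu t y x.
Proof.
by move=> t0 x0 y0; rewrite !exotic_poissonE// (mulrC x y) addrAC.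
Qed.

Let arg_bounds t x y : 0 < t -> 0 < x -> 0 < y ->
  0 < (x * y / (t ^+ 2 + x ^+ 2 + y ^+ 2)) ^+ 2 < 1 / 4.
Proof.
move=> t0 x0 y0.
have S0 : 0 < t ^+ 2 + x ^+ 2 + y ^+ 2 by pos.
have xy0 : 0 < x * y by pos.
apply/andP; split; first by pos.
rewrite expr_div_n ltr_pdivrMr ?exprn_gt0//.
have h : 2 * (x * y) < t ^+ 2 + x ^+ 2 + y ^+ 2.
  by have h1 := sqr_ge0 (x - y); have h2 := exprn_gt0 2 t0; nra.
nra.
Qed.

(** The series contributes [1 / (1 - 4 r)], and [1 - 4 r] factors through the squared distances to
    [(x, y)] and to its reflection. The reflected factor lies between [S] and [2 S], so it cancels
    one power of [S] and only the singularity at [x = y] survives. *)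
Lemma poisson_model_bounds : exists c C : R, [/\ 0 < c, 0 < C &
  forall t x y, 0 < t -> 0 < x -> 0 < y ->
  c * model_kernel nu t x y <= exotic_poisson nu t x y * y `^ (2 * nu + 1)
    <= C * model_kernel nu t x y].
Proof.
have mu1 : -1 < - nu by rewrite ltrN2.
have [c [C [c0 C0 cC]]] := poisson_series_bounds mu1.
have pi0 : 0 < Num.sqrt pi :> R by rewrite sqrtr_gt0 pi_gt0.
exists ((Num.sqrt pi)^-1 * c), ((Num.sqrt pi)^-1 * (2 * C)); split; [by pos|by pos|].
move=> t x y t0 x0 y0; rewrite exotic_poissonE// (model_far _ _ _ t0) /far_kernel.
have /andP[r0 r14] := arg_bounds t0 x0 y0.
have /andP[lo up] := cC _ (ltW r0) r14.
move: lo up; set P := poisson_series _ _.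
set r := (_ / _) ^+ 2 in r0 r14 *; set S := _ + y ^+ 2 in r r0 r14 *.
have S0 : 0 < S by rewrite /S; pos.
have D0 : 0 < t ^+ 2 + (x - y) ^+ 2 by pos.
have E0 : 0 < t ^+ 2 + (x + y) ^+ 2 by pos.
(* Writing D and E for the two factors, [S = (D + E) / 2] and [2 x y = (E - D) / 2], so
   [S^2 - (2 x y)^2 = D E]. *)
have rE : 1 - 4 * r = (t ^+ 2 + (x - y) ^+ 2) * (t ^+ 2 + (x + y) ^+ 2) / S ^+ 2.
  apply: (mulIf (lt0r_neq0 (exprn_gt0 2 S0))); rewrite divfK ?gt_eqF ?exprn_gt0//.
  rewrite mulrBl mul1r /r expr_div_n -mulrA divfK ?gt_eqF ?exprn_gt0// /S; ring.
rewrite rE !invf_div => lo up.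
have xyE : (x * y) `^ (- (2 * nu)) * y `^ (2 * nu + 1) = x `^ (- (2 * nu)) * y.
  rewrite powRM ?ltW// -mulrA -powRD ?(gt_eqF y0) ?implybT//.
  by congr (_ * _); rewrite -[RHS]powRr1 ?ltW//; congr powR; ring.
pose A := (Num.sqrt pi)^-1 * (x `^ (- (2 * nu)) * (t * y) * S `^ (nu - 3 / 2)).
have A0 : 0 <= A by rewrite /A; pos.
have -> : (Num.sqrt pi)^-1 * (2 * (x * y) `^ (- (2 * nu)) * t * S `^ (nu - 3 / 2) * P)
    * y `^ (2 * nu + 1) = A * (2 * P).
  rewrite (_ : A = (Num.sqrt pi)^-1 * (((x * y) `^ (- (2 * nu)) * y `^ (2 * nu + 1))
    * t * S `^ (nu - 3 / 2))); last by rewrite xyE /A; ring.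
  by ring.
have -> : (Num.sqrt pi)^-1 * c * (x `^ (- (2 * nu)) * (t * y) * S `^ (nu - 3 / 2) *
    (S / (t ^+ 2 + (x - y) ^+ 2))) = A * (c * (S / (t ^+ 2 + (x - y) ^+ 2))).
  by rewrite /A; ring.
have -> : (Num.sqrt pi)^-1 * (2 * C) * (x `^ (- (2 * nu)) * (t * y) *
    S `^ (nu - 3 / 2) * (S / (t ^+ 2 + (x - y) ^+ 2))) =
    A * (2 * (C * (S / (t ^+ 2 + (x - y) ^+ 2)))).
  by rewrite /A; ring.
have sE (d e : R) : 0 < d -> 0 < e -> S ^+ 2 / (d * e) = S / d * (S / e).
  by move=> d0 e0; rewrite expr2 invfM mulrACA.
have Se : S / (t ^+ 2 + (x + y) ^+ 2) <= 1.
  by rewrite ler_pdivrMr// /S; have := mulr_gt0 x0 y0; nra.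
have eS : 1 <= 2 * (S / (t ^+ 2 + (x + y) ^+ 2)).
  rewrite mulrA ler_pdivlMr// mul1r /S.
  by have h1 := sqr_ge0 t; have h2 := sqr_ge0 (x - y); nra.
rewrite (sE _ _ D0 E0) in lo up.
have Q0 : 0 < S / (t ^+ 2 + (x - y) ^+ 2) by pos.
move: lo up Se eS Q0; move: (S / (t ^+ 2 + (x + y) ^+ 2)) => e.
move: (S / (t ^+ 2 + (x - y) ^+ 2)) => q lo up e1 e2 q0.
apply/andP; split; apply: ler_wpM2l => //.
  apply: (@le_trans _ _ (2 * (c * (q * e)))); last by lra.
  have -> : 2 * (c * (q * e)) = c * q * (2 * e) by ring.
  by rewrite -[leLHS]mulr1; apply: ler_wpM2l => //; pos.
rewrite ler_pM2l//; apply: (le_trans up); apply: ler_wpM2l; first exact: ltW.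
by rewrite -[leRHS]mulr1; apply: ler_wpM2l => //; exact: ltW.
Qed.

Lemma exotic_poisson_ge0 t x y : 0 < t -> 0 < x -> 0 < y ->
  0 <= exotic_poisson nu t x y.
Proof.
move=> t0 x0 y0; have [c [C [c0 C0 /(_ _ _ _ t0 x0 y0) /andP[h _]]]] :=
  poisson_model_bounds.
have y1 : 0 < y `^ (2 * nu + 1) by pos.
rewrite -(pmulr_lge0 _ y1); apply: le_trans h.
by apply: mulr_ge0; [exact: ltW|apply: model_kernel_ge0 => //; exact: ltW].
Qed.

(** Both kernels are compared with [growth_weight]. It spreads integrability from one point (t0, x0)
    to all others, and supplies the dominating function for continuity in [x]. *)
Lemma poisson_harnack t x1 x2 t0 x0 : 0 < t -> 0 < x1 -> 0 < t0 -> 0 < x0 ->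
  exists2 C : R, 0 < C & forall x y, x1 <= x <= x2 -> 0 < y ->
  exotic_poisson nu t x y <= C * exotic_poisson nu t0 x0 y.
Proof.
move=> t_gt0 x10 t00 x00.
have [c [C [c0 C0 cC]]] := poisson_model_bounds.
have [D D0 HD] := model_le_weight nu_lt1 x2 t_gt0 x10.
have [d d0 Hd] := model_ge_weight nu_lt1 t00 x00.
exists (C * D / (c * d)); first by pos.
move=> x y /andP[xx1 xx2] y0; have x_gt0 := lt_le_trans x10 xx1.
have y1 : 0 < y `^ (2 * nu + 1) by pos.
have /andP[_ h1] := cC _ _ _ t_gt0 x_gt0 y0.
have /andP[h2 _] := cC _ _ _ t00 x00 y0.
have h3 := HD x y ltac:(by rewrite xx1 xx2) (ltW y0).
have h4 := Hd y (ltW y0).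
rewrite -(ler_pM2r y1) -[leRHS]mulrA; apply: (le_trans h1).
apply: (@le_trans _ _ (C * D / (c * d) * (c * d * growth_weight nu y))).
  rewrite [leRHS]mulrA divfK ?gt_eqF ?mulr_gt0// -[leRHS]mulrA.
  by apply: ler_wpM2l => //; exact: ltW.
apply: ler_wpM2l; first by pos.
apply: le_trans h2; rewrite -mulrA; apply: ler_wpM2l => //; exact: ltW.
Qed.

Lemma continuous_poisson_x t x y : 0 < t -> 0 < x -> 0 < y ->
  {for x, continuous (fun x => exotic_poisson nu t x y)}.
Proof.
move=> t0 x0 y0; have mu1 : -1 < - nu by rewrite ltrN2.
pose F x := (Num.sqrt pi)^-1 *
  (2 * (x * y) `^ (- (2 * nu)) * t * (t ^+ 2 + x ^+ 2 + y ^+ 2) `^ (nu - 3 / 2) *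
   poisson_series (- nu) ((x * y / (t ^+ 2 + x ^+ 2 + y ^+ 2)) ^+ 2)).
have S0 z : 0 < t ^+ 2 + z ^+ 2 + y ^+ 2 by pos.
have cS : {for x, continuous (fun z : R => t ^+ 2 + z ^+ 2 + y ^+ 2)}.
  apply: cvgD; last exact: cvg_cst.
  by apply: cvgD; [exact: cvg_cst|exact: exprn_continuous].
have cxy : {for x, continuous (fun z : R => z * y)}.
  by apply: cvgM; [exact: cvg_id|exact: cvg_cst].
have xy0 : 0 < x * y by pos.
have cF : {for x, continuous F}.
  apply: cvgM; first exact: cvg_cst.
  apply: cvgM; [apply: cvgM; [apply: cvgM; [apply: cvgM|]|]|].
  - exact: cvg_cst.
  - exact: (@continuous_powR_comp _ _ _ (fun z => z * y)).
  - exact: cvg_cst.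
  - exact: (@continuous_powR_comp _ _ _ (fun z => t ^+ 2 + z ^+ 2 + y ^+ 2)).
  - apply: (@continuous_at_comp _ _
      (fun z => (z * y / (t ^+ 2 + z ^+ 2 + y ^+ 2)) ^+ 2) (poisson_series (- nu))).
      apply: (@continuous_at_comp _ _
        (fun z => z * y / (t ^+ 2 + z ^+ 2 + y ^+ 2)) (fun z => z ^+ 2)).
        by apply: cvgM => //; apply: cvgV => //; rewrite gt_eqF.
      exact: exprn_continuous.
    by apply: continuous_poisson_series => //; exact: arg_bounds.
rewrite /prop_for /continuous_at exotic_poissonE//.
apply: cvg_trans cF; apply: near_eq_cvg; near=> z.
rewrite exotic_poissonE//; near: z; exact: lt_nbhsr.
Unshelve. all: by end_near. Qed.

(** By symmetry of the kernel, continuity in the first space variable also gives measurability in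
    the second. *)
Lemma measurable_poisson t x : 0 < t -> 0 < x ->
  measurable_fun (Rpos : set (measurableTypeR R)) (exotic_poisson nu t x).
Proof.
move=> t0 x0.
apply: (@eq_measurable_fun _ _ _ _ _ (fun y => exotic_poisson nu t y x)).
  by move=> y /[!inE] /RposE y0; rewrite exotic_poisson_sym.
apply: open_continuous_measurable_fun; first exact: interval_open.
by move=> y /[!inE] /RposE y0; exact: continuous_poisson_x.
Qed.

Definition model_int (t x : R) (g : R -> R) : \bar R :=
  (\int[leb]_(y in Rpos) (model_kernel nu t x y * g y)%:E)%E.

Let rhs t x (g : R -> R) : \bar R :=
  (\int[leb]_(y in Rpos) (exotic_poisson nu t x y * y `^ (2 * nu + 1) * g y)%:E)%E.

Lemma measurable_model t x : 0 < t ->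
  measurable_fun (Rpos : set (measurableTypeR R)) (model_kernel nu t x).
Proof.
move=> t0; have S0 y : 0 < t ^+ 2 + x ^+ 2 + y ^+ 2 by pos.
have D0 y : 0 < t ^+ 2 + (x - y) ^+ 2 by pos.
apply: open_continuous_measurable_fun; first exact: interval_open.
move=> y /[!inE] /RposE y0.
apply: cvgM; first apply: cvgM; first exact: cvg_cst.
  apply: cvgM; first by apply: cvgM; [exact: cvg_cst|exact: cvg_id].
  apply: cvgV; first by rewrite gt_eqF.
  apply: cvgD; first exact: cvg_cst.
  apply: (@continuous_comp _ _ _ (fun z => x - z) (fun z => z ^+ 2)).
    by apply: cvgB; [exact: cvg_cst|exact: cvg_id].
  exact: exprn_continuous.
apply: (@continuous_powR_comp _ _ _ (fun z => t ^+ 2 + x ^+ 2 + z ^+ 2)) => //.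
by apply: cvgD; [exact: cvg_cst|exact: exprn_continuous].
Qed.

Lemma eta_int (t x : R) (g : R -> R) : 0 < t -> 0 < x ->
  measurable_fun (Rpos : set (measurableTypeR R)) g -> (forall y, 0 < y -> 0 <= g y) ->
  (\int[eta nu]_(y in Rpos) (exotic_poisson nu t x y * g y)%:E)%E = rhs t x g.
Proof.
move=> t0 x0 mg g0; rewrite ge0_integral_power_measure//; last 2 first.
- by apply/measurable_EFinP; apply: measurable_funM => //; exact: measurable_poisson.
- move=> y /RposE y0; rewrite lee_fin mulr_ge0 ?g0//.
  exact: exotic_poisson_ge0.
by rewrite setIid; apply: eq_integral => y _; rewrite -EFinM mulrAC.
Qed.

Lemma poisson_int_bounds : exists c C : R, [/\ 0 < c, 0 < C &
  forall (t x : R) (g : R -> R), 0 < t -> 0 < x ->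
  measurable_fun (Rpos : set (measurableTypeR R)) g -> (forall y, 0 < y -> 0 <= g y) ->
  (c%:E * model_int t x g <=
   \int[eta nu]_(y in Rpos) (exotic_poisson nu t x y * g y)%:E <=
   C%:E * model_int t x g)%E].
Proof.
have [c [C [c0 C0 cC]]] := poisson_model_bounds; exists c, C; split => //.
move=> t x g t0 x0 mg g0; rewrite eta_int//.
have mJ : measurable_fun (Rpos : set (measurableTypeR R))
    (fun y => model_kernel nu t x y * g y).
  by apply: measurable_funM => //; exact: measurable_model.
have mK : measurable_fun (Rpos : set (measurableTypeR R))
    (fun y => exotic_poisson nu t x y * y `^ (2 * nu + 1) * g y).
  apply: measurable_funM => //; apply: measurable_funM.
    exact: measurable_poisson.
  exact: measurable_fun_powR.
have J0 y : Rpos y -> 0 <= model_kernel nu t x y * g y.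
  by move=> /RposE y0; rewrite mulr_ge0 ?g0// model_kernel_ge0// ltW.
have E k : 0 < k -> (k%:E * model_int t x g =
    \int[leb]_(y in Rpos) (k * (model_kernel nu t x y * g y))%:E)%E.
  move=> k0; apply/esym; apply: ge0_intZl; [exact: mRpos|exact: ltW|exact: mJ|].
  exact: J0.
rewrite (E _ c0) (E _ C0); apply/andP; split.
- apply: ge0_le_int => //.
    exact: measurable_funM.
  move=> y yp; have /RposE y0 := yp.
  rewrite (mulr_ge0 (ltW c0) (J0 _ yp))/= mulrA; apply: ler_wpM2r; first exact: g0.
  by have /andP[] := cC _ _ _ t0 x0 y0.
- apply: ge0_le_int => //.
    exact: measurable_funM.
  move=> y yp; have /RposE y0 := yp.
  apply/andP; split.
    by rewrite (mulr_ge0 _ (g0 _ y0))// mulr_ge0 ?powR_ge0// exotic_poisson_ge0.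
  rewrite mulrA; apply: ler_wpM2r; first exact: g0.
  by have /andP[] := cC _ _ _ t0 x0 y0.
Qed.

End poisson_kernel_estimates.

(** * The maximal operator *)

Section maximal_operator.
Context {R : realType}.
Local Notation leb := (@lebesgue_measure R).
Local Notation mR := (measurableTypeR R).
Variable nu : R.
Hypothesis nu_lt1 : nu < 1.
Implicit Types t x y : R.

Let measurable_Kf (f : mR -> R) t x : 0 < t -> 0 < x ->
  measurable_fun (Rpos : set mR) f ->
  measurable_fun (Rpos : set mR) (fun y => exotic_poisson nu t x y * f y).
Proof. by move=> t0 x0 mf; apply: measurable_funM => //; exact: measurable_poisson. Qed.

Let abs_Kf (f : mR -> R) t x : 0 < t -> 0 < x ->
  (\int[eta nu]_(y in Rpos) `|(exotic_poisson nu t x y * f y)%:E| =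
  \int[eta nu]_(y in Rpos) (exotic_poisson nu t x y * `|f y|)%:E)%E.
Proof.
move=> t0 x0; apply: eq_integral => y /[!inE] /RposE y0.
by rewrite abse_EFin normrM ger0_norm// exotic_poisson_ge0.
Qed.

(** Finiteness at a single point is enough, by [poisson_harnack]; the majorants constructed later
    are only known to be finite somewhere. *)
Lemma poisson_domI (f : mR -> R) t0 x0 : measurable_fun setT f ->
  0 < t0 -> 0 < x0 -> (model_int nu t0 x0 (fun y => `|f y|%R) < +oo)%E ->
  poisson_dom nu f.
Proof.
move=> mf t00 x00 fin t x t_gt0 x_gt0.
have mfR : measurable_fun (Rpos : set mR) f by exact: measurable_funTS.
have mnR : measurable_fun (Rpos : set mR) (fun y => `|f y|).
  exact: measurableT_comp.
have [c [C [c0 C0 cC]]] := poisson_int_bounds nu_lt1.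
have [D D0 HD] := poisson_harnack nu_lt1 x t_gt0 x_gt0 t00 x00.
apply/integrableP; split; first by apply/measurable_EFinP; exact: measurable_Kf.
rewrite abs_Kf//.
have /andP[_ h] := cC _ _ _ t00 x00 mnR (fun y _ => normr_ge0 _).
apply: (@le_lt_trans _ _ (\int[eta nu]_(y in Rpos)
    (D * (exotic_poisson nu t0 x0 y * `|f y|))%:E)%E).
  apply: ge0_le_integral => //=.
  - by move=> y /RposE y0; rewrite lee_fin mulr_ge0// exotic_poisson_ge0.
  - by apply/measurable_EFinP; exact: measurable_Kf.
  - apply/measurable_EFinP; apply: measurable_funM => //; exact: measurable_Kf.
  - move=> y /RposE y0; rewrite lee_fin mulrA; apply: ler_wpM2r => //.
    by apply: HD => //; rewrite lexx.
under eq_integral do rewrite EFinM.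
rewrite ge0_integralZl_EFin//.
- rewrite lte_mul_pinfty ?lee_fin ?ltW//.
  by apply: (le_lt_trans h); rewrite lte_mul_pinfty ?lee_fin ?ltW.
- by move=> y /RposE y0; rewrite lee_fin mulr_ge0// exotic_poisson_ge0.
- by apply/measurable_EFinP; exact: measurable_Kf.
- exact: ltW.
Qed.

Lemma poisson_max_le : exists2 C : R, 0 < C &
  forall (f : mR -> R) (B : R -> \bar R), measurable_fun setT f ->
  poisson_dom nu f -> (forall x, 0 <= B x)%E ->
  (forall t x, (0 < t)%R -> (0 < x)%R ->
    model_int nu t x (fun y => `|f y|%R) <= B x)%E ->
  forall x, (0 <= poisson_max nu f x <= C%:E * B x)%E.
Proof.
have [c [C [c0 C0 cC]]] := poisson_int_bounds nu_lt1; exists C => //.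
move=> f B mf df B0 fB x; rewrite /poisson_max patchE; case: ifPn => [|_]; last first.
  by rewrite lexx/= mule_ge0// lee_fin ltW.
rewrite inE => /RposE x0.
have mnR : measurable_fun (Rpos : set mR) (fun y => `|f y|).
  by apply: measurable_funTS; exact: measurableT_comp.
apply/andP; split.
  apply: le_ereal_sup_tmp; exists (`|poisson_op nu 1 f x|%:E); last by rewrite lee_fin.
  by exists 1 => //; apply/RposE.
apply: ge_ereal_sup => _ [t /RposE t0 <-].
have int := df _ _ t0 x0.
rewrite /poisson_op (@EFin_normr_Rintegral _ _ _ (eta nu) Rpos
  (fun y => exotic_poisson nu t x y * f y) mRpos int).
apply: (@le_trans _ _ (\int[eta nu]_(y in Rpos) `|(exotic_poisson nu t x y * f y)%:E|)%E).
  by apply: le_abse_integral => //; exact: (measurable_int _ int).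
rewrite abs_Kf//.
have /andP[_ h] := cC _ _ _ t0 x0 mnR (fun y _ => normr_ge0 _).
by apply: (le_trans h); apply: lee_wpmul2l; [rewrite lee_fin ltW|exact: fB].
Qed.

Lemma poisson_max_ge : exists2 c : R, 0 < c &
  forall (f : mR -> R), measurable_fun setT f ->
  (forall y, 0 <= f y) -> poisson_dom nu f ->
  forall t x, 0 < t -> 0 < x -> (c%:E * model_int nu t x f <= poisson_max nu f x)%E.
Proof.
have [c [C [c0 C0 cC]]] := poisson_int_bounds nu_lt1; exists c => //.
move=> f mf f0 df t x t0 x0.
rewrite /poisson_max patchE mem_set; last exact/RposE.
apply: le_ereal_sup_tmp; exists (`|poisson_op nu t f x|%:E).
  by exists t => //; apply/RposE.
have int := df _ _ t0 x0.
have mR_ : measurable_fun (Rpos : set mR) f by exact: measurable_funTS.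
have /andP[h _] := cC _ _ _ t0 x0 mR_ (fun y _ => f0 y).
rewrite /poisson_op (@EFin_normr_Rintegral _ _ _ (eta nu) Rpos
  (fun y => exotic_poisson nu t x y * f y) mRpos int).
by apply: (le_trans h); exact: lee_abs.
Qed.

Lemma continuous_poisson_op (f : mR -> R) t x : poisson_dom nu f ->
  0 < t -> 0 < x -> {for x, continuous (poisson_op nu t f)}.
Proof.
move=> df t0 x0.
have u0 : 0 < x / 2 by rewrite divr_gt0.
(* Uniform for arguments in [[x / 2, 2 x]], with the centre [x] as reference point, whose integrand
   is known to be integrable. *)
have [D D0 HD] := poisson_harnack nu_lt1 (2 * x) t0 u0 t0 x0.
have xI : x \in `]x / 2, 2 * x[%classic by rewrite inE/= in_itv/=; lra.
apply: (@continuity_under_integral _ _ _ (eta nu)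
  (fun x y => exotic_poisson nu t x y * f y) Rpos mRpos (x / 2) (2 * x) _ _
  (fun y => D * (exotic_poisson nu t x y * `|f y|)) _ _ _ xI).
- move=> z; rewrite /= in_itv/= => /andP[z1 _].
  by apply: df => //; exact: lt_trans z1.
- apply/nearW => y /RposE y0 z; rewrite inE/= in_itv/= => /andP[z1 _].
  apply: cvgM; last exact: cvg_cst.
  by apply: continuous_poisson_x => //; exact: lt_trans z1.
- have -> : (EFin \o (fun y => D * (exotic_poisson nu t x y * `|f y|))) =
    (fun y => D%:E * (exotic_poisson nu t x y * `|f y|)%:E)%E by [].
  apply: integrableZl => //.
  have := integrable_abse (df _ _ t0 x0); apply: eq_integrable => //.
  move=> y /[!inE] /RposE y0.
  by rewrite /= normrM ger0_norm// exotic_poisson_ge0.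
- move=> z; rewrite /= in_itv/= => /andP[z1 z2]; apply/nearW => y /RposE y0.
  have z0 : 0 < z by exact: lt_trans z1.
  rewrite normrM ger0_norm ?exotic_poisson_ge0// mulrA; apply: ler_wpM2r => //.
  by apply: HD => //; rewrite !ltW.
Qed.

(** A supremum of continuous functions of [x], however many, is lower semicontinuous. The extension
    by 0 keeps this property because [Rpos] is open and the supremum is nonnegative. *)
Lemma measurable_poisson_max (f : mR -> R) : poisson_dom nu f ->
  measurable_fun (setT : set mR) (poisson_max nu f).
Proof.
move=> df.
have max0 x : (0 <= poisson_max nu f x)%E.
  rewrite /poisson_max patchE; case: ifPn => // _.
  apply: le_ereal_sup_tmp; exists (`|poisson_op nu 1 f x|%:E); last by rewrite lee_fin.
  by exists 1 => //; apply/RposE.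
apply: lower_semicontinuous_measurable => x a ax.
have [a0|a0] := ltP a 0.
  exists setT; first exact: filterT.
  by move=> y _; apply: (lt_le_trans _ (max0 y)); rewrite lte_fin.
have x0 : 0 < x.
  move: ax; rewrite /poisson_max patchE; case: ifPn => [|_].
    by rewrite inE => /RposE.
  by rewrite lte_fin ltNge a0.
have := ax; rewrite /poisson_max patchE mem_set; last exact/RposE.
move=> /ereal_sup_gt [_ [t /RposE t0 <-]]; rewrite lte_fin => at_.
have cP : {for x, continuous (fun z => `|poisson_op nu t f z|)}.
  by apply: cvg_norm; exact: continuous_poisson_op.
have /cvgr_gt := cP; move=> /(_ _ at_) V.
exists ([set z | a < `|poisson_op nu t f z|] `&` Rpos).
  by apply: filterI => //; near=> z; apply/RposE; near: z; exact: lt_nbhsr.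
move=> z [az /RposE z0].
rewrite /poisson_max patchE mem_set; last exact/RposE.
apply: (@lt_le_trans _ _ `|poisson_op nu t f z|%:E); first by rewrite lte_fin.
by apply: ereal_sup_ubound; exists t => //; apply/RposE.
Unshelve. all: by end_near. Qed.

End maximal_operator.

(** * The Hardy-Littlewood maximal function *)

Section maximal_function.
Context {R : realType}.
Local Notation leb := (@lebesgue_measure R).
Local Notation mR := (measurableTypeR R).
Implicit Types (h : mR -> R) (p r x y : R).

Lemma integral_trunc_lt (phi : mR -> R) r : measurable_fun Rpos phi -> 0 < r ->
  (\int[leb]_(l in Rpos) (phi l * (l < r)%R%:R)%:E =
   \int[leb]_(l in `]0%R, r]) (phi l)%:E)%E.
Proof.
move=> mphi r0.
rewrite -integral_itv_bndo_bndc; last first.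
  apply/measurable_EFinP; apply: measurable_funS mphi; first exact: mRpos.
  by move=> z /=; rewrite in_itv/= => /andP[z0 _]; apply/RposE.
rewrite integral_mkcond [RHS]integral_mkcond; apply: eq_integral => l _.
rewrite !patchE; have [l0|l0] := ltP 0 l.
  rewrite mem_set; last exact/RposE.
  have [lr|lr] := ltP l r.
    by rewrite mem_set ?mulr1//= in_itv/= l0.
  by rewrite memNset ?mulr0//= in_itv/= l0 ltNge lr.
rewrite memNset; last by move/RposE; rewrite ltNge l0.
by rewrite memNset//= in_itv/= ltNge l0.
Qed.

Lemma integral_trunc_le (phi : mR -> R) r : 0 < r ->
  (\int[leb]_(l in Rpos) (phi l * (l <= r)%R%:R)%:E =
   \int[leb]_(l in `]0%R, r]) (phi l)%:E)%E.
Proof.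
move=> r0; rewrite integral_mkcond [RHS]integral_mkcond; apply: eq_integral => l _.
rewrite !patchE; have [l0|l0] := ltP 0 l.
  rewrite mem_set; last exact/RposE.
  have [lr|lr] := leP l r.
    by rewrite mem_set ?mulr1//= in_itv/= l0.
  by rewrite memNset ?mulr0//= in_itv/= l0 leNgt lr.
rewrite memNset; last by move/RposE; rewrite ltNge l0.
by rewrite memNset//= in_itv/= ltNge l0.
Qed.

(** [F ^ p] is the integral of [p l ^ (p - 1)] over [0 < l < F]; Tonelli's theorem then exposes the
    level sets. Stated with a majorant [G], so that only a bound on the level sets is required. *)
Lemma layer_cake_le p (F G : mR -> \bar R) : 0 < p -> measurable_fun setT F ->
  (forall x, 0 <= F x)%E -> measurable_fun Rpos G ->
  (forall l : R, (0 < l)%R ->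
    (p * l `^ (p - 1))%:E * leb [set x | l%:E < F x] <= G l)%E ->
  (\int[leb]_x F x `^ p <= \int[leb]_(l in Rpos) G l)%E.
Proof.
move=> p0 mF F0 mG FG.
pose f (x l : mR) : \bar R := (p * l `^ (p - 1) * (l%:E < F x)%E%:R)%:E.
have f0 x l : (0 <= f x l)%E by rewrite lee_fin !mulr_ge0 ?powR_ge0// ltW.
have mphi : measurable_fun Rpos (fun l : mR => p * l `^ (p - 1)).
  by apply: measurable_funM => //; exact: measurable_fun_powR.
have mf : measurable_fun setT (fun z : mR * mR => f z.1 z.2).
  apply/measurable_EFinP; apply: measurable_funM.
    apply: measurable_funM => //.
    exact: (measurableT_comp (measurable_powR _) measurable_snd).
  have mb : measurable_fun setT (fun z : mR * mR => (z.2%:E < F z.1)%E).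
    apply: measurable_fun_lte; first exact: measurableT_comp.
    by apply: measurableT_comp.
  rewrite (_ : (fun z => _) =
    (fun z : mR * mR => if (z.2%:E < F z.1)%E then 1 else 0)); last first.
    by apply/funext => z; case: ifP.
  exact: measurable_fun_ifT.
have inner x : (F x `^ p <= \int[leb]_(l in Rpos) f x l)%E.
  have fin r : 0 < r -> (r%:E <= F x)%E -> ((r `^ p)%:E <= \int[leb]_(l in Rpos) f x l)%E.
    move=> r0 rF.
    have -> : ((r `^ p)%:E =
        \int[leb]_(l in Rpos) (p * l `^ (p - 1) * (l < r)%R%:R)%:E)%E.
      rewrite (integral_trunc_lt mphi r0) ge0_intZl//; last 3 first.
      - exact: ltW.
      - exact: measurable_fun_powR.
      - by move=> l _; exact: powR_ge0.
      rewrite integral_powR_0x//; last by lra.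
      by rewrite -EFinM subrK mulrC divfK// gt_eqF.
    apply: ge0_le_integral => //=.
    - by move=> l _; rewrite lee_fin !mulr_ge0 ?powR_ge0// ltW.
    - apply/measurable_EFinP; apply: measurable_funM => //.
      rewrite (_ : (fun z => _) = (fun z : mR => if z < r then 1 else 0)); last first.
        by apply/funext => z; case: ifP.
      apply: measurable_funTS; apply: measurable_fun_ifT => //.
      exact: measurable_fun_ltr.
    - apply/measurable_EFinP; apply: measurable_funM => //.
      rewrite (_ : (fun z => _) = (fun l : mR => if (l%:E < F x)%E then 1 else 0)); last first.
        by apply/funext => z; case: ifP.
      apply: measurable_funTS; apply: measurable_fun_ifT => //.
      by apply: measurable_fun_lte => //; exact: measurableT_comp.
    - move=> l /RposE l0; rewrite lee_fin; apply: ler_wpM2l.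
        by rewrite mulr_ge0 ?powR_ge0// ltW.
      have [lr|lr] := ltP l r; last by [].
      by rewrite (lt_le_trans _ rF).
  have := F0 x; case: (F x) fin => [r| |]// fin; last first.
    (* The value [+oo] is reached from below: the finite level [A ^ (1 / p)] already contributes
       [A], for every [A > 0]. *)
    move=> _; rewrite poweRyr ?gt_eqF// leye_eq; apply/eqP/eqyP => A A0.
    have h := fin (A `^ p^-1) (powR_gt0 _ A0) (leey _).
    by move: h; rewrite -powRrM mulVf ?gt_eqF// powRr1// ltW.
  rewrite lee_fin le_eqVlt => /predU1P[<-|r0]; last exact: fin.
  by rewrite poweR0r ?gt_eqF// integral_ge0.
apply: (@le_trans _ _ (\int[leb]_x \int[leb]_(l in Rpos) f x l)%E).
  apply: ge0_le_integral => //.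
  - by move=> x _; exact: poweR_ge0.
  - exact: measurableT_comp (measurable_poweR _) mF.
  - apply: measurable_ge0_integral2 => //; exact: measurable_funTS.
rewrite ge0_tonelli//; last exact: measurable_funTS.
apply: ge0_le_integral => //.
- by move=> l _; exact: integral_ge0.
- by apply: measurable_ge0_integral1 => //; exact: measurable_funTS.
move=> l /RposE l0; apply: le_trans (FG _ l0).
rewrite le_eqVlt; apply/orP; left; apply/eqP.
have mA : measurable [set x : mR | (l%:E < F x)%E].
  by rewrite -[X in measurable X]setTI; exact: emeasurable_fun_o_infty.
rewrite -(setIT [set x | _]) -(integral_indic leb measurableT mA) -ge0_integralZl_EFin//.
- apply: eq_integral => x _; rewrite /f -EFinM; congr ((_ * _)%:E).
  have [h|h] := boolP (l%:E < F x)%E; rewrite indicE.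
    by rewrite mem_set.
  by rewrite memNset//; exact/negP.
- by apply/measurable_EFinP; exact: measurable_indic.
- by rewrite mulr_ge0 ?powR_ge0// ltW.
Qed.

Lemma HL_maximal_ball h x r : 0 < r ->
  (\int[leb]_(y in ball x r) `|(h y)%:E| <= (2 * r)%:E * HL_maximal h x)%E.
Proof.
move=> r0; have r20 : 0 < 2 * r by rewrite mulr_gt0.
rewrite -lee_pdivrMl//; apply: ereal_sup_ubound; exists r.
  by rewrite /= in_itv/= r0.
by rewrite /iavg lebesgue_measure_ball ?(ltW r0)// mulr_natl inver mulrn_eq0/= gt_eqF.
Qed.

Let loc h : leb.-integrable setT (EFin \o h) -> locally_integrable setT h.
Proof. by move=> ih; apply: open_integrable_locally => //; exact: openT. Qed.

(** The part of [h] below [l / 2] raises no average above [l / 2], so only the truncation [k]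
    matters, at level [l / 2]; the constant 3 of the maximal inequality becomes 6. The truncation is
    what makes the layer-cake integral converge at [l = 0]. *)
Lemma HL_maximal_weak h l : leb.-integrable setT (EFin \o h) ->
  (forall y, 0 <= h y) -> 0 < l ->
  (leb [set x | l%:E < HL_maximal h x] <=
   (6 / l)%:E * \int[leb]_y (h y * (l <= 2 * h y)%R%:R)%:E)%E.
Proof.
move=> ih h0 l0.
pose k y := h y * (l <= 2 * h y)%R%:R.
have mh : measurable_fun setT h by by apply/measurable_EFinP; exact: (measurable_int _ ih).
have mk : measurable_fun setT k.
  apply: measurable_funM => //.
  rewrite (_ : (fun z => _) = (fun z : mR => if l <= 2 * h z then 1 else 0)); last first.
    by apply/funext => z; case: ifP.
  apply: measurable_fun_ifT => //; apply: measurable_fun_ler => //.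
  exact: measurable_funM.
have k0 y : 0 <= k y by rewrite mulr_ge0.
have kh y : k y <= h y by rewrite ler_piMr// lern1 leq_b1.
have ik : leb.-integrable setT (EFin \o k).
  apply: (le_integrable measurableT _ _ ih); first exact/measurable_EFinP.
  by move=> y _; rewrite lee_fin !ger0_norm.
have sub : [set x | (l%:E < HL_maximal h x)%E] `<=`
    [set x | ((l / 2)%:E < HL_maximal k x)%E].
  move=> x /=; apply: contraTT; rewrite -!leNgt => kx.
  apply: ge_ereal_sup => _ [r + <-]; rewrite /= in_itv/= andbT => r0.
  rewrite /iavg lebesgue_measure_ball ?(ltW r0)// inver mulrn_eq0/= gt_eqF//.
  rewrite lee_pdivrMl ?mulrn_wgt0//.
  apply: (@le_trans _ _ (\int[leb]_(y in ball x r) ((l / 2)%:E + (k y)%:E))%E).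
    apply: ge0_le_integral => //=.
    - exact: measurable_ball.
    - by apply/measurable_funTS/measurable_EFinP/measurableT_comp.
    - by apply/measurable_funTS/measurable_EFinP; exact: measurable_funD.
    - move=> y _; rewrite -EFinD lee_fin ger0_norm// /k.
      have [lh|lh] := leP l (2 * h y).
        by rewrite mulr1; lra.
      by rewrite mulr0; lra.
  rewrite ge0_integralD//=; last 4 first.
  - exact: measurable_ball.
  - by move=> y _; rewrite lee_fin divr_ge0 ?ltW.
  - by move=> y _; rewrite lee_fin.
  - exact/measurable_funTS/measurable_EFinP.
  rewrite integral_cst; last exact: measurable_ball.
  rewrite [X in (_ * X + _)%E](lebesgue_measure_ball x (ltW r0)).
  have hk := HL_maximal_ball k x r0.
  have kE : (\int[leb]_(y in ball x r) (k y)%:E <= (2 * r)%:E * (l / 2)%:E)%E.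
    under eq_integral do rewrite -[(k _)%:E]gee0_abs ?lee_fin//.
    apply: (le_trans hk); apply: lee_wpmul2l => //.
    by rewrite lee_fin mulr_ge0// ltW.
  apply: (@le_trans _ _ ((l / 2)%:E * (r *+ 2)%:E + (2 * r)%:E * (l / 2)%:E)%E).
    exact: leeD2l.
  by rewrite -!EFinM -EFinD lee_fin le_eqVlt; apply/orP; left; apply/eqP; field.
have mHL g : leb.-integrable setT (EFin \o g) -> 
    measurable_fun (setT : set mR) (HL_maximal g).
  by move=> ig; apply: measurable_HL_maximal; exact: loc.
apply: (@le_trans _ _ (leb [set x | ((l / 2)%:E < HL_maximal k x)%E])).
  apply: le_measure => //; rewrite inE.
    by rewrite -[X in measurable X]setTI; apply: emeasurable_fun_o_infty => //; exact: mHL.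
  by rewrite -[X in measurable X]setTI; apply: emeasurable_fun_o_infty => //; exact: mHL.
have l20 : 0 < l / 2 by rewrite divr_gt0.
apply: (le_trans (maximal_inequality (loc ik) l20)).
have -> : 3 / (l / 2) = 6 / l by field; rewrite gt_eqF.
apply: lee_wpmul2l; first by rewrite lee_fin divr_ge0 ?ltW.
rewrite le_eqVlt; apply/orP; left; apply/eqP; apply: eq_integral => y _.
by rewrite gee0_abs ?lee_fin.
Qed.

Let measurable_trunc h l : measurable_fun setT h ->
  measurable_fun setT (fun y => h y * (l <= 2 * h y)%R%:R).
Proof.
move=> mh; apply: measurable_funM => //.
rewrite (_ : (fun z => _) = (fun z : mR => if l <= 2 * h z then 1 else 0)); last first.
  by apply/funext => z; case: ifP.
apply: measurable_fun_ifT => //; apply: measurable_fun_ler => //.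
exact: measurable_funM.
Qed.

(** Marcinkiewicz interpolation between weak (1,1) and the bound for bounded functions. After
    Tonelli, [l ^ (p - 2)] is integrated up to [2 h y]; convergence at 0 needs [p > 1] and produces
    the denominator [p - 1]. *)
Lemma HL_maximal_strong p : 1 < p -> exists2 C : R, 0 < C &
  forall h, leb.-integrable setT (EFin \o h) -> (forall y, 0 <= h y) ->
  (\int[leb]_x HL_maximal h x `^ p <= C%:E * \int[leb]_y (h y `^ p)%:E)%E.
Proof.
move=> p1; have p10 : 0 < p - 1 by lra.
have p0 : 0 < p by lra.
exists (6 * p * 2 `^ (p - 1) / (p - 1)).
  by rewrite divr_gt0// mulr_gt0 ?powR_gt0// mulr_gt0.
move=> h ih h0.
have mh : measurable_fun setT h by by apply/measurable_EFinP; exact: (measurable_int _ ih).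
pose f (l y : mR) : \bar R :=
  (6 * p * l `^ (p - 2) * (h y * (l <= 2 * h y)%R%:R))%:E.
have f0 l y : (0 <= f l y)%E by rewrite lee_fin !mulr_ge0 ?powR_ge0// ltW.
have mf : measurable_fun setT (fun z : mR * mR => f z.1 z.2).
  apply/measurable_EFinP; apply: measurable_funM.
    apply: measurable_funM => //.
    exact: (measurableT_comp (measurable_powR _) measurable_fst).
  have mh2 : measurable_fun setT (fun z : mR * mR => h z.2).
    exact: measurableT_comp.
  apply: measurable_funM => //.
  rewrite (_ : (fun z => _) =
    (fun z : mR * mR => if z.1 <= 2 * h z.2 then 1 else 0)); last first.
    by apply/funext => z; case: ifP.
  apply: measurable_fun_ifT => //; apply: measurable_fun_ler => //.
  exact: measurable_funM.
apply: (@le_trans _ _ (\int[leb]_(l in Rpos) \int[leb]_y f l y)%E).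
  apply: layer_cake_le => //.
  - exact: measurable_HL_maximal (loc ih).
  - exact: HL_maximalT_ge0 (loc ih).
  - by apply: measurable_ge0_integral2 => //; exact: measurable_funTS.
  move=> l l0.
  have -> : (\int[leb]_y f l y = (6 * p * l `^ (p - 2))%:E *
      \int[leb]_y (h y * (l <= 2 * h y)%R%:R)%:E)%E.
    apply: ge0_intZl => //.
    - by rewrite !mulr_ge0 ?powR_ge0// ltW.
    - exact: measurable_trunc.
    - by move=> y _; rewrite mulr_ge0.
  have -> : 6 * p * l `^ (p - 2) = (p * l `^ (p - 1)) * (6 / l).
    rewrite (_ : p - 1 = (p - 2) + 1); last by ring.
    rewrite [X in _ = p * X * _]powRD ?(gt_eqF l0) ?implybT// powRr1 ?ltW//.
    by field; rewrite gt_eqF.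
  rewrite [in leRHS]EFinM -[leRHS]muleA; apply: lee_wpmul2l.
    by rewrite lee_fin mulr_ge0 ?powR_ge0// ltW.
  exact: HL_maximal_weak.
rewrite ge0_tonelli//; last exact: measurable_funTS.
have mhp : measurable_fun setT (fun y => h y `^ p).
  exact: measurableT_comp (measurable_powR _) mh.
have C0 : 0 < 6 * p * 2 `^ (p - 1) / (p - 1).
  by rewrite divr_gt0// mulr_gt0 ?powR_gt0// mulr_gt0.
rewrite -[leRHS](@ge0_intZl _ _ measurableT _ _ (ltW C0) mhp); last first.
  by move=> y _; exact: powR_ge0.
apply: ge0_le_integral => //.
- by move=> y _; exact: integral_ge0.
- by apply: measurable_ge0_integral1 => //; exact: measurable_funTS.
- by apply/measurable_EFinP; exact: measurable_funM.
move=> y _; have := h0 y; rewrite le_eqVlt => /predU1P[hy|hy].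
  rewrite integral0_eq; first by rewrite lee_fin; apply: mulr_ge0; [exact: ltW|exact: powR_ge0].
  by move=> l _; rewrite /f -hy mul0r mulr0.
have h20 : 0 < 2 * h y by rewrite mulr_gt0.
have -> : (\int[leb]_(l in Rpos) f l y = \int[leb]_(l in Rpos)
    (6 * p * h y * l `^ (p - 2) * (l <= 2 * h y)%R%:R)%:E)%E.
  by apply: eq_integral => l _; rewrite /f; congr EFin; ring.
rewrite (integral_trunc_le (fun l => 6 * p * h y * l `^ (p - 2)) h20).
rewrite ge0_intZl//; last 3 first.
- by rewrite !mulr_ge0// ltW.
- exact: measurable_fun_powR.
- by move=> l _; exact: powR_ge0.
rewrite integral_powR_0x//; last by lra.
rewrite -EFinM lee_fin le_eqVlt; apply/orP; left; apply/eqP.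
rewrite (_ : p - 2 + 1 = p - 1); last by ring.
rewrite powRM ?ltW// -(mulr_powRB1 (ltW hy) p0).
by field; rewrite gt_eqF.
Qed.

(** The kernel is dominated by a sum of multiples of indicators of concentric balls of radius
    [2 ^ k t], and each ball average is controlled by the maximal function. *)
Lemma poisson_le_HL_maximal h t x : measurable_fun setT h ->
  (forall y, 0 <= h y) -> 0 < t ->
  (\int[leb]_y (t / (t ^+ 2 + (x - y) ^+ 2) * h y)%:E <=
   16%:E * HL_maximal h x)%E.
Proof.
move=> mh h0 t0.
(* Bounds the kernel where [|x - y| >= 2 ^ (k - 1) t]. Times the length [2 ^ (k + 1) t] of the ball
   it gives [16 / 2 ^ (k + 1)], and these sum to 16. *)
pose c (k : nat) : R := 4 * t^-1 / (4 ^ k)%:R.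
have c0 k : 0 <= c k by rewrite /c !mulr_ge0 ?invr_ge0 ?(ltW t0).
pose g (k : nat) (y : mR) : \bar R := (c k * (h y * \1_(ball x ((2 ^ k)%:R * t) : set mR) y))%:E.
have mb k : measurable (ball x ((2 ^ k)%:R * t) : set mR) by exact: measurable_ball.
have g0 k y : (0 <= g k y)%E by rewrite lee_fin; apply: mulr_ge0 => //; apply: mulr_ge0.
have mg k : measurable_fun setT (g k).
  apply/measurable_EFinP; apply: measurable_funM => //; apply: measurable_funM => //.
apply: (@le_trans _ _ (\int[leb]_y \sum_(0 <= k <oo) g k y)%E).
  apply: ge0_le_integral => //=.
  - by move=> y _; rewrite lee_fin mulr_ge0// divr_ge0 ?(ltW t0)// addr_ge0 ?sqr_ge0.
  - apply/measurable_EFinP; apply: measurable_funM => //; apply: measurable_funM => //.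
    apply: measurable_funTS; apply: continuous_measurable_fun => y.
    apply: cvgV; first by rewrite gt_eqF// ltr_pwDl ?exprn_gt0 ?sqr_ge0.
    apply: cvgD; first exact: cvg_cst.
    by apply: (@cvg_comp _ _ _ (fun y => x - y) (fun z => z ^+ 2));
      [apply: cvgB; [exact: cvg_cst|exact: cvg_id]|exact: exprn_continuous].
  - by apply: ge0_emeasurable_sum => // k y _ _.
  move=> y _.
  have ex : exists k : nat, `|x - y| < (2 ^ k)%:R * t.
    exists (Num.bound (`|x - y| / t)); rewrite -ltr_pdivrMr//.
    apply: lt_le_trans (archi_boundP _) _; first by rewrite divr_ge0// ltW.
    by rewrite ler_nat ltnW// ltn_expl.
  (* For the least such [k], either [k = 0] and [t^2] alone controls the denominator, or minimality
     gives [2 ^ (k - 1) t <= |x - y|]. *)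
  case: (ex_minnP ex) => k hk kmin.
  apply: (@le_trans _ _ (g k y)).
    rewrite /g indicE mem_set// mulr1 lee_fin; apply: ler_wpM2r => //.
    have S0 : 0 < t ^+ 2 + (x - y) ^+ 2 by rewrite ltr_pwDl ?exprn_gt0 ?sqr_ge0.
    rewrite ler_pdivrMr//.
    case: k hk kmin => [|k] hk kmin.
      rewrite /c expn0 divr1.
      have : 0 <= 4 * t^-1 * (x - y) ^+ 2 by apply: mulr_ge0; [apply: mulr_ge0; rewrite ?invr_ge0 ?(ltW t0)|exact: sqr_ge0].
      have -> : 4 / t * (t ^+ 2 + (x - y) ^+ 2) = 4 * t + 4 / t * (x - y) ^+ 2.
        by field; rewrite gt_eqF.
      lra.
    have hk1 : (2 ^ k)%:R * t <= `|x - y|.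
      by rewrite leNgt; apply/negP => /kmin; rewrite ltnn.
    have sq : (4 ^ k)%:R * t ^+ 2 <= (x - y) ^+ 2.
      rewrite -(real_normK (num_real (x - y))) (_ : (4 ^ k)%:R * _ = ((2 ^ k)%:R * t) ^+ 2).
        by rewrite ler_sqr// ?nnegrE// mulr_ge0// ltW.
      by rewrite exprMn -natrX -expnM mulnC expnM.
    have k0 : 0 < (4 ^ k)%:R :> R by rewrite ltr0n expn_gt0.
    have -> : c k.+1 = t^-1 / (4 ^ k)%:R.
      by rewrite /c expnS natrM; field; rewrite !gt_eqF.
    rewrite -mulrA ler_pdivlMl// ler_pdivlMl//; move: sq; rewrite !expr2; nra.
  apply: le_trans (nneseries_lim_ge k.+1 _) => //.
  by rewrite big_nat_recr//= leeDr// sume_ge0.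
rewrite integral_nneseries//.
have HL0 : (0 <= HL_maximal h x)%E.
  have h20 : 0 < 2^-1 :> R by rewrite invr_gt0.
  have := HL_maximal_ball h x h20; rewrite divff// mul1e; apply: le_trans.
  exact: integral_ge0.
have gk k : (\int[leb]_y g k y <= (16 / (2 ^ k.+1)%:R)%:E * HL_maximal h x)%E.
  have -> : (\int[leb]_y g k y = (c k)%:E * \int[leb]_y (h y * \1_(ball x ((2 ^ k)%:R * t) : set mR) y)%:E)%E.
    apply: ge0_intZl => //.
    - by apply: measurable_funM => //; exact: (measurable_indic (mb k)).
    - by move=> y _; rewrite mulr_ge0.
  have r0 : 0 < (2 ^ k)%:R * t :> R by rewrite mulr_gt0// ltr0n expn_gt0.
  have -> : (16 / (2 ^ k.+1)%:R)%:E = ((c k)%:E * (2 * ((2 ^ k)%:R * t))%:E)%E.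
    rewrite -EFinM; congr EFin; rewrite /c (_ : 4 ^ k = 2 ^ k * 2 ^ k)%N.
      by rewrite expnS !natrM; field; rewrite !gt_eqF// ltr0n expn_gt0.
    by rewrite -expnMn.
  rewrite -muleA; apply: lee_wpmul2l; first by rewrite lee_fin.
  apply: le_trans (HL_maximal_ball _ _ r0).
  rewrite le_eqVlt; apply/orP; left; apply/eqP.
  rewrite [RHS]integral_mkcond; apply: eq_integral => y _.
  rewrite patchE indicE; case: ifP => _; last by rewrite mulr0.
  by rewrite mulr1 gee0_abs ?lee_fin.
case: (HL_maximal h x) HL0 gk => [r| |]// r0 gk; last first.
  by rewrite gt0_muley ?leey// lte_fin.
apply: (@le_trans _ _ (\sum_(0 <= k <oo) (16 * r / (2 ^ k.+1)%:R)%:E)%E).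
  apply: lee_nneseries => [k _ _|k _]; first exact: integral_ge0.
  by apply: le_trans (gk k) _; rewrite -EFinM mulrAC.
by apply: (le_trans (epsilon_trick0 _ _)); rewrite ?mulr_ge0// EFinM.
Qed.

End maximal_function.

(** * Dyadic decomposition of the half-line *)

Section dyadic_decomposition.
Context {R : realType}.
Local Notation leb := (@lebesgue_measure R).
Local Notation mR := (measurableTypeR R).
Implicit Types (n : int) (x y : R) (g : mR -> R) (F G : mR -> \bar R).

(** The power [2 ^ n] for an integer [n], as an exponential so that the block of [x] can be read off
    the floor of [ln x / ln 2]. *)
Definition dyad n : R := expR (n%:~R * ln 2).

Lemma dyad_gt0 n : 0 < dyad n. Proof. exact: expR_gt0. Qed.

Let ln2_gt0 : 0 < ln 2 :> R. Proof. by rewrite ln_gt0// ltr1n. Qed.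

Lemma dyadS n : dyad (n + 1) = 2 * dyad n.
Proof. by rewrite /dyad intrD mulrDl mul1r expRD lnK ?posrE// mulrC. Qed.

Lemma dyadP n : dyad (n - 1) = dyad n / 2.
Proof. by rewrite -{2}(subrK 1 n) dyadS mulrAC divff// mul1r. Qed.

Definition dyadic n : set mR := `[dyad n, 2 * dyad n[%classic.

(** A block with its two neighbours: for [x] in [dyadic n] and a positive [y] outside, [y <= x / 2]
    or [2 x <= y], which is the region of [model_le_far]. *)
Definition fat_dyadic n : set mR := `[dyad n / 2, 4 * dyad n[%classic.

Definition dyadic_index x : int := Num.floor (ln x / ln 2).

Lemma dyadicP n x : 0 < x -> dyadic n x <-> dyadic_index x = n.
Proof.
move=> x0; rewrite /dyadic /= in_itv/= -dyadS /dyad.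
rewrite -[X in _ <= X]lnK ?posrE// -[X in X < _]lnK ?posrE// ler_expR ltr_expR.
rewrite -ler_pdivlMr// -ltr_pdivrMr// /dyadic_index.
split => [h|<-]; last exact: floor_itv.
by apply/eqP; rewrite floor_eq.
Qed.

Lemma dyadic_pos n x : dyadic n x -> 0 < x.
Proof. by rewrite /dyadic/= in_itv/= => /andP[+ _]; apply: lt_le_trans; exact: dyad_gt0. Qed.

Lemma fat_dyadic_pos n x : fat_dyadic n x -> 0 < x.
Proof.
rewrite /fat_dyadic/= in_itv/= => /andP[+ _]; apply: lt_le_trans.
by rewrite divr_gt0// dyad_gt0.
Qed.

Lemma mdyadic n : measurable (dyadic n). Proof. exact: measurable_itv. Qed.

Lemma mfat_dyadic n : measurable (fat_dyadic n). Proof. exact: measurable_itv. Qed.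

Hint Resolve mdyadic mfat_dyadic : core.

(** A bijection from the naturals to the integers, so that sums over all blocks become ordinary
    series. *)
Definition int_enum (k : nat) : int := if odd k then Negz k./2 else Posz k./2.

Lemma int_enum_inj : injective int_enum.
Proof.
move=> k l; have := odd_double_half k; have := odd_double_half l.
by rewrite /int_enum; case: (odd k); case: (odd l) => // hl hk [h]; rewrite -hl -hk h.
Qed.

Lemma int_enum_surj n : exists k, int_enum k = n.
Proof.
case: n => m; [exists m.*2|exists m.*2.+1]; rewrite /int_enum/= odd_double/=.
  by rewrite doubleK.
by rewrite uphalf_double.
Qed.

Let trivIset_dyadic j : trivIset setT (fun k => dyadic (int_enum k + j)).
Proof.
move=> k l _ _ [x [dk dl]]; have x0 := dyadic_pos dk.
move: dk dl => /(dyadicP _ x0) h1 /(dyadicP _ x0) h2.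
by apply/int_enum_inj/(addIr j); rewrite -h1 -h2.
Qed.

Lemma bigcup_dyadic : \bigcup_k dyadic (int_enum k) = Rpos.
Proof.
apply/seteqP; split => [x [k _ /dyadic_pos/RposE]//|x /RposE x0].
have [k kx] := int_enum_surj (dyadic_index x).
by exists k => //; apply/(dyadicP _ x0).
Qed.

Lemma integral_dyadic F : measurable_fun (Rpos : set mR) F -> (forall x, 0 <= F x)%E ->
  (\int[leb]_(x in Rpos) F x =
   \sum_(0 <= k <oo) \int[leb]_(x in dyadic (int_enum k)) F x)%E.
Proof.
move=> mF F0; rewrite -bigcup_dyadic ge0_integral_bigcup//.
- by rewrite bigcup_dyadic.
- move=> k l _ _ [x [dk dl]]; have x0 := dyadic_pos dk.
  move: dk dl => /(dyadicP _ x0) h1 /(dyadicP _ x0) h2.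
  by apply/int_enum_inj; rewrite -h1 -h2.
Qed.

Let integral_dyadic_shift j F : measurable_fun (Rpos : set mR) F -> (forall x, 0 <= F x)%E ->
  (\sum_(0 <= k <oo) \int[leb]_(x in dyadic (int_enum k + j)) F x <=
   \int[leb]_(x in Rpos) F x)%E.
Proof.
move=> mF F0.
have sub : \bigcup_k dyadic (int_enum k + j) `<=` Rpos.
  by move=> x [k _ /dyadic_pos/RposE].
rewrite -ge0_integral_bigcup//.
- apply: ge0_subset_integral => //; exact: bigcupT_measurable.
- exact: measurable_funS mF.
Qed.

Let fat_dyadicE n : fat_dyadic n = dyadic (n - 1) `|` (dyadic n `|` dyadic (n + 1)).
Proof.
have n0 := dyad_gt0 n.
apply/seteqP; split => x; rewrite /fat_dyadic /dyadic /= !in_itv/= dyadS dyadP.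
  move=> /andP[h1 h2].
  have [h3|h3] := ltP x (dyad n); first by left; apply/andP; lra.
  right; have [h4|h4] := ltP x (2 * dyad n); first by left; apply/andP; lra.
  by right; apply/andP; lra.
by case=> [|[]] /andP[h1 h2]; apply/andP; lra.
Qed.

(** Every point lies in exactly three fat blocks, hence the factor 3. *)
Lemma le_integral_dyadic_local F G (c : R) : 0 <= c ->
  measurable_fun (Rpos : set mR) F -> (forall x, 0 <= F x)%E ->
  measurable_fun (Rpos : set mR) G -> (forall x, 0 <= G x)%E ->
  (forall n, \int[leb]_(x in dyadic n) F x <= c%:E * \int[leb]_(x in fat_dyadic n) G x)%E ->
  (\int[leb]_(x in Rpos) F x <= (3 * c)%:E * \int[leb]_(x in Rpos) G x)%E.
Proof.
move=> c0 mF F0 mG G0 FG; rewrite integral_dyadic//.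
have fatS n : (\int[leb]_(x in fat_dyadic n) G x = \int[leb]_(x in dyadic (n - 1)) G x +
    (\int[leb]_(x in dyadic n) G x + \int[leb]_(x in dyadic (n + 1)) G x))%E.
  have n0 := dyad_gt0 n.
  have mG' D : D `<=` Rpos -> measurable_fun D G by move=> D0; exact: measurable_funS mG.
  rewrite fat_dyadicE !ge0_integral_setU//=.
  - by apply: mG' => x [|] /dyadic_pos/RposE.
  - apply/disj_setPS => x /=; rewrite /dyadic /= !in_itv/= dyadS => -[/andP[h1 h2]].
    by move=> /andP[h3 h4]; lra.
  - exact: measurableU.
  - by apply: mG' => x [|[]] /dyadic_pos/RposE.
  - apply/disj_setPS => x /=; rewrite /dyadic /= !in_itv/= dyadS dyadP.
    by move=> [/andP[h1 h2]] [] /andP[h3 h4]; lra.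
apply: (@le_trans _ _ (\sum_(0 <= k <oo) (c%:E *
    (\int[leb]_(x in dyadic (int_enum k - 1)) G x +
    (\int[leb]_(x in dyadic (int_enum k + 0)) G x +
     \int[leb]_(x in dyadic (int_enum k + 1)) G x))))%E).
  apply: lee_nneseries => [k _ _|k _]; first exact: integral_ge0.
  by rewrite addr0 -fatS.
have i0 D : (0 <= \int[leb]_(x in D) G x)%E by exact: integral_ge0.
rewrite nneseriesZl; last by move=> k _; apply: adde_ge0 => //; exact: adde_ge0.
rewrite (mulrC 3 c) EFinM -[leRHS]muleA; apply: lee_wpmul2l; first by rewrite lee_fin.
pose u (j : int) k : \bar R := (\int[leb]_(x in dyadic (int_enum k + j)) G x)%E.
have u0 j k : (0 <= u j k)%E by exact: i0.
have uS j : (\sum_(0 <= k <oo) u j k <= \int[leb]_(x in Rpos) G x)%E.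
  exact: integral_dyadic_shift.
change (\sum_(0 <= k <oo) (u (-1)%R k + (u 0%R k + u 1%R k)) <=
  3%:E * \int[leb]_(x in Rpos) G x)%E.
move: (u) u0 uS => {}u u0 uS.
rewrite (@nneseriesD _ (u (-1)) (fun k => u 0%R k + u 1%R k)%E)//; last first.
  by move=> k _ _; exact: adde_ge0.
rewrite (@nneseriesD _ (u 0) (u 1))//.
have -> : (3%:E * \int[leb]_(x in Rpos) G x = \int[leb]_(x in Rpos) G x +
   (\int[leb]_(x in Rpos) G x + \int[leb]_(x in Rpos) G x))%E.
  have -> : 3 = 1 + (1 + 1) :> R by ring.
  by rewrite !EFinD !ge0_muleDl ?mul1e// lee_fin.
by apply: leeD => //; exact: leeD.
Qed.

(** The range is symmetric under inversion, so a single constant serves both signs of [delta]. *)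
Lemma powR_ratio (delta u : R) : 1 / 4 <= u <= 4 ->
  (4 `^ `|delta|)^-1 <= u `^ delta <= 4 `^ `|delta|.
Proof.
move=> /andP[u1 u2]; have u0 : 0 < u by lra.
have h4 : (4 `^ `|delta|)^-1 = (4^-1) `^ `|delta| by rewrite -powR_inv1 ?powR_ge0// -(powR_inv1 (ler0n _ 4)) -!powRrM mulrC.
have h5 v w : 0 <= v -> v <= w -> v `^ `|delta| <= w `^ `|delta|.
  by move=> v0 vw; apply: ge0_ler_powR; rewrite ?nnegrE//; lra.
have [d0|d0] := leP 0 delta.
  rewrite -[in u `^ _](ger0_norm d0) h4 !h5//; lra.
have -> : u `^ delta = u^-1 `^ `|delta|.
  by rewrite ltr0_norm// -powR_inv1 ?ltW// -powRrM mulN1r opprK.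
rewrite h4 !h5// ?invr_ge0 ?lef_pV2 ?posrE ?(ltW u0)//.
by rewrite -[leRHS]invrK lef_pV2 ?posrE//; lra.
Qed.

Lemma powR_fat_dyadic (delta : R) n x : fat_dyadic n x ->
  (4 `^ `|delta|)^-1 * dyad n `^ delta <= x `^ delta <= 4 `^ `|delta| * dyad n `^ delta.
Proof.
have n0 := dyad_gt0 n; move=> fx; have x0 := fat_dyadic_pos fx.
move: fx; rewrite /fat_dyadic/= in_itv/= => /andP[h1 h2].
have -> : x = x / dyad n * dyad n by rewrite divfK// gt_eqF.
rewrite (powRM _ (divr_ge0 (ltW x0) (ltW n0)) (ltW n0)).
have /andP[h3 h4] : (4 `^ `|delta|)^-1 <= (x / dyad n) `^ delta <= 4 `^ `|delta|.
  by apply: powR_ratio; rewrite ler_pdivlMr// ler_pdivrMr//; apply/andP; lra.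
by rewrite !ler_wpM2r ?powR_ge0.
Qed.

(** On a fat block the weight stays within a factor [K] of its value at [dyad n], so it can be
    replaced by a constant and restored at the cost of [K * K], for every real [delta]. *)
Lemma le_integral_dyadic_local_power (delta c : R) : 0 <= c -> exists2 C : R, 0 < C &
  forall F G,
  measurable_fun (Rpos : set mR) F -> (forall x, 0 <= F x)%E ->
  measurable_fun (Rpos : set mR) G -> (forall x, 0 <= G x)%E ->
  (forall n, \int[leb]_(x in dyadic n) F x <= c%:E * \int[leb]_(x in fat_dyadic n) G x)%E ->
  (\int[leb]_(x in Rpos) (F x * (x `^ delta)%:E) <=
   C%:E * \int[leb]_(x in Rpos) (G x * (x `^ delta)%:E))%E.
Proof.
move=> c0; pose K : R := 4 `^ `|delta|.
have K0 : 0 < K by rewrite powR_gt0.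
have cK : 0 <= K * K * c by rewrite !mulr_ge0// ltW.
exists (3 * (K * K * c) + 1); first by lra.
move=> F G mF F0 mG G0 FG.
have mw D : measurable_fun D (fun x : mR => (x `^ delta)%:E).
  by apply/measurable_EFinP; exact: measurable_fun_powR.
have mFw : measurable_fun (Rpos : set mR) (fun x : mR => F x * (x `^ delta)%:E)%E.
  by apply: emeasurable_funM; [|exact: mw].
have mGw : measurable_fun (Rpos : set mR) (fun x : mR => G x * (x `^ delta)%:E)%E.
  by apply: emeasurable_funM; [|exact: mw].
have w0 x : (0 <= (x `^ delta)%:E)%E by rewrite lee_fin powR_ge0.
have Fw0 x : (0 <= F x * (x `^ delta)%:E)%E by rewrite mule_ge0.
have Gw0 x : (0 <= G x * (x `^ delta)%:E)%E by rewrite mule_ge0.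
apply: (@le_trans _ _ ((3 * (K * K * c))%:E *
    \int[leb]_(x in Rpos) (G x * (x `^ delta)%:E))%E); last first.
  by apply: lee_wpmul2r; [exact: integral_ge0|rewrite lee_fin; lra].
apply: le_integral_dyadic_local => // n.
have n0 := dyad_gt0 n; set a := dyad n `^ delta.
have a0 : 0 < a by exact: powR_gt0.
have subR : fat_dyadic n `<=` Rpos by move=> x /fat_dyadic_pos/RposE.
have subD : dyadic n `<=` fat_dyadic n.
  by rewrite fat_dyadicE => x; right; left.
have wP x := @powR_fat_dyadic delta n x.
have subDR := subset_trans subD subR.
apply: (@le_trans _ _ (\int[leb]_(x in dyadic n) (F x * (K * a)%:E))%E).
  apply: ge0_le_integral => //.
  - exact: measurable_funS mFw.
  - by apply: emeasurable_funM => //; exact: measurable_funS mF.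
  - by move=> x /subD/wP/andP[_ h]; rewrite lee_wpmul2l// lee_fin.
have Ka0 : 0 <= K * a by rewrite mulr_ge0// ltW.
rewrite ge0_integralZr//; last exact: measurable_funS mF.
apply: (@le_trans _ _ (c%:E * \int[leb]_(x in fat_dyadic n) G x * (K * a)%:E)%E).
  by apply: lee_wpmul2r => //; rewrite lee_fin.
have mGf : measurable_fun (fat_dyadic n) G by exact: measurable_funS mG.
rewrite -muleA -ge0_integralZr//.
have -> : K * K * c = c * (K * K) by ring.
rewrite [in leRHS]EFinM -[leRHS]muleA; apply: lee_wpmul2l; first by rewrite lee_fin.
have mGwf : measurable_fun (fat_dyadic n) (fun x : mR => G x * (x `^ delta)%:E)%E.
  exact: measurable_funS mGw.
have KK0 : 0 <= K * K by rewrite mulr_ge0// ltW.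
have KKE : (0 <= (K * K)%:E)%E by rewrite lee_fin.
rewrite muleC -(ge0_integralZr leb (mfat_dyadic n) mGwf (fun x _ => Gw0 x) KKE).
apply: ge0_le_integral => //.
- by move=> x _; rewrite mule_ge0// lee_fin.
- by apply: emeasurable_funM.
- by apply: emeasurable_funM.
move=> x /wP/andP[h _]; rewrite -muleA lee_wpmul2l// -EFinM lee_fin.
rewrite mulrCA ler_pM2l// mulrC.
by rewrite -ler_pdivrMl.
Qed.

End dyadic_decomposition.

(** * The local part *)

Lemma integral_indic_le {R : realType} (D A B : set (measurableTypeR R)) :
  measurable D -> measurable B -> measurable_fun D (fun x => (\1_A x : R)%:E) ->
  (forall x, D x -> A x -> B x) ->
  (\int[lebesgue_measure]_(x in D) (\1_A x)%:E <= (lebesgue_measure : _ -> \bar R) B)%E.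
Proof.
move=> mD mB mA AB; rewrite -(setIT B) -(integral_indic _ measurableT mB).
apply: (@le_trans _ _ (\int[lebesgue_measure]_(x in D) (\1_B x)%:E)%E).
  apply: ge0_le_integral => //.
    by apply/measurable_EFinP; exact: measurable_indic.
  move=> x Dx; rewrite lee_fin !indicE ler_nat; have [xA|//] := boolP (x \in A).
  by rewrite mem_set//; apply: AB => //; exact/set_mem.
apply: ge0_subset_integral => //.
by apply/measurable_EFinP; exact: measurable_indic.
Qed.

Section local_maximal_function.
Context {R : realType}.
Local Notation leb := (@lebesgue_measure R).
Local Notation mR := (measurableTypeR R).
Implicit Types (n : int) (delta p l x y : R) (g : mR -> R).

Definition fat_part n g : mR -> R := fun y => g y * \1_(fat_dyadic n : set mR) y.

(** The function being maximised changes with the block of [x]; on each [dyadic n] it is the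
    Hardy-Littlewood maximal function of one fixed truncation. *)
Definition local_max g x : \bar R := HL_maximal (fat_part (dyadic_index x) g) x.

Lemma local_maxE g n x : dyadic n x -> local_max g x = HL_maximal (fat_part n g) x.
Proof. by move=> nx; rewrite /local_max ((dyadicP _ (dyadic_pos nx)).1 nx). Qed.

Lemma HL_maximal_ge0 (h : R -> R) x : (0 <= HL_maximal h x)%E.
Proof.
have h20 : 0 < 2^-1 :> R by rewrite invr_gt0.
have := HL_maximal_ball h x h20; rewrite divff// mul1e; apply: le_trans.
exact: integral_ge0.
Qed.

Lemma integral_fat_part n g :
  (\int[leb]_y (fat_part n g y)%:E = \int[leb]_(y in fat_dyadic n) (g y)%:E)%E.
Proof.
rewrite [RHS]integral_mkcond; apply: eq_integral => y _.
by rewrite /fat_part patchE indicE; case: ifP => _; rewrite ?mulr1// mulr0.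
Qed.

Lemma measurable_fat_part n g : measurable_fun setT g ->
  measurable_fun setT (fat_part n g).
Proof.
move=> mg; apply: measurable_funM => //.
exact: (measurable_indic (mfat_dyadic n)).
Qed.

Section local_bounds.
Variable g : mR -> R.
Hypotheses (mg : measurable_fun setT g) (g0 : forall y, 0 <= g y).

Lemma fat_part_ge0 n y : 0 <= fat_part n g y.
Proof. by rewrite /fat_part indicE mulr_ge0. Qed.

Lemma model_int_le_local nu t x : nu < 1 -> 0 < t -> 0 < x ->
  (model_int nu t x g <=
   5%:E * (\int[leb]_(y in Rpos) (far_kernel nu t x y * g y)%:E) +
   1728%:E * local_max g x)%E.
Proof.
move=> nu1 t0 x0; set n := dyadic_index x.
have nx : dyadic n x by apply/dyadicP.
have h0 := fat_part_ge0 n; have mh := measurable_fat_part n mg.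
pose k (y : mR) := t / (t ^+ 2 + (x - y) ^+ 2).
have mk : measurable_fun setT k.
  apply: continuous_measurable_fun => y.
  have S0 : 0 < t ^+ 2 + (x - y) ^+ 2 by rewrite ltr_pwDl ?exprn_gt0 ?sqr_ge0.
  apply: cvgM; first exact: cvg_cst.
  apply: cvgV; first by rewrite gt_eqF.
  apply: cvgD; first exact: cvg_cst.
  by apply: (@cvg_comp _ _ _ (fun y => x - y) (fun z => z ^+ 2));
    [apply: cvgB; [exact: cvg_cst|exact: cvg_id]|exact: exprn_continuous].
have k0 y : 0 <= k y by rewrite divr_ge0 ?(ltW t0)// addr_ge0 ?sqr_ge0.
have mfar : measurable_fun (Rpos : set mR) (far_kernel nu t x).
  apply: measurable_funM; first by apply: measurable_funM => //; apply: measurable_funM.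
  apply: (measurableT_comp (measurable_powR _)).
  by apply: measurable_funD => //; exact: measurable_funX.
have far0 (y : R) : 0 < y -> 0 <= far_kernel nu t x y * g y.
  by move=> y0; rewrite mulr_ge0// far_kernel_ge0// ltW.
have x10 : 0 <= x^-1 by rewrite invr_ge0 ltW.
apply: (@le_trans _ _ (\int[leb]_(y in Rpos)
   (5 * (far_kernel nu t x y * g y) +
    72 * (k y * fat_part n g y + x^-1 * fat_part n g y))%:E)%E).
  apply: ge0_le_int => //.
  - by apply: measurable_funM; [exact: measurable_model|exact: measurable_funTS].
  - apply: measurable_funD.
      apply: measurable_funM => //; apply: measurable_funM => //.
      exact: measurable_funTS.
    apply: measurable_funM => //; apply: measurable_funD.
      by apply: measurable_funTS; exact: measurable_funM.
    by apply: measurable_funTS; exact: measurable_funM.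
  move=> y /RposE y0; rewrite mulr_ge0//= ?model_kernel_ge0 ?(ltW y0)//.
  have kx0 : 0 <= k y + x^-1 by exact: addr_ge0.
  have f5 : 0 <= 5 * (far_kernel nu t x y * g y) by rewrite mulr_ge0// far0.
  have [ny|ny] := pselect (fat_dyadic n y).
    rewrite /fat_part indicE mem_set// mulr1 -mulrDl [X in _ + X]mulrA.
    apply: ler_wpDl => //; apply: ler_wpM2r => //; apply: model_le_near => //.
    rewrite (ltW y0)/=; move: nx ny.
    rewrite /dyadic /fat_dyadic /= !in_itv/= => /andP[h1 h2] /andP[h3 h4]; lra.
  rewrite /fat_part indicE memNset// !mulr0 addr0 mulr0 addr0 mulrA.
  apply: ler_wpM2r => //; apply: model_le_far => //; [exact: ltW|exact: ltW|].
  move: nx ny; rewrite /dyadic /fat_dyadic /= !in_itv/= => /andP[h1 h2].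
  move=> /negP; rewrite negb_and -ltNge -leNgt => /orP[|] h; [left|right]; lra.
rewrite (_ : (fun y => _) = (fun y : mR => (5 * (far_kernel nu t x y * g y))%:E +
    (72 * (k y * fat_part n g y + x^-1 * fat_part n g y))%:E)%E)//.
have kh0 y : 0 <= k y * fat_part n g y + x^-1 * fat_part n g y.
  by apply: addr_ge0; apply: mulr_ge0.
have mkh : measurable_fun setT (fun y => k y * fat_part n g y).
  exact: measurable_funM.
have mxh : measurable_fun setT (fun y => x^-1 * fat_part n g y).
  exact: measurable_funM.
have mkxh : measurable_fun setT (fun y => k y * fat_part n g y + x^-1 * fat_part n g y).
  exact: measurable_funD.
have mfg : measurable_fun (Rpos : set mR) (fun y => far_kernel nu t x y * g y).
  by apply: measurable_funM => //; exact: measurable_funTS.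
rewrite ge0_integralD//=; last 4 first.
- by move=> y /RposE y0; rewrite lee_fin mulr_ge0// far0.
- by apply/measurable_EFinP; exact: measurable_funM.
- by move=> y _; rewrite lee_fin mulr_ge0.
- by apply/measurable_EFinP/measurable_funTS; exact: measurable_funM.
apply: leeD.
  rewrite (@ge0_intZl R Rpos mRpos 5 _ (ler0n _ _) mfg)//.
  by move=> y /RposE; exact: far0.
apply: (@le_trans _ _ (\int[leb]_y
    (72 * (k y * fat_part n g y + x^-1 * fat_part n g y))%:E)%E).
  apply: ge0_subset_integral => //; first by apply/measurable_EFinP; exact: measurable_funM.
  by move=> y _; rewrite lee_fin mulr_ge0.
rewrite (@ge0_intZl R setT measurableT 72 _ (ler0n _ _) mkxh)//.
(* 72 comes from [model_le_near], 16 from [poisson_le_HL_maximal], and 8 from the average part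
   below. *)
have -> : 1728 = 72 * (16 + 8) :> R by ring.
rewrite EFinM -muleA; apply: lee_wpmul2l => //.
have L0 : (0 <= local_max g x)%E by exact: HL_maximal_ge0.
rewrite EFinD ge0_muleDl//.
rewrite (_ : (fun y => _) = (fun y : mR => (k y * fat_part n g y)%:E +
    (x^-1 * fat_part n g y)%:E)%E)//.
rewrite ge0_integralD//=; last 4 first.
- by move=> y _; rewrite lee_fin mulr_ge0.
- exact/measurable_EFinP.
- by move=> y _; rewrite lee_fin mulr_ge0.
- exact/measurable_EFinP.
apply: leeD; first exact: poisson_le_HL_maximal.
rewrite (@ge0_intZl R setT measurableT _ _ x10 mh)//.
rewrite lee_pdivrMl// muleA -EFinM.
(* The ball of radius [4 x] around [x] contains the fat block of [x] and has length [8 x]; divided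
   by [x] this is the 8. *)
have x40 : 0 < 4 * x by rewrite mulr_gt0.
have -> : x * 8 = 2 * (4 * x) by ring.
apply: le_trans (HL_maximal_ball _ _ x40).
rewrite [leRHS]integral_mkcond; apply: ge0_le_integral => //.
- by move=> y _; rewrite lee_fin.
- exact/measurable_EFinP.
- apply/(measurable_restrictT _ _).1; first exact: measurable_ball.
  by apply/measurable_funTS/measurableT_comp => //; exact/measurable_EFinP.
move=> y _; rewrite patchE; have [yb|yb] := boolP (y \in _).
  by rewrite gee0_abs ?lee_fin.
rewrite /fat_part indicE memNset ?mulr0// => ny; move: yb; rewrite notin_setE.
apply; rewrite /ball/= ltr_norml; move: nx ny.
by rewrite /dyadic /fat_dyadic /= !in_itv/= => /andP[h1 h2] /andP[h3 h4]; lra.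
Qed.

Variables delta p : R.
Hypothesis p1 : 1 <= p.
Hypothesis fin : (\int[leb]_(y in Rpos) (g y `^ p * y `^ delta)%:E < +oo)%E.

Let mgp D : measurable_fun D (fun y : mR => g y `^ p).
Proof. by apply: measurable_funTS; exact: measurableT_comp (measurable_powR _) mg. Qed.

(** On a fat block the weight is bounded below and the length is finite, so [g <= 1 + g ^ p] gives
    integrability for every [p >= 1]. *)
Lemma integrable_fat_part n : leb.-integrable setT (EFin \o fat_part n g).
Proof.
have n0 := @dyad_gt0 R n.
have subR : fat_dyadic n `<=` (Rpos : set mR) by move=> x /fat_dyadic_pos/RposE.
apply/integrableP; split; first by apply/measurable_EFinP; exact: measurable_fat_part.
under eq_integral do rewrite /= ger0_norm ?fat_part_ge0//.
rewrite integral_fat_part.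
pose c : R := (4 `^ `|delta|)^-1 * dyad n `^ delta.
have c0 : 0 < c by rewrite mulr_gt0 ?invr_gt0 ?powR_gt0.
apply: (@le_lt_trans _ _ (\int[leb]_(y in fat_dyadic n)
    (1%:E + (c^-1 * (g y `^ p * y `^ delta))%:E))%E).
  apply: ge0_le_integral => //=.
  - exact: mfat_dyadic.
  - by move=> y _; rewrite lee_fin.
  - exact/measurable_EFinP/measurable_funTS.
  - apply/measurable_EFinP; apply: measurable_funD => //; apply: measurable_funM => //.
    by apply: measurable_funM => //; exact: measurable_fun_powR.
  move=> y /(powR_fat_dyadic delta) /andP[h _]; rewrite -EFinD lee_fin.
  have gp0 : 0 <= g y `^ p := powR_ge0 _ _.
  have h1 : g y `^ p <= c^-1 * (g y `^ p * y `^ delta).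
    by rewrite ler_pdivlMl// mulrC; apply: ler_wpM2l.
  have [g1|g1] := leP (g y) 1; first by lra.
  by have := le1r_powR (ltW g1) p1; lra.
have mgw : measurable_fun (Rpos : set mR) (fun y => g y `^ p * y `^ delta).
  by apply: measurable_funM => //; exact: measurable_fun_powR.
have mgw' : measurable_fun (fat_dyadic n : set mR) (fun y => g y `^ p * y `^ delta).
  exact: measurable_funS mgw.
have c10 : 0 <= c^-1 by rewrite invr_ge0 ltW.
have gw0 y : 0 <= g y `^ p * y `^ delta by rewrite mulr_ge0 ?powR_ge0.
rewrite ge0_integralD//=; last 3 first.
- exact: mfat_dyadic.
- by move=> y _; rewrite lee_fin mulr_ge0.
- by apply/measurable_EFinP; exact: measurable_funM.
rewrite lte_add_pinfty//.
  rewrite integral_cst; last exact: mfat_dyadic.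
  rewrite mul1e [X in (X < _)%E](lebesgue_measure_itv `[dyad n / 2, 4 * dyad n[).
  by case: ifP => _; rewrite -?EFinD ltry.
rewrite (ge0_intZl (mfat_dyadic n) c10 mgw')//.
apply: lte_mul_pinfty => //.
apply: le_lt_trans fin; apply: ge0_subset_integral => //; first exact: mfat_dyadic.
- exact/measurable_EFinP.
- by move=> y _; rewrite lee_fin.
Qed.

Let loc n : locally_integrable setT (fat_part n g).
Proof. by apply: open_integrable_locally => //; [exact: openT|exact: integrable_fat_part]. Qed.

Lemma measurable_local_max : measurable_fun (Rpos : set mR) (local_max g).
Proof.
rewrite -(@bigcup_dyadic R); apply/measurable_fun_bigcup; first by move=> k; exact: mdyadic.
move=> k; apply: (eq_measurable_fun (HL_maximal (fat_part (int_enum k) g))).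
  by move=> x /set_mem /local_maxE ->.
by apply: measurable_funTS; exact: measurable_HL_maximal (loc _).
Qed.

End local_bounds.

Lemma local_max_weak delta : exists2 C : R, 0 < C & forall g l,
  measurable_fun setT g -> (forall y, 0 <= g y) ->
  (\int[leb]_(y in Rpos) (g y * y `^ delta)%:E < +oo)%E -> 0 < l ->
  (l%:E * \int[leb]_(x in Rpos) ((\1_[set x : mR | (l%:E < local_max g x)%E] x)%:E * (x `^ delta)%:E) <=
   C%:E * \int[leb]_(y in Rpos) (g y * y `^ delta)%:E)%E.
Proof.
(* 3 is the constant of the weak (1,1) maximal inequality, applied on each block with the level [l]
   carried inside [F]. *)
have [C C0 HC] := @le_integral_dyadic_local_power R delta 3 (ler0n _ _).
exists C => // g l mg g0 fin l0.
have fin1 : (\int[leb]_(y in Rpos) (g y `^ 1 * y `^ delta)%:E < +oo)%E.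
  by under eq_integral do rewrite powRr1//.
have mL := measurable_local_max mg g0 (lexx 1) fin1.
pose A : set mR := [set x : mR | (l%:E < local_max g x)%E].
have mA : measurable_fun (Rpos : set mR) (fun x => (\1_A x)%:E : \bar R).
  have mB : measurable (Rpos `&` A) by exact: emeasurable_fun_o_infty.
  apply: (eq_measurable_fun (fun x : mR => (\1_(Rpos `&` A) x)%:E)).
    by move=> x xR; rewrite !indicE in_setI xR.
  by apply/measurable_EFinP; exact: measurable_indic.
have w0 (y : mR) : (0 <= (y `^ delta)%:E)%E by rewrite lee_fin powR_ge0.
have mAw : measurable_fun (Rpos : set mR) (fun x => (\1_A x)%:E * (x `^ delta)%:E)%E.
  apply: emeasurable_funM => //; apply/measurable_EFinP; exact: measurable_fun_powR.
rewrite -ge0_integralZl_EFin//; last 2 first.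
- by move=> x _; rewrite mule_ge0// lee_fin.
- exact: ltW.
have := HC (fun x => l%:E * (\1_A x)%:E)%E (fun y => (g y)%:E).
under eq_integral do rewrite muleA.
apply.
- by apply: emeasurable_funM.
- by move=> x; rewrite mule_ge0// lee_fin// ltW.
- exact/measurable_EFinP/measurable_funTS.
- by move=> y; rewrite lee_fin.
move=> n; have ig := integrable_fat_part mg g0 (lexx 1) fin1 n.
have lo : locally_integrable setT (fat_part n g).
  by apply: open_integrable_locally => //; exact: openT.
have subR : dyadic n `<=` (Rpos : set mR) by move=> x /dyadic_pos/RposE.
have mAn : measurable_fun (dyadic n : set mR) (fun x => (\1_A x)%:E : \bar R).
  exact: measurable_funS mA.
rewrite ge0_integralZl_EFin//; [|exact: mdyadic|exact: ltW].
have l10 : (0 <= (l^-1)%:E)%E by rewrite lee_fin invr_ge0 ltW.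
rewrite -lee_pdivlMl// muleA -EFinM mulrC.
have := maximal_inequality lo l0.
have -> : (\int[leb]_y `|(fat_part n g y)%:E| = \int[leb]_(y in fat_dyadic n) (g y)%:E)%E.
  rewrite -integral_fat_part; apply: eq_integral => y _.
  by rewrite gee0_abs// lee_fin fat_part_ge0.
apply: le_trans.
pose B : set mR := [set x : mR | (l%:E < HL_maximal (fat_part n g) x)%E].
have mB : measurable B.
  have mH : measurable_fun (setT : set mR) (HL_maximal (fat_part n g)).
    exact: (measurable_HL_maximal lo).
  rewrite -(setTI B); apply: emeasurable_fun_o_infty; last exact: mH.
  exact: measurableT.
apply: (integral_indic_le (mdyadic n) mB mAn) => x nx.
by rewrite /A /B /= (local_maxE g nx).
Qed.

Lemma local_max_strong delta p : 1 < p -> exists2 C : R, 0 < C & forall g,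
  measurable_fun setT g -> (forall y, 0 <= g y) ->
  (\int[leb]_(y in Rpos) (g y `^ p * y `^ delta)%:E < +oo)%E ->
  (\int[leb]_(x in Rpos) (local_max g x `^ p * (x `^ delta)%:E) <=
   C%:E * \int[leb]_(y in Rpos) (g y `^ p * y `^ delta)%:E)%E.
Proof.
move=> p1; have [C1 C10 HL] := @HL_maximal_strong R p p1.
have p0 : 0 < p by lra.
have [C C0 HC] := @le_integral_dyadic_local_power R delta C1 (ltW C10).
exists C => // g mg g0 fin.
have mL := measurable_local_max mg g0 (ltW p1) fin.
apply: (HC (fun x => local_max g x `^ p)%E (fun y => (g y `^ p)%:E)).
- exact: measurableT_comp (measurable_poweR _) mL.
- by move=> x; exact: poweR_ge0.
- by apply/measurable_EFinP/measurable_funTS; exact: measurableT_comp (measurable_powR _) mg.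
- by move=> y; rewrite lee_fin powR_ge0.
move=> n; have ig := integrable_fat_part mg g0 (ltW p1) fin n.
have lo : locally_integrable setT (fat_part n g).
  by apply: open_integrable_locally => //; exact: openT.
have := HL _ ig (fat_part_ge0 g0 n).
have -> : (\int[leb]_y (fat_part n g y `^ p)%:E =
    \int[leb]_(y in fat_dyadic n) (g y `^ p)%:E)%E.
  rewrite [RHS]integral_mkcond; apply: eq_integral => y _.
  rewrite /fat_part patchE indicE; case: ifP => _; rewrite ?mulr1// mulr0 powR0//.
  by rewrite gt_eqF.
apply: le_trans.
have mH : measurable_fun setT (fun x : mR => HL_maximal (fat_part n g) x `^ p)%E.
  exact: measurableT_comp (measurable_poweR _) (measurable_HL_maximal lo).
apply: (@le_trans _ _ (\int[leb]_(x in dyadic n) (HL_maximal (fat_part n g) x `^ p))%E).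
  rewrite le_eqVlt; apply/orP; left; apply/eqP; apply: eq_integral => x /set_mem nx.
  by rewrite (local_maxE g nx).
apply: ge0_subset_integral => //; first exact: mdyadic.
by move=> x _; exact: poweR_ge0.
Qed.

End local_maximal_function.

(** * Schur's test *)

Section schur.
Context {R : realType}.
Local Notation leb := (@lebesgue_measure R).
Local Notation mR := (measurableTypeR R).
Implicit Types (p s c delta x y : R) (g u v : mR -> R) (k : mR -> mR -> R).

Lemma measurable_powRc (D : set mR) u p : measurable_fun D u ->
  measurable_fun D (fun y => u y `^ p).
Proof. exact: measurableT_comp (measurable_powR _). Qed.

(** Raised to the power [p], so that it can be integrated in a further variable and remains
    meaningful with infinite integrals. *)
Lemma hoelder_powR (D : set mR) p u v : 1 < p -> measurable D ->
  measurable_fun D u -> measurable_fun D v ->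
  (forall y, D y -> 0 <= u y) -> (forall y, D y -> 0 <= v y) ->
  ((\int[leb]_(y in D) (u y * v y)%:E) `^ p <=
   (\int[leb]_(y in D) (u y `^ (p / (p - 1)))%:E) `^ (p - 1) *
   \int[leb]_(y in D) (v y `^ p)%:E)%E.
Proof.
move=> p1 mD mu mv u0 v0; set q := p / (p - 1).
have p10 : 0 < p - 1 by lra.
have p0 : 0 < p by lra.
have q0 : 0 < q by rewrite divr_gt0.
have pq : q^-1 + p^-1 = 1 by rewrite /q; field; rewrite !gt_eqF.
pose U : mR -> R := u \_ D; pose V : mR -> R := v \_ D.
have mU : measurable_fun setT U by apply/(measurable_restrictT _ _).1.
have mV : measurable_fun setT V by apply/(measurable_restrictT _ _).1.
have U0 y : 0 <= U y by rewrite /U patchE; case: ifP => // /set_mem; exact: u0.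
have V0 y : 0 <= V y by rewrite /V patchE; case: ifP => // /set_mem; exact: v0.
have powI r (w : mR -> R) : 0 < r -> (forall y, D y -> 0 <= w y) ->
    (\int[leb]_y `|(EFin \o (w \_ D)) y| `^ r = \int[leb]_(y in D) (w y `^ r)%:E)%E.
  move=> r0 w0; rewrite [RHS]integral_mkcond; apply: eq_integral => y _.
  rewrite /= !patchE; case: ifPn => [/set_mem/w0 wy|_].
    by rewrite ger0_norm.
  change ((`|0 : R| `^ r)%:E = 0%E).
  by rewrite normr0 powR0// gt_eqF.
have := hoelder leb mU mV q0 p0 pq.
have -> : ('N[leb]_1[EFin \o (U \* V)%R] = \int[leb]_(y in D) (u y * v y)%:E)%E.
  rewrite Lnorm1 [RHS]integral_mkcond; apply: eq_integral => y _.
  rewrite gee0_abs ?lee_fin ?mulr_ge0//= /U /V !patchE.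
  by case: ifP => _; rewrite ?mulr0.
move=> H; have H2 := @gt0_ler_poweR R p (ltW p0) _ _ _ _ H.
apply: (le_trans (H2 _ _)).
- by rewrite in_itv/= leey andbT; apply: integral_ge0 => y Dy;
    rewrite lee_fin mulr_ge0 ?u0 ?v0.
- by rewrite in_itv/= leey andbT; apply: mule_ge0; exact: Lnorm_ge0.
have pE : p = q * (p - 1) by rewrite /q divfK// gt_eqF.
have -> : (('N[leb]_q%:E[EFin \o U] * 'N[leb]_p%:E[EFin \o V]) `^ p =
    'N[leb]_q%:E[EFin \o U] `^ p * 'N[leb]_p%:E[EFin \o V] `^ p)%E.
  by apply: poweRM; exact: Lnorm_ge0.
rewrite [X in (X * _)%E](_ : _ = ('N[leb]_q%:E[EFin \o U] `^ q) `^ (p - 1))%E; last first.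
  by rewrite -poweRrM -pE.
have q_neq0 : q != 0 by rewrite gt_eqF.
have p_neq0 : p != 0 by rewrite gt_eqF.
have NU : ('N[leb]_q%:E[EFin \o U] `^ q = \int[leb]_(y in D) (u y `^ q)%:E)%E.
  rewrite (powR_Lnorm leb (EFin \o U) q_neq0); exact: powI q u q0 u0.
have NV : ('N[leb]_p%:E[EFin \o V] `^ p = \int[leb]_(y in D) (v y `^ p)%:E)%E.
  rewrite (powR_Lnorm leb (EFin \o V) p_neq0); exact: powI p v p0 v0.
by rewrite NU NV.
Qed.

Section kernel.
Variables (k : mR -> mR -> R) (p s c c' delta : R).
Hypotheses (p1 : 1 <= p) (ps : p = 1 -> s = 0) (c0 : 0 < c) (c'0 : 0 <= c').
Hypothesis mk : measurable_fun setT (fun z : mR * mR => k z.1 z.2).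
Hypothesis k0 : forall x y : R, 0 < x -> 0 < y -> 0 <= k x y.
Hypothesis row : 1 < p -> forall x : R, 0 < x ->
  (\int[leb]_(y in Rpos) (k x y * y `^ (- (s / (p - 1))))%:E <=
   (c * x `^ (- (s / (p - 1))))%:E)%E.
Hypothesis column : forall y : R, 0 < y ->
  (\int[leb]_(x in Rpos) (k x y * x `^ (delta - s))%:E <= (c' * y `^ (delta - s))%:E)%E.
Variable g : mR -> R.
Hypotheses (mg : measurable_fun setT g) (g0 : forall y, 0 <= g y).

Let mkx x : measurable_fun (Rpos : set mR) (k x).
Proof.
apply: measurable_funTS.
exact: (measurableT_comp mk (measurable_pair1 x)).
Qed.

(** Hölder's inequality for [k] split as [k ^ ((p - 1) / p)] times [k ^ (1 / p)], with [y ^ (s / p)]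
    moved from one factor to the other. The row condition evaluates the dual factor. For [p = 1]
    there is nothing to split, and [s = 0] makes it an equality. *)
Let pointwise x : 0 < x ->
  ((\int[leb]_(y in Rpos) (k x y * g y)%:E) `^ p <=
   (c `^ (p - 1) * x `^ (- s))%:E *
   \int[leb]_(y in Rpos) (k x y * y `^ s * g y `^ p)%:E)%E.
Proof.
move=> x0; have p0 : 0 < p by have := p1; lra.
have i0 : (0 <= \int[leb]_(y in Rpos) (k x y * g y)%:E)%E.
  by apply: integral_ge0 => y /RposE y0; rewrite lee_fin mulr_ge0 ?k0.
have [p_eq1|p_neq1] := eqVneq p 1.
  rewrite p_eq1 (ps p_eq1) subrr oppr0 !powRr0 mul1r mul1e poweRe1//.
  rewrite le_eqVlt; apply/orP; left; apply/eqP; apply: eq_integral => y _.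
  by rewrite powRr0 mulr1 powRr1.
have p_gt1 : 1 < p by rewrite lt_neqAle eq_sym p_neq1.
have p10 : 0 < p - 1 by lra.
pose u (y : mR) := k x y `^ ((p - 1) / p) * y `^ (- (s / p)).
pose v (y : mR) := k x y `^ p^-1 * (y `^ (s / p) * g y).
have kE y : 0 < y -> k x y = k x y `^ ((p - 1) / p) * k x y `^ p^-1.
  move=> y0; rewrite -powRD; last first.
    by rewrite (_ : _ + _ = 1) ?oner_eq0//; field; rewrite gt_eqF.
  by rewrite (_ : _ + _ = 1) ?powRr1 ?k0//; field; rewrite gt_eqF.
have -> : (\int[leb]_(y in Rpos) (k x y * g y)%:E =
    \int[leb]_(y in Rpos) (u y * v y)%:E)%E.
  apply: eq_integral => y /set_mem/RposE y0; rewrite /u /v {1}(kE _ y0).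
  rewrite powRN; congr EFin; field; rewrite gt_eqF// powR_gt0//.
have mu : measurable_fun (Rpos : set mR) u.
  by apply: measurable_funM; [exact: measurable_powRc|exact: measurable_fun_powR].
have mv : measurable_fun (Rpos : set mR) v.
  apply: measurable_funM; first exact: measurable_powRc.
  by apply: measurable_funM; [exact: measurable_fun_powR|exact: measurable_funTS].
have u0 y : Rpos y -> 0 <= u y by move=> _; rewrite mulr_ge0 ?powR_ge0.
have v0 y : Rpos y -> 0 <= v y by move=> _; rewrite !mulr_ge0 ?powR_ge0.
apply: (le_trans (hoelder_powR p_gt1 mRpos mu mv u0 v0)).
have -> : (\int[leb]_(y in Rpos) (v y `^ p)%:E =
    \int[leb]_(y in Rpos) (k x y * y `^ s * g y `^ p)%:E)%E.
  apply: eq_integral => y /set_mem/RposE y0; congr EFin; rewrite /v.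
  rewrite !powRM ?mulr_ge0 ?powR_ge0// -!powRrM mulVf ?gt_eqF// powRr1 ?k0//.
  by rewrite divfK ?gt_eqF// mulrA.
have -> : (\int[leb]_(y in Rpos) (u y `^ (p / (p - 1)))%:E =
    \int[leb]_(y in Rpos) (k x y * y `^ (- (s / (p - 1))))%:E)%E.
  apply: eq_integral => y /set_mem/RposE y0; congr EFin; rewrite /u.
  rewrite powRM ?powR_ge0// -!powRrM (_ : _ / p * _ = 1); last first.
    by field; rewrite !gt_eqF.
  rewrite powRr1 ?k0//; congr (_ * _ `^ _); field; rewrite !gt_eqF//.
apply: lee_wpmul2r.
  by apply: integral_ge0 => y /RposE y0; rewrite lee_fin !mulr_ge0 ?powR_ge0 ?k0.
have cx0 : 0 <= c * x `^ (- (s / (p - 1))) by rewrite mulr_ge0 ?powR_ge0// ltW.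
apply: (@le_trans _ _ ((c * x `^ (- (s / (p - 1))))%:E `^ (p - 1))%E).
  apply: gt0_ler_poweR; [exact: ltW| | |exact: row].
    rewrite in_itv/= leey andbT; apply: integral_ge0 => y /RposE y0.
    by rewrite lee_fin mulr_ge0 ?powR_ge0 ?k0.
  by rewrite in_itv/= leey andbT lee_fin.
rewrite poweR_EFin lee_fin powRM ?powR_ge0 ?(ltW c0)// -powRrM.
by rewrite mulNr divfK// gt_eqF.
Qed.

Lemma measurable_kernel_int :
  measurable_fun (Rpos : set mR) (fun x => \int[leb]_(y in Rpos) (k x y * g y)%:E)%E.
Proof.
apply: (@measurable_ge0_integral2 R Rpos Rpos (fun x y => (k x y * g y)%:E)) => //.
- apply: measurable_funTS; apply/measurable_EFinP; apply: measurable_funM => //.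
  exact: measurableT_comp.
- by move=> x y /RposE x0 /RposE y0; rewrite lee_fin mulr_ge0 ?k0.
Qed.

(** After [pointwise], Tonelli's theorem brings the integral in [x] inside, where the column
    condition applies: the factor [x ^ (- s)] left by the rows turns the weight into
    [x ^ (delta - s)]. *)
Lemma schur_test :
  (\int[leb]_(x in Rpos) ((\int[leb]_(y in Rpos) (k x y * g y)%:E) `^ p * (x `^ delta)%:E) <=
   (c `^ (p - 1) * c')%:E * \int[leb]_(y in Rpos) (g y `^ p * y `^ delta)%:E)%E.
Proof.
pose f (x y : mR) : \bar R := (k x y * x `^ (delta - s) * (y `^ s * g y `^ p))%:E.
have f0 x y : Rpos x -> Rpos y -> (0 <= f x y)%E.
  by move=> /RposE x0 /RposE y0; rewrite lee_fin !mulr_ge0 ?powR_ge0 ?k0.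
have mgp : measurable_fun setT (fun y => g y `^ p) by exact: measurable_powRc.
have mf : measurable_fun (Rpos `*` Rpos) (fun z : mR * mR => f z.1 z.2).
  apply: measurable_funTS; apply/measurable_EFinP; apply: measurable_funM.
    apply: measurable_funM => //.
    exact: (measurableT_comp (measurable_powR _) measurable_fst).
  apply: measurable_funM.
    exact: (measurableT_comp (measurable_powR _) measurable_snd).
  exact: (measurableT_comp mgp measurable_snd).
have cp0 : 0 <= c `^ (p - 1) by exact: powR_ge0.
have mF := measurable_ge0_integral2 mRpos mRpos mf f0.
have mG := measurable_ge0_integral1 mRpos mRpos mf f0.
apply: (@le_trans _ _ (\int[leb]_(x in Rpos) ((c `^ (p - 1))%:E *
    \int[leb]_(y in Rpos) f x y))%E).
  apply: ge0_le_integral => //.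
  - by move=> x _; rewrite mule_ge0 ?poweR_ge0// lee_fin powR_ge0.
  - apply: emeasurable_funM; last by apply/measurable_EFinP; exact: measurable_fun_powR.
    exact: measurableT_comp (measurable_poweR _) measurable_kernel_int.
  - by apply: emeasurable_funM; [exact: measurable_cst|exact: mF].
  move=> x /RposE x0; have := pointwise x0.
  move=> /(lee_wpmul2r (x := (x `^ delta)%:E)); rewrite lee_fin powR_ge0 => /(_ isT).
  move/le_trans; apply; rewrite le_eqVlt; apply/orP; left; apply/eqP.
  have kg0 y : Rpos y -> 0 <= k x y * y `^ s * g y `^ p.
    by move=> /RposE y0; rewrite !mulr_ge0 ?powR_ge0 ?k0.
  have mkg : measurable_fun (Rpos : set mR) (fun y => k x y * y `^ s * g y `^ p).
    apply: measurable_funM; last exact: measurable_funTS.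
    by apply: measurable_funM => //; exact: measurable_fun_powR.
  have -> : (\int[leb]_(y in Rpos) f x y = (x `^ (delta - s))%:E *
      \int[leb]_(y in Rpos) (k x y * y `^ s * g y `^ p)%:E)%E.
    rewrite -(ge0_intZl mRpos (powR_ge0 _ _) mkg kg0).
    by apply: eq_integral => y _; rewrite /f; congr EFin; ring.
  rewrite muleAC muleA -!EFinM; congr (_%:E * _)%E.
  rewrite -mulrA; congr (_ * _); rewrite -powRD; last first.
    by rewrite (gt_eqF x0) implybT.
  by rewrite addrC.
have F0 x : Rpos x -> (0 <= \int[leb]_(y in Rpos) f x y)%E.
  by move=> Rx; apply: integral_ge0 => y; exact: f0.
rewrite (ge0_integralZl_EFin leb mRpos F0 mF cp0).
rewrite EFinM -muleA; apply: lee_wpmul2l; first by rewrite lee_fin.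
rewrite (ge0_tonelli mRpos mRpos mf f0).
have mgw : measurable_fun (Rpos : set mR) (fun y => g y `^ p * y `^ delta).
  by apply: measurable_funM; [exact: measurable_funTS|exact: measurable_fun_powR].
rewrite -(ge0_intZl mRpos c'0 mgw); last first.
  by move=> y _; rewrite mulr_ge0 ?powR_ge0.
apply: ge0_le_integral.
- exact: mRpos.
- by move=> y Ry; apply: integral_ge0 => x Rx; exact: f0.
- exact: mG.
- by apply/measurable_EFinP; exact: measurable_funM.
move=> y /RposE y0.
have mky : measurable_fun (Rpos : set mR) (fun x => k x y * x `^ (delta - s)).
  apply: measurable_funM; last exact: measurable_fun_powR.
  apply: measurable_funTS; exact: (measurableT_comp mk (measurable_pair2 y)).
have b0 : 0 <= y `^ s * g y `^ p by rewrite mulr_ge0 ?powR_ge0.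
have -> : (\int[leb]_(x in Rpos) f x y = (y `^ s * g y `^ p)%:E *
    \int[leb]_(x in Rpos) (k x y * x `^ (delta - s))%:E)%E.
  rewrite -(ge0_intZl mRpos b0 mky); last first.
    by move=> x /RposE x0; rewrite mulr_ge0 ?powR_ge0 ?k0.
  by apply: eq_integral => x _; rewrite /f; congr EFin; ring.
apply: (@le_trans _ _ ((y `^ s * g y `^ p)%:E * (c' * y `^ (delta - s))%:E)%E).
  by apply: lee_wpmul2l; [rewrite lee_fin|exact: column].
rewrite -EFinM lee_fin le_eqVlt; apply/orP; left; apply/eqP.
have -> : y `^ delta = y `^ s * y `^ (delta - s).
  by rewrite -powRD ?(gt_eqF y0) ?implybT// addrC subrK.
ring.
Qed.

End kernel.
End schur.

(** * The part away from the diagonal *)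

Section hardy.
Context {R : realType}.
Local Notation leb := (@lebesgue_measure R).
Local Notation mR := (measurableTypeR R).
Implicit Types (nu p s t delta r x y : R) (g phi : mR -> R).

Lemma integral_trunc_gt phi r : 0 < r ->
  (\int[leb]_(l in Rpos) (phi l * (r < l)%R%:R)%:E =
   \int[leb]_(l in `]r, +oo[) (phi l)%:E)%E.
Proof.
move=> r0; rewrite integral_mkcond [RHS]integral_mkcond; apply: eq_integral => l _.
rewrite !patchE; have [l0|l0] := ltP 0 l.
  rewrite mem_set; last exact/RposE.
  have [lr|lr] := ltP r l; first by rewrite mem_set ?mulr1//= in_itv/= lr.
  by rewrite memNset ?mulr0//= in_itv/= andbT ltNge lr.
rewrite memNset; last by move/RposE; rewrite ltNge l0.
by rewrite memNset//= in_itv/= andbT ltNge (le_trans l0 (ltW r0)).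
Qed.

Lemma integral_trunc_ge phi r : measurable_fun (Rpos : set mR) phi -> 0 < r ->
  (\int[leb]_(l in Rpos) (phi l * (r <= l)%R%:R)%:E =
   \int[leb]_(l in `]r, +oo[) (phi l)%:E)%E.
Proof.
move=> mphi r0; rewrite [RHS]integral_itv_obnd_cbnd; last first.
  apply/measurable_EFinP; apply: measurable_funS mphi; first exact: mRpos.
  by move=> z /=; rewrite in_itv/= andbT => rz; apply/RposE/(lt_trans r0).
rewrite integral_mkcond [RHS]integral_mkcond; apply: eq_integral => l _.
rewrite !patchE; have [l0|l0] := ltP 0 l.
  rewrite mem_set; last exact/RposE.
  have [lr|lr] := leP r l; first by rewrite mem_set ?mulr1//= in_itv/= lr.
  by rewrite memNset ?mulr0//= in_itv/= andbT leNgt lr.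
rewrite memNset; last by move/RposE; rewrite ltNge l0.
by rewrite memNset//= in_itv/= andbT leNgt (le_lt_trans l0 r0).
Qed.

Let mul_powR x a b : 0 < x -> x `^ a * x `^ b = x `^ (a + b).
Proof. by move=> x0; rewrite powRD// (gt_eqF x0) implybT. Qed.

Let mul4l (a b c d : R) : a * b * c * d = a * (b * d) * c. Proof. by ring. Qed.

Let mul4r (a b c d : R) : a * b * c * d = b * (a * d) * c. Proof. by ring. Qed.

Definition lower_kernel x y : R := x `^ (- 2) * y * (y <= x)%R%:R.

Definition upper_kernel nu x y : R := x `^ (- (2 * nu)) * y `^ (2 * nu - 1) * (x < y)%R%:R.

Definition hardy_lower g x : \bar R :=
  (\int[leb]_(y in Rpos) (lower_kernel x y * g y)%:E)%E.

Definition hardy_upper nu g x : \bar R :=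
  (\int[leb]_(y in Rpos) (upper_kernel nu x y * g y)%:E)%E.

Lemma lower_kernel_ge0 x y : 0 < x -> 0 < y -> 0 <= lower_kernel x y.
Proof. by move=> x0 y0; rewrite /lower_kernel !mulr_ge0 ?powR_ge0// ltW. Qed.

Lemma upper_kernel_ge0 nu x y : 0 < x -> 0 < y -> 0 <= upper_kernel nu x y.
Proof. by move=> x0 y0; rewrite /upper_kernel !mulr_ge0 ?powR_ge0. Qed.

Lemma measurable_lower_kernel :
  measurable_fun setT (fun z : mR * mR => lower_kernel z.1 z.2).
Proof.
apply: measurable_funM.
  apply: measurable_funM => //.
  exact: (measurableT_comp (measurable_powR _) measurable_fst).
rewrite (_ : (fun z => _) = (fun z : mR * mR => if z.2 <= z.1 then 1 else 0)); last first.
  by apply/funext => z; case: ifP.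
by apply: measurable_fun_ifT => //; apply: measurable_fun_ler.
Qed.

Lemma measurable_upper_kernel nu :
  measurable_fun setT (fun z : mR * mR => upper_kernel nu z.1 z.2).
Proof.
apply: measurable_funM.
  apply: measurable_funM.
    exact: (measurableT_comp (measurable_powR _) measurable_fst).
  exact: (measurableT_comp (measurable_powR _) measurable_snd).
rewrite (_ : (fun z => _) = (fun z : mR * mR => if z.1 < z.2 then 1 else 0)); last first.
  by apply/funext => z; case: ifP.
by apply: measurable_fun_ifT => //; apply: measurable_fun_ltr.
Qed.

Section bounds.
Variable g : mR -> R.
Hypotheses (mg : measurable_fun setT g) (g0 : forall y, 0 <= g y).

Lemma hardy_lower_ge0 x : 0 < x -> (0 <= hardy_lower g x)%E.
Proof.
move=> x0; apply: integral_ge0 => y /RposE y0.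
by rewrite lee_fin mulr_ge0// lower_kernel_ge0.
Qed.

Lemma hardy_upper_ge0 nu x : 0 < x -> (0 <= hardy_upper nu g x)%E.
Proof.
move=> x0; apply: integral_ge0 => y /RposE y0.
by rewrite lee_fin mulr_ge0// upper_kernel_ge0.
Qed.

Lemma measurable_hardy_lower : measurable_fun (Rpos : set mR) (hardy_lower g).
Proof. exact: (measurable_kernel_int measurable_lower_kernel lower_kernel_ge0 mg g0). Qed.

Lemma measurable_hardy_upper nu : measurable_fun (Rpos : set mR) (hardy_upper nu g).
Proof.
exact: (measurable_kernel_int (measurable_upper_kernel nu) (@upper_kernel_ge0 nu) mg g0).
Qed.

Let measurable_row (k : mR -> mR -> R) x : measurable_fun setT (fun z : mR * mR => k z.1 z.2) ->
  measurable_fun (Rpos : set mR) (fun y => k x y * g y).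
Proof.
move=> mk; apply: measurable_funTS; apply: measurable_funM => //.
exact: (measurableT_comp mk (measurable_pair1 x)).
Qed.

Lemma measurable_far nu t x : 0 < t -> measurable_fun (setT : set mR) (far_kernel nu t x).
Proof.
move=> t0; apply: measurable_funM; first by apply: measurable_funM => //; apply: measurable_funM.
apply: (measurableT_comp (measurable_powR _)).
by apply: measurable_funD => //; exact: measurable_funX.
Qed.

Lemma far_int_le nu t x : nu < 1 -> 0 < t -> 0 < x ->
  (\int[leb]_(y in Rpos) (far_kernel nu t x y * g y)%:E <=
   hardy_lower g x + hardy_upper nu g x)%E.
Proof.
move=> nu1 t0 x0; have mk1 := measurable_row x measurable_lower_kernel.
have mk2 := measurable_row x (measurable_upper_kernel nu).
rewrite /hardy_lower /hardy_upper -ge0_integralD//=; last 4 first.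
- by move=> y /RposE y0; rewrite lee_fin mulr_ge0// lower_kernel_ge0.
- exact/measurable_EFinP.
- by move=> y /RposE y0; rewrite lee_fin mulr_ge0// upper_kernel_ge0.
- exact/measurable_EFinP.
apply: ge0_le_integral => //.
- by move=> y /RposE y0; rewrite lee_fin mulr_ge0// far_kernel_ge0// ltW.
- apply/measurable_EFinP; apply: measurable_funTS; apply: measurable_funM => //.
  exact: measurable_far.
- by apply: emeasurable_funD; exact/measurable_EFinP.
move=> y /RposE y0; rewrite -EFinD lee_fin -mulrDl; apply: ler_wpM2r => //.
rewrite /lower_kernel /upper_kernel; have [yx|xy] := leP y x.
  by rewrite mulr0 addr0 mulr1; apply: far_le_below => //; exact: ltW.
by rewrite mulr0 add0r mulr1; exact: far_le_above.
Qed.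

End bounds.

Lemma hardy_lower_strong p delta : 1 <= p -> delta < 2 * p - 1 ->
  exists2 C : R, 0 < C & forall g, measurable_fun setT g -> (forall y, 0 <= g y) ->
  (\int[leb]_(x in Rpos) (hardy_lower g x `^ p * (x `^ delta)%:E) <=
   C%:E * \int[leb]_(y in Rpos) (g y `^ p * y `^ delta)%:E)%E.
Proof.
(* The columns converge for [s > delta - 1], the rows for [s < 2 (p - 1)]. The midpoint works, and
   the interval is nonempty exactly when [delta < 2 p - 1]. *)
move=> p1 dp; pose s : R := if p == 1 then 0 else (delta - 1 + 2 * (p - 1)) / 2.
have p1s : p = 1 -> s = 0 by move=> p_eq; rewrite /s p_eq eqxx.
have s1 : delta - s - 1 < 0.
  rewrite /s; case: eqP => [p_eq|/eqP p_neq]; first by lra.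
  have : 1 < p by rewrite lt_neqAle eq_sym p_neq.
  lra.
have s2 : 1 < p -> s / (p - 1) < 2.
  move=> p_gt1; have p10 : 0 < p - 1 by lra.
  rewrite ltr_pdivrMr// /s gt_eqF//; lra.
(* The absolute value and the added 1 keep [c] positive also for [p = 1], where the division is by 0
   and the row condition is void. *)
pose c : R := `|2 - s / (p - 1)|^-1 + 1.
have c0 : 0 < c by rewrite ltr_wpDl// invr_ge0.
pose c' : R := (1 + s - delta)^-1.
have c'0 : 0 < c' by rewrite invr_gt0; lra.
exists (c `^ (p - 1) * c'); first by rewrite mulr_gt0// powR_gt0.
move=> g mg g0.
apply: (@schur_test R lower_kernel p s c c' delta p1 p1s c0 (ltW c'0)
  measurable_lower_kernel lower_kernel_ge0) => //.
- move=> p_gt1 x x0; have {}s2 := s2 p_gt1; set q := s / (p - 1) in s2 *.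
  have -> : (\int[leb]_(y in Rpos) (lower_kernel x y * y `^ (- q))%:E =
      \int[leb]_(y in Rpos) (x `^ (- 2) * y `^ (1 - q) * (y <= x)%R%:R)%:E)%E.
    apply: eq_integral => y /set_mem/RposE y0; congr EFin.
    by rewrite /lower_kernel mul4l -{1}[y]powRr1 ?(ltW y0)// mul_powR.
  rewrite (integral_trunc_le (fun y => x `^ (- 2) * y `^ (1 - q)) x0).
  rewrite ge0_intZl//; [|exact: powR_ge0|exact: measurable_fun_powR|by move=> y _; exact: powR_ge0].
  rewrite integral_powR_0x//; last by lra.
  rewrite -EFinM lee_fin mulrA mul_powR// (_ : - 2 + _ = - q); last by ring.
  rewrite mulrC; apply: ler_wpM2r; first exact: powR_ge0.
  rewrite (_ : 1 - q + 1 = 2 - q); last by ring.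
  by rewrite /c -/q ger0_norm ?lerDl//; lra.
- move=> y y0.
  have -> : (\int[leb]_(x in Rpos) (lower_kernel x y * x `^ (delta - s))%:E =
      \int[leb]_(x in Rpos) (y * x `^ (- 2 + (delta - s)) * (y <= x)%R%:R)%:E)%E.
    apply: eq_integral => x /set_mem/RposE x0; congr EFin.
    by rewrite /lower_kernel mul4r mul_powR.
  rewrite (@integral_trunc_ge (fun x => y * x `^ (- 2 + (delta - s))))//; last first.
    by apply: measurable_funM => //; exact: measurable_fun_powR.
  rewrite ge0_intZl//; [|exact: ltW|exact: measurable_fun_powR|by move=> x _; exact: powR_ge0].
  rewrite integral_powR_xy//; last by lra.
  rewrite -EFinM lee_fin le_eqVlt; apply/orP; left; apply/eqP.
  rewrite mulrA -{1}[y]powRr1 ?ltW// mul_powR// mulrC.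
  rewrite (_ : 1 + _ = delta - s); last by ring.
  by congr (_^-1 * _); ring.
Qed.

Lemma hardy_upper_strong nu p delta : 1 <= p -> 2 * nu * p - 1 < delta ->
  exists2 C : R, 0 < C & forall g, measurable_fun setT g -> (forall y, 0 <= g y) ->
  (\int[leb]_(x in Rpos) (hardy_upper nu g x `^ p * (x `^ delta)%:E) <=
   C%:E * \int[leb]_(y in Rpos) (g y `^ p * y `^ delta)%:E)%E.
Proof.
move=> p1 dp.
(* The midpoint between the row bound [2 nu (p - 1)] and the column bound [delta + 1 - 2 nu], an
   interval that is nonempty exactly when [2 nu p - 1 < delta]. *)
pose s : R := if p == 1 then 0 else (delta + 1 - 2 * nu + 2 * nu * (p - 1)) / 2.
have p1s : p = 1 -> s = 0 by move=> p_eq; rewrite /s p_eq eqxx.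
have s1 : 0 < delta - s + 1 - 2 * nu.
  rewrite /s; case: eqP => [p_eq|/eqP p_neq].
    by move: dp; rewrite p_eq; lra.
  have : 1 < p by rewrite lt_neqAle eq_sym p_neq.
  lra.
have s2 : 1 < p -> 2 * nu < s / (p - 1).
  move=> p_gt1; have p10 : 0 < p - 1 by lra.
  rewrite ltr_pdivlMr// /s gt_eqF//; lra.
pose c : R := `|s / (p - 1) - 2 * nu|^-1 + 1.
have c0 : 0 < c by rewrite ltr_wpDl// invr_ge0.
pose c' : R := (delta - s + 1 - 2 * nu)^-1.
have c'0 : 0 < c' by rewrite invr_gt0.
exists (c `^ (p - 1) * c'); first by rewrite mulr_gt0// powR_gt0.
move=> g mg g0.
apply: (@schur_test R (upper_kernel nu) p s c c' delta p1 p1s c0 (ltW c'0)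
  (measurable_upper_kernel nu) (@upper_kernel_ge0 nu)) => //.
- move=> p_gt1 x x0; have {}s2 := s2 p_gt1; set q := s / (p - 1) in s2 *.
  have -> : (\int[leb]_(y in Rpos) (upper_kernel nu x y * y `^ (- q))%:E =
      \int[leb]_(y in Rpos)
        (x `^ (- (2 * nu)) * y `^ (2 * nu - 1 - q) * (x < y)%R%:R)%:E)%E.
    apply: eq_integral => y /set_mem/RposE y0; congr EFin.
    by rewrite /upper_kernel mul4l mul_powR.
  rewrite (integral_trunc_gt (fun y => x `^ (- (2 * nu)) * y `^ (2 * nu - 1 - q)) x0).
  rewrite ge0_intZl//; [|exact: powR_ge0|exact: measurable_fun_powR|by move=> y _; exact: powR_ge0].
  rewrite integral_powR_xy//; last by lra.
  rewrite -EFinM lee_fin mulrA mul_powR// (_ : - (2 * nu) + _ = - q); last by ring.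
  rewrite mulrC; apply: ler_wpM2r; first exact: powR_ge0.
  rewrite (_ : - (_ + 1) = q - 2 * nu); last by ring.
  by rewrite /c -/q ger0_norm ?lerDl//; lra.
- move=> y y0.
  have -> : (\int[leb]_(x in Rpos) (upper_kernel nu x y * x `^ (delta - s))%:E =
      \int[leb]_(x in Rpos)
        (y `^ (2 * nu - 1) * x `^ (- (2 * nu) + (delta - s)) * (x < y)%R%:R)%:E)%E.
    apply: eq_integral => x /set_mem/RposE x0; congr EFin.
    by rewrite /upper_kernel mul4r mul_powR.
  rewrite (@integral_trunc_lt _ (fun x => y `^ (2 * nu - 1) * x `^ (- (2 * nu) + (delta - s))))//; last first.
    by apply: measurable_funM => //; exact: measurable_fun_powR.
  rewrite ge0_intZl//; [|exact: powR_ge0|exact: measurable_fun_powR|by move=> x _; exact: powR_ge0].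
  rewrite integral_powR_0x//; last by lra.
  rewrite -EFinM lee_fin le_eqVlt; apply/orP; left; apply/eqP.
  rewrite mulrA mul_powR// mulrC.
  rewrite (_ : 2 * nu - 1 + _ = delta - s); last by ring.
  by congr (_^-1 * _); ring.
Qed.

(** Hölder's inequality at fixed [t], with the bounds [far_le_short] and [far_le_long] joined at
    [y = t]. The dual norm is scale invariant, so the constant does not depend on [t] and the only
    trace of [x] is the power [x ^ (- (2 nu))]. *)
Lemma far_int_endpoint nu p : nu < 1 -> 1 <= p -> exists2 C : R, 0 < C &
  forall g t x, measurable_fun setT g -> (forall y, 0 <= g y) -> 0 < t -> 0 < x ->
  (\int[leb]_(y in Rpos) (far_kernel nu t x y * g y)%:E <= (x `^ (- (2 * nu)))%:E *
   (C%:E * \int[leb]_(y in Rpos) (g y `^ p * y `^ (2 * nu * p - 1))%:E) `^ p^-1)%E.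
Proof.
move=> nu1 p1; have p0 : 0 < p by lra.
pose q : R := p / (p - 1); set delta := 2 * nu * p - 1.
pose c : R := if p == 1 then 1 else ((2 - 2 * nu) * q)^-1 + q^-1.
have c0 : 0 < c.
  rewrite /c; case: eqP => [//|/eqP p_neq].
  have p_gt1 : 1 < p by rewrite lt_neqAle eq_sym p_neq.
  have q0 : 0 < q by rewrite divr_gt0; lra.
  by rewrite addr_gt0 ?invr_gt0// mulr_gt0//; lra.
exists (c `^ (p - 1)); first by rewrite powR_gt0.
move=> g t x mg g0 t0 x0.
(* [A] and [B] are the short and long bounds divided by [y ^ (delta / p)], the share of the weight
   given to [v]. *)
pose A y := t `^ (2 * nu - 2) * y `^ (1 - delta / p).
pose B y := t * y `^ (2 * nu - 2 - delta / p).
pose u (y : mR) := A y * (y <= t)%R%:R + B y * (t < y)%R%:R.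
pose v (y : mR) := y `^ (delta / p) * g y.
have A0 y : 0 <= A y by rewrite mulr_ge0 ?powR_ge0.
have B0 y : 0 <= B y by rewrite mulr_ge0 ?powR_ge0// ltW.
have u0 y : Rpos y -> 0 <= u y by move=> _; rewrite addr_ge0// mulr_ge0.
have v0 y : Rpos y -> 0 <= v y by move=> _; rewrite mulr_ge0 ?powR_ge0.
have mA : measurable_fun (Rpos : set mR) A.
  by apply: measurable_funM => //; exact: measurable_fun_powR.
have mB : measurable_fun (Rpos : set mR) B.
  by apply: measurable_funM => //; exact: measurable_fun_powR.
have mle : measurable_fun (Rpos : set mR) (fun y => (y <= t)%R%:R : R).
  rewrite (_ : (fun z => _) = (fun z : mR => if z <= t then 1 else 0)); last first.
    by apply/funext => z; case: ifP.
  by apply: measurable_funTS; apply: measurable_fun_ifT => //; exact: measurable_fun_ler.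
have mlt : measurable_fun (Rpos : set mR) (fun y => (t < y)%R%:R : R).
  rewrite (_ : (fun z => _) = (fun z : mR => if t < z then 1 else 0)); last first.
    by apply/funext => z; case: ifP.
  by apply: measurable_funTS; apply: measurable_fun_ifT => //; exact: measurable_fun_ltr.
have mu : measurable_fun (Rpos : set mR) u.
  by apply: measurable_funD; exact: measurable_funM.
have mv : measurable_fun (Rpos : set mR) v.
  by apply: measurable_funM; [exact: measurable_fun_powR|exact: measurable_funTS].
have uv0 y : Rpos y -> 0 <= u y * v y by move=> Ry; rewrite mulr_ge0 ?u0 ?v0.
have muv : measurable_fun (Rpos : set mR) (fun y => u y * v y) by exact: measurable_funM.
apply: (@le_trans _ _ ((x `^ (- (2 * nu)))%:E * \int[leb]_(y in Rpos) (u y * v y)%:E)%E).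
  rewrite -(ge0_intZl mRpos (powR_ge0 _ _) muv uv0).
  apply: ge0_le_int => //.
  - by apply: measurable_funTS; apply: measurable_funM => //; exact: measurable_far.
  - by apply: measurable_funM.
  move=> y /RposE y0; rewrite mulr_ge0 ?far_kernel_ge0 ?(ltW y0)//=.
  have -> : x `^ (- (2 * nu)) * (u y * v y) =
      x `^ (- (2 * nu)) * (u y * y `^ (delta / p)) * g y by rewrite /v; ring.
  apply: ler_wpM2r => //.
  have yA : A y * y `^ (delta / p) = t `^ (2 * nu - 2) * y.
    by rewrite /A -mulrA mul_powR// subrK powRr1// ltW.
  have yB : B y * y `^ (delta / p) = t * y `^ (2 * nu - 2).
    by rewrite /B -mulrA mul_powR// subrK.
  rewrite /u; have [yt|ty] := leP y t.
    by rewrite mulr1 mulr0 addr0 yA; apply: far_le_short => //; exact: ltW.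
  by rewrite mulr1 mulr0 add0r yB; apply: far_le_long.
apply: lee_wpmul2l; first by rewrite lee_fin powR_ge0.
set I := (\int[leb]_(y in Rpos) (u y * v y)%:E)%E.
set N := (\int[leb]_(y in Rpos) _)%E.
have I0 : (0 <= I)%E by apply: integral_ge0 => y Ry; rewrite lee_fin uv0.
have N0 : (0 <= N)%E.
  by apply: integral_ge0 => y _; rewrite lee_fin mulr_ge0 ?powR_ge0.
suff H : (I `^ p <= (c `^ (p - 1))%:E * N)%E.
  have p_neq0 : p != 0 by rewrite gt_eqF.
  rewrite -[leLHS]poweRe1// -[X in (I `^ X)%E](mulfV p_neq0) poweRrM.
  apply: gt0_ler_poweR => //.
  - by rewrite invr_ge0 ltW.
  - by rewrite in_itv/= leey andbT poweR_ge0.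
  - by rewrite in_itv/= leey andbT mule_ge0// lee_fin powR_ge0.
have vp y : 0 < y -> v y `^ p = g y `^ p * y `^ delta.
  move=> y0; rewrite /v powRM ?powR_ge0// -powRrM divfK ?gt_eqF// mulrC//.
have [p_eq1|p_neq1] := eqVneq p 1.
  rewrite p_eq1 subrr powRr0 mul1e poweRe1//.
  have delta1 : delta = 2 * nu - 1 by rewrite /delta p_eq1 mulr1.
  apply: ge0_le_int => //.
    apply: measurable_funM; last exact: measurable_fun_powR.
    by apply: measurable_powRc; exact: measurable_funTS.
  move=> y /RposE y0; have Ry : Rpos y by apply/RposE.
  rewrite uv0//= -vp// p_eq1 powRr1 ?v0//.
  apply: ler_piMl; first exact: v0.
  (* For [p = 1] the dual norm is a supremum: the two pieces are [(y / t) ^ (2 - 2 nu)] and [t / y],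
     both at most 1 on their ranges. *)
  rewrite /u /A /B p_eq1 divr1 delta1; have [yt|ty] := leP y t.
    rewrite mulr1 mulr0 addr0 (_ : 1 - _ = - (2 * nu - 2)); last by ring.
    rewrite powRN ler_pdivrMr ?powR_gt0// mul1r; apply: ler_powRn => //; lra.
  rewrite mulr1 mulr0 add0r (_ : 2 * nu - 2 - _ = - 1); last by ring.
  by rewrite powR_inv1 ?(ltW y0)// ler_pdivrMr// mul1r ltW.
have p_gt1 : 1 < p by rewrite lt_neqAle eq_sym p_neq1.
have q0 : 0 < q by rewrite divr_gt0; lra.
apply: (le_trans (hoelder_powR p_gt1 mRpos mu mv u0 v0)).
have -> : (\int[leb]_(y in Rpos) (v y `^ p)%:E = N)%E.
  by apply: eq_integral => y /set_mem/RposE y0; rewrite vp.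
apply: lee_wpmul2r => //; rewrite -/q.
have uq y : 0 < y -> u y `^ q =
   t `^ ((2 * nu - 2) * q) * y `^ ((2 - 2 * nu) * q - 1) * (y <= t)%R%:R +
   t `^ q * y `^ (- q - 1) * (t < y)%R%:R.
  move=> y0; rewrite /u /A /B; have [yt|ty] := leP y t.
    rewrite !mulr1 !mulr0 !addr0 powRM ?powR_ge0// -!powRrM.
    by congr (_ * _ `^ _); rewrite /delta /q; field; rewrite !gt_eqF; lra.
  rewrite !mulr1 !mulr0 !add0r powRM ?powR_ge0 ?(ltW t0)// -!powRrM.
  by congr (_ * _ `^ _); rewrite /delta /q; field; rewrite !gt_eqF; lra.
(* All powers of [t] cancel: the integral over [y <= t] is [1 / ((2 - 2 nu) q)] and the one over
   [y > t] is [1 / q]. *)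
have -> : (\int[leb]_(y in Rpos) (u y `^ q)%:E = c%:E)%E.
  rewrite (eq_integral (fun y : mR =>
    (t `^ ((2 * nu - 2) * q) * y `^ ((2 - 2 * nu) * q - 1) * (y <= t)%R%:R)%:E +
    (t `^ q * y `^ (- q - 1) * (t < y)%R%:R)%:E)%E); last first.
    by move=> y /set_mem/RposE y0; rewrite uq.
  rewrite ge0_integralD//=; last 4 first.
  - by move=> y _; rewrite lee_fin !mulr_ge0 ?powR_ge0.
  - apply/measurable_EFinP; apply: measurable_funM => //; apply: measurable_funM => //.
    exact: measurable_fun_powR.
  - by move=> y _; rewrite lee_fin !mulr_ge0 ?powR_ge0.
  - apply/measurable_EFinP; apply: measurable_funM => //; apply: measurable_funM => //.
    exact: measurable_fun_powR.
  have nq : 0 < (2 - 2 * nu) * q by rewrite mulr_gt0//; lra.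
  rewrite (integral_trunc_le (fun y => t `^ ((2 * nu - 2) * q) * y `^ ((2 - 2 * nu) * q - 1)) t0).
  rewrite (integral_trunc_gt (fun y => t `^ q * y `^ (- q - 1)) t0).
  rewrite ge0_intZl//; [|exact: powR_ge0|exact: measurable_fun_powR|by move=> y _; exact: powR_ge0].
  rewrite ge0_intZl//; [|exact: powR_ge0|exact: measurable_fun_powR|by move=> y _; exact: powR_ge0].
  rewrite integral_powR_0x//; last by lra.
  rewrite integral_powR_xy//; last by lra.
  rewrite -!EFinM -EFinD; congr EFin.
  rewrite !subrK opprK (mulrA (t `^ ((2 * nu - 2) * q))) (mulrA (t `^ q)).
  rewrite !mul_powR// subrr powRr0.
  rewrite (_ : (2 * nu - 2) * q + (2 - 2 * nu) * q = 0) ?powRr0 ?mul1r; last by ring.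
  by rewrite /c (negbTE p_neq1).
by rewrite poweR_EFin.
Qed.

Lemma hardy_lower_endpoint1 g x : measurable_fun setT g -> (forall y, 0 <= g y) -> 0 < x ->
  (hardy_lower g x <= (x `^ (- 2))%:E * \int[leb]_(y in Rpos) (g y * y)%:E)%E.
Proof.
move=> mg g0 x0.
have mgy : measurable_fun (Rpos : set mR) (fun y : mR => g y * y).
  by apply: measurable_funTS; exact: measurable_funM.
rewrite -(ge0_intZl mRpos (powR_ge0 _ _) mgy); last first.
  by move=> y /RposE y0; rewrite mulr_ge0// ltW.
apply: ge0_le_int => //.
- apply: measurable_funTS; apply: measurable_funM => //.
  exact: (measurableT_comp measurable_lower_kernel (measurable_pair1 x)).
- exact: measurable_funM.
move=> y /RposE y0; rewrite mulr_ge0 ?lower_kernel_ge0//= /lower_kernel.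
have -> : x `^ (- 2) * (g y * y) = x `^ (- 2) * y * 1 * g y by ring.
apply: ler_wpM2r => //; apply: ler_wpM2l; first by rewrite mulr_ge0 ?powR_ge0// ltW.
by rewrite lern1 leq_b1.
Qed.

(** The integral of [y] over [E] is cut at a radius [r]: below it [E] is replaced by the whole
    interval, above it [y <= r ^ (2 - 2 p) y ^ (2 p - 1)]. The first step uses that the function is
    at most 1. *)
Lemma hardy_lower_endpoint p (E : set mR) x : 1 <= p -> measurable E -> 0 < x ->
  (hardy_lower \1_E x <= (x `^ (- 2))%:E * ((3 / 2)%:E *
   (\int[leb]_(y in Rpos) (\1_E y * y `^ (2 * p - 1))%:E) `^ p^-1))%E.
Proof.
move=> p1 mE x0; have p0 : 0 < p by lra.
have mI D : measurable_fun D (\1_E : mR -> R) by exact: measurable_indic.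
have I0 y : 0 <= (\1_E y : R) by [].
apply: (le_trans (hardy_lower_endpoint1 (mI _) I0 x0)).
apply: lee_wpmul2l; first by rewrite lee_fin powR_ge0.
set m := (\int[leb]_(y in Rpos) (_ * _ `^ _)%:E)%E.
have m0 : (0 <= m)%E by apply: integral_ge0 => y _; rewrite lee_fin mulr_ge0 ?powR_ge0.
have mle r : measurable_fun (Rpos : set mR) (fun y => y * (y <= r)%R%:R : R).
  rewrite (_ : (fun z => _) = (fun z : mR => if z <= r then z else 0)); last first.
    by apply/funext => z; case: ifP; rewrite ?mulr1 ?mulr0.
  by apply: measurable_funTS; apply: measurable_fun_ifT => //; exact: measurable_fun_ler.
have H r : 0 < r -> (\int[leb]_(y in Rpos) (\1_E y * y)%:E <=
    (r ^+ 2 / 2)%:E + (r `^ (2 - 2 * p))%:E * m)%E.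
  move=> r0.
  have mEy : measurable_fun (Rpos : set mR) (fun y : mR => \1_E y * y `^ (2 * p - 1) : R).
    by apply: measurable_funM => //; exact: measurable_fun_powR.
  have Ey0 y : Rpos y -> 0 <= \1_E y * y `^ (2 * p - 1) :> R.
    by move=> _; rewrite mulr_ge0 ?powR_ge0.
  rewrite -(ge0_intZl mRpos (powR_ge0 _ _) mEy Ey0).
  have -> : ((r ^+ 2 / 2)%:E = \int[leb]_(y in Rpos) (y * (y <= r)%R%:R)%:E)%E.
    rewrite (integral_trunc_le (fun y => y) r0).
    rewrite (eq_integral (fun y : mR => (y `^ 1)%:E)); last first.
      by move=> y /set_mem/=; rewrite in_itv/= => /andP[y0 _]; rewrite powRr1// ltW.
    have h1 : -1 < 1 :> R by lra.
    rewrite (integral_powR_0x h1 r0) (_ : 1 + 1 = 2%:R); last by ring.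
    by rewrite powR_mulrn// ltW.
  rewrite -ge0_integralD//=; last 4 first.
  - by move=> y /RposE y0; rewrite lee_fin mulr_ge0// ltW.
  - exact/measurable_EFinP.
  - by move=> y Ry; rewrite lee_fin mulr_ge0 ?powR_ge0 ?Ey0.
  - by apply/measurable_EFinP; exact: measurable_funM.
  apply: ge0_le_integral => //.
  - by move=> y /RposE y0; rewrite lee_fin mulr_ge0// ltW.
  - by apply/measurable_EFinP; exact: measurable_funM.
  - by apply: emeasurable_funD; apply/measurable_EFinP => //; exact: measurable_funM.
  move=> y /RposE y0; rewrite -EFinD lee_fin.
  have [yr|ry] := leP y r.
    rewrite mulr1 ler_wpDr//; first by rewrite !mulr_ge0 ?powR_ge0.
    by apply: ler_piMl; [exact: ltW|rewrite indicE lern1 leq_b1].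
  rewrite mulr0 add0r mulrCA; apply: ler_wpM2l => //.
  have {1}-> : y = y `^ (2 - 2 * p) * y `^ (2 * p - 1).
    by rewrite mul_powR// (_ : 2 - 2 * p + (2 * p - 1) = 1) ?powRr1 ?ltW//; ring.
  by apply: ler_wpM2r; [exact: powR_ge0|apply: ler_powRn => //; [lra|exact: ltW]].
case: m m0 H => [m| |]// m0 H; last first.
  rewrite poweRyr ?gt_eqF ?invr_gt0// gt0_muley ?leey// lte_fin; lra.
rewrite poweR_EFin; move: m0 H; rewrite lee_fin le_eqVlt => /predU1P[<-|m0] H; last first.
  (* This radius balances the two terms: they become [m ^ (1 / p) / 2] and [m ^ (1 / p)], whence
     3/2. *)
  have r0 : 0 < m `^ (2 * p)^-1 by rewrite powR_gt0.
  apply: (le_trans (H _ r0)); rewrite -EFinM -EFinD lee_fin.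
  rewrite -powR_mulrn ?powR_ge0// -!powRrM.
  rewrite -{3}[m]powRr1 ?(ltW m0)// mul_powR//.
  rewrite [X in m `^ X / 2](_ : _ = p^-1); last by field; rewrite gt_eqF.
  rewrite [X in _ + m `^ X](_ : _ = p^-1); last by field; rewrite gt_eqF.
  have z32 (z : R) : z / 2 + z <= 3 / 2 * z by lra.
  exact: z32.
(* For [m = 0] no radius balances; letting [r] tend to 0 shows that the integral vanishes. *)
rewrite powR0 ?gt_eqF ?invr_gt0// mule0; apply/lee_addgt0Pr => e e0.
have r0 : 0 < Num.sqrt e by rewrite sqrtr_gt0.
apply: (le_trans (H _ r0)); rewrite mule0 adde0 add0e lee_fin sqr_sqrtr ?(ltW e0)//; lra.
Qed.

End hardy.

(** * Weak and strong bounds for power weights *)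

Lemma indic_congr {T : Type} {R : pzRingType} (A B : set T) x :
  (A x <-> B x) -> \1_A x = \1_B x :> R.
Proof.
move=> AB; rewrite !indicE; have -> // : (x \in A) = (x \in B).
by apply/idP/idP => /set_mem h; apply/mem_set/AB.
Qed.

Section weak_strong_calculus.
Context {R : realType}.
Local Notation leb := (@lebesgue_measure R).
Local Notation mR := (measurableTypeR R).
Variables (delta p : R).
Hypothesis p_gt0 : 0 < p.
Local Notation mu := (power_measure delta).
Implicit Types (E F : mR -> \bar R) (M N : \bar R) (c l a x : R).

(** Formulated for a function instead of an operator, so that bounds for the pieces of a majorant
    can be scaled and added before they are transferred to the maximal operator. *)
Definition weak_le E N := forall l, 0 < l ->
  ((l `^ p)%:E * mu [set x | l%:E < E x] <= N)%E.

Definition strong_le E N := (\int[mu]_x E x `^ p <= N)%E.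

Lemma measurable_superlevel E l : measurable_fun setT E ->
  measurable [set x | (l%:E < E x)%E].
Proof.
move=> mE; rewrite -[X in measurable X]setTI.
by apply: emeasurable_fun_o_infty => //; exact: mE.
Qed.

Lemma weak_leS E F N : measurable_fun setT E -> measurable_fun setT F ->
  (forall x, E x <= F x)%E -> weak_le F N -> weak_le E N.
Proof.
move=> mE mF EF W l l0; apply: le_trans (W l l0).
apply: lee_wpmul2l; first by rewrite lee_fin powR_ge0.
apply: le_measure; rewrite ?inE; try exact: measurable_superlevel.
by move=> x /= /lt_le_trans; apply.
Qed.

Lemma weak_le_scale E N c : measurable_fun setT E -> 0 < c -> weak_le E N ->
  weak_le (fun x => c%:E * E x)%E ((c `^ p)%:E * N)%E.
Proof.
move=> mE c0 W l l0; have lc0 : 0 < l / c by rewrite divr_gt0.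
have lE x : ((l / c)%:E < E x)%E = (l%:E < c%:E * E x)%E.
  by rewrite mulrC EFinM lte_pdivrMl.
have -> : [set x | (l%:E < c%:E * E x)%E] = [set x | ((l / c)%:E < E x)%E].
  by apply/seteqP; split => x /=; rewrite lE.
have {1}-> : l = c * (l / c) by rewrite mulrC divfK// gt_eqF.
rewrite powRM ?(ltW c0) ?(ltW lc0)// EFinM -muleA.
by apply: lee_wpmul2l; [rewrite lee_fin powR_ge0|exact: W].
Qed.

Lemma weak_leD E F M N : measurable_fun setT E -> measurable_fun setT F ->
  (forall x, 0 <= E x)%E -> (forall x, 0 <= F x)%E ->
  weak_le E M -> weak_le F N ->
  weak_le (fun x => E x + F x)%E ((2 `^ p)%:E * (M + N))%E.
Proof.
move=> mE mF E0 F0 WE WF l l0; have l20 : 0 < l / 2 by rewrite divr_gt0.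
have mEl := measurable_superlevel (l / 2) mE.
have mFl := measurable_superlevel (l / 2) mF.
apply: (@le_trans _ _ ((l `^ p)%:E * (mu [set x | (l / 2)%:E < E x] +
    mu [set x | (l / 2)%:E < F x]))%E).
  apply: lee_wpmul2l; first by rewrite lee_fin powR_ge0.
  apply: le_trans (measureU2 mu mEl mFl).
  apply: le_measure; rewrite ?inE.
  - by apply: measurable_superlevel; exact: emeasurable_funD.
  - exact: measurableU.
  move=> x /= lEF; apply: contrapT => /not_orP[/negP + /negP].
  rewrite -!leNgt => h1 h2; move: lEF; rewrite ltNge => /negP; apply.
  by rewrite (splitr l) EFinD; exact: leeD.
have {1}-> : l = 2 * (l / 2) by rewrite mulrC divfK.
rewrite powRM ?(ltW l20)// EFinM -muleA.
apply: lee_wpmul2l; first by rewrite lee_fin powR_ge0.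
rewrite ge0_muleDr//; apply: leeD; [exact: WE|exact: WF].
Qed.

Lemma strong_le_weak E N : measurable_fun setT E -> (forall x, 0 <= E x)%E ->
  strong_le E N -> weak_le E N.
Proof.
move=> mE E0 S l l0; apply: le_trans S.
have mEl := measurable_superlevel l mE.
have mEp : measurable_fun setT (fun x => E x `^ p)%E.
  exact: measurableT_comp (measurable_poweR _) mE.
rewrite -(setIT [set x | _]) -(integral_indic mu measurableT mEl).
rewrite -(@ge0_integralZl_EFin _ _ _ mu _ measurableT) ?powR_ge0//; last first.
  by apply/measurable_EFinP; exact: measurable_indic.
apply: ge0_le_integral => //.
- by move=> x _; rewrite mule_ge0// lee_fin ?powR_ge0.
- by apply: emeasurable_funM => //; apply/measurable_EFinP; exact: measurable_indic.
move=> x _; rewrite indicE; have [/set_mem lE|_] := boolP (x \in _).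
  rewrite mule1 -poweR_EFin; apply: gt0_ler_poweR; rewrite ?(ltW p_gt0)//.
  - by rewrite in_itv/= leey andbT lee_fin ltW.
  - by rewrite in_itv/= leey andbT.
  - exact: ltW.
by rewrite mule0 poweR_ge0.
Qed.

Lemma strong_leS E F N : measurable_fun setT E -> measurable_fun setT F ->
  (forall x, 0 <= E x <= F x)%E -> strong_le F N -> strong_le E N.
Proof.
move=> mE mF EF; apply: le_trans; apply: ge0_le_integral => //.
- by move=> x _; exact: poweR_ge0.
- exact: measurableT_comp (measurable_poweR _) mE.
- exact: measurableT_comp (measurable_poweR _) mF.
move=> x _; have /andP[E0 EFx] := EF x.
apply: gt0_ler_poweR; rewrite ?(ltW p_gt0)//.
- by rewrite in_itv/= leey andbT.
- by rewrite in_itv/= leey andbT (le_trans E0).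
Qed.

Lemma strong_le_scale E N c : measurable_fun setT E -> (forall x, 0 <= E x)%E ->
  0 < c -> strong_le E N ->
  strong_le (fun x => c%:E * E x)%E ((c `^ p)%:E * N)%E.
Proof.
move=> mE E0 c0 S; rewrite /strong_le.
under eq_integral do rewrite poweRM ?lee_fin ?(ltW c0)// poweR_EFin.
rewrite ge0_integralZl_EFin ?powR_ge0//.
- by apply: lee_wpmul2l => //; rewrite lee_fin powR_ge0.
- by move=> x _; exact: poweR_ge0.
- exact: measurableT_comp (measurable_poweR _) mE.
Qed.

Lemma poweRD_le (u v : \bar R) : (0 <= u -> 0 <= v ->
  (u + v) `^ p <= (2 `^ p)%:E * (u `^ p + v `^ p))%E.
Proof.
wlog uv : u v / (u <= v)%E => [H u0 v0|u0 v0].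
  have /orP[|] := le_total u v; first by move=> uv; exact: H.
  by move=> vu; rewrite addeC [X in (_ * X)%E]addeC; exact: H.
apply: (@le_trans _ _ ((2%:E * v) `^ p)%E).
  apply: gt0_ler_poweR; rewrite ?(ltW p_gt0)//.
  - by rewrite in_itv/= leey andbT adde_ge0.
  - by rewrite in_itv/= leey andbT mule_ge0.
  have -> : (2%:E * v = v + v)%E by rewrite (_ : 2 = 1 + 1)// EFinD ge0_muleDl// mul1e.
  exact: leeD2r.
rewrite poweRM// poweR_EFin; apply: lee_wpmul2l; first by rewrite lee_fin powR_ge0.
by rewrite leeDr// poweR_ge0.
Qed.

Lemma strong_leD E F M N : measurable_fun setT E -> measurable_fun setT F ->
  (forall x, 0 <= E x)%E -> (forall x, 0 <= F x)%E ->
  strong_le E M -> strong_le F N ->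
  strong_le (fun x => E x + F x)%E ((2 `^ p)%:E * (M + N))%E.
Proof.
move=> mE mF E0 F0 SE SF; rewrite /strong_le.
have mEp : measurable_fun setT (fun x => E x `^ p)%E.
  exact: measurableT_comp (measurable_poweR _) mE.
have mFp : measurable_fun setT (fun x => F x `^ p)%E.
  exact: measurableT_comp (measurable_poweR _) mF.
have mEF : measurable_fun setT (fun x => E x `^ p + F x `^ p)%E.
  exact: emeasurable_funD.
apply: (@le_trans _ _ (\int[mu]_x ((2 `^ p)%:E * (E x `^ p + F x `^ p)))%E).
  apply: ge0_le_integral => //.
  - by move=> x _; exact: poweR_ge0.
  - apply: (measurableT_comp (measurable_poweR _)); exact: emeasurable_funD.
  - by apply: emeasurable_funM.
  - by move=> x _; exact: poweRD_le.
rewrite ge0_integralZl_EFin ?powR_ge0//; last first.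
  by move=> x _; rewrite adde_ge0// poweR_ge0.
apply: lee_wpmul2l; first by rewrite lee_fin powR_ge0.
rewrite ge0_integralD//; [exact: leeD| |]; by move=> x _; exact: poweR_ge0.
Qed.

Section restriction.
Variable F : mR -> \bar R.
Hypotheses (mF : measurable_fun (Rpos : set mR) F) (F0 : forall x, 0 < x -> (0 <= F x)%E).

Lemma measurable_restrict_pos : measurable_fun setT (F \_ Rpos).
Proof. by apply/(measurable_restrictT _ _).1. Qed.

Lemma restrict_pos_ge0 x : (0 <= (F \_ Rpos) x)%E.
Proof. by rewrite patchE; case: ifP => // /set_mem/RposE; exact: F0. Qed.

Lemma strong_le_restrict N :
  (\int[leb]_(x in Rpos) (F x `^ p * (x `^ delta)%:E) <= N)%E ->
  strong_le (F \_ Rpos) N.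
Proof.
rewrite /strong_le ge0_integral_power_measure//; last 2 first.
- exact: measurableT_comp (measurable_poweR _) measurable_restrict_pos.
- by move=> x _; exact: poweR_ge0.
rewrite setTI; apply: le_trans; rewrite le_eqVlt; apply/orP; left; apply/eqP.
by apply: eq_integral => x xR; rewrite patchE xR.
Qed.

Lemma weak_le_restrict N :
  (forall l, (0 < l)%R -> (l `^ p)%:E *
    \int[leb]_(x in Rpos) ((\1_[set x : mR | (l%:E < F x)%E] x)%:E * (x `^ delta)%:E) <= N)%E ->
  weak_le (F \_ Rpos) N.
Proof.
move=> H l l0; apply: le_trans (H l l0); apply: lee_wpmul2l.
  by rewrite lee_fin powR_ge0.
have mA := measurable_superlevel l measurable_restrict_pos.
rewrite -(setIT [set x | (_ < (_ \_ _) _)%E]) -(integral_indic mu measurableT mA).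
rewrite ge0_integral_power_measure//; last first.
  by apply/measurable_EFinP; exact: measurable_indic.
rewrite setTI le_eqVlt; apply/orP; left; apply/eqP; apply: eq_integral => x xR.
congr (_%:E * _)%E; apply: indic_congr.
by rewrite /= patchE xR.
Qed.

End restriction.

Lemma measurable_power_bound (a B : R) :
  measurable_fun (Rpos : set mR) (fun x : mR => (B * x `^ a)%:E).
Proof.
by apply/measurable_EFinP; apply: measurable_funM => //; exact: measurable_fun_powR.
Qed.

(** The level set is contained in an interval from 0 to [r] or from [r] to infinity, according to
    the sign of [a], and its measure is of order [l ^ (- p)]. For [a = 0] the function would be
    constant and the measure infinite. *)
Lemma weak_le_power (a B : R) : a != 0 -> 0 <= B -> delta = a * p - 1 ->
  weak_le ((fun x : mR => (B * x `^ (- a))%:E) \_ Rpos) (B `^ p / (`|a| * p))%:E.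
Proof.
move=> a_neq0 B0 deltaE l l0.
have mA := measurable_superlevel l (measurable_restrict_pos (measurable_power_bound (- a) B)).
set A := [set x | _] in mA *.
have AE x : A x -> 0 < x /\ l < B * x `^ (- a).
  rewrite /A /= patchE; case: ifP => [/set_mem/RposE x0|_]; first by rewrite lte_fin.
  by rewrite lte_fin ltNge (ltW l0).
move: B0; rewrite le_eqVlt => /predU1P[B0|B0].
  rewrite (_ : A = set0) ?measure0 ?mule0.
    by rewrite lee_fin mulr_ge0 ?powR_ge0// invr_ge0 mulr_ge0// ltW.
  by apply/seteqP; split => x // /AE[_]; rewrite -B0 mul0r ltNge (ltW l0).
pose r := (B / l) `^ a^-1.
have Bl0 : 0 < B / l by rewrite divr_gt0.
have r0 : 0 < r by exact: powR_gt0.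
have xa x : A x -> 0 < x /\ x `^ a < B / l.
  move=> /AE[x0 h]; split=> //; move: h; rewrite powRN.
  by rewrite ltr_pdivlMr ?powR_gt0// ltr_pdivlMr// mulrC.
have rE : r `^ (a * p) = (B / l) `^ p by rewrite /r -powRrM mulrA mulVf// mul1r.
have key (I : set mR) : measurable I -> I `<=` Rpos -> A `<=` I ->
    (\int[leb]_(x in I) (x `^ delta)%:E <= (r `^ (a * p) / (`|a| * p))%:E)%E ->
    ((l `^ p)%:E * mu A <= (B `^ p / (`|a| * p))%:E)%E.
  move=> mI IR AI H; apply: (@le_trans _ _ ((l `^ p)%:E * (r `^ (a * p) / (`|a| * p))%:E)%E).
    apply: lee_wpmul2l; first by rewrite lee_fin powR_ge0.
    apply: le_trans H; apply: (@le_trans _ _ (mu I)); first by apply: le_measure; rewrite ?inE.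
    by rewrite /power_measure setIidl.
  rewrite -EFinM lee_fin rE mulrA -powRM ?(ltW l0) ?(ltW Bl0)//.
  by rewrite (mulrC l) divfK// gt_eqF.
case: (ltrgtP a 0) (a_neq0) => // a0 _.
- have d1 : delta < -1 by rewrite deltaE ltrBlDr addNr nmulr_rlt0.
  apply: (key `]r, +oo[%classic) => //.
  + by move=> x /=; rewrite in_itv/= andbT => rx; apply/RposE/(lt_trans r0).
  + move=> x /xa[x0]; rewrite /= in_itv/= andbT /r => h; rewrite ltNge; apply/negP => xr.
    move: h; rewrite ltNge => /negP; apply.
    have := ler_powRn (ltW a0) x0 xr.
    by rewrite -powRrM mulVf// powRr1// ltW.
  rewrite (integral_powR_xy d1 r0) deltaE subrK (ltr0_norm a0).
  by rewrite mulNr.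
- have d1 : -1 < delta by rewrite deltaE ltrBrDr addNr mulr_gt0.
  apply: (key `]0, r]%classic) => //.
  + by move=> x /=; rewrite in_itv/= => /andP[x0 _]; apply/RposE.
  + move=> x /xa[x0 h]; rewrite /= in_itv/= x0/= leNgt; apply/negP => rx.
    move: h; rewrite ltNge => /negP; apply.
    have : r `^ a <= x `^ a.
      by apply: ge0_ler_powR; rewrite ?nnegrE ?(ltW a0) ?(ltW r0) ?(ltW x0) ?(ltW rx).
    by rewrite /r -powRrM mulVf// powRr1// ltW.
  rewrite (integral_powR_0x d1 r0) deltaE subrK (gtr0_norm a0).
  by [].
Qed.

Lemma power_measure_itv (s : R) : 0 < s ->
  (((4 `^ `|delta|)^-1 * s `^ (delta + 1))%:E <= mu `]s, (2 * s)%R] <=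
   (4 `^ `|delta| * s `^ (delta + 1))%:E)%E.
Proof.
move=> s0; have s2 : s < 2 * s by lra.
rewrite /power_measure setIidl; last first.
  by move=> x /=; rewrite in_itv/= => /andP[sx _]; apply/RposE/(lt_trans s0).
have ss : s `^ (delta + 1) = s `^ delta * s.
  by rewrite powRD ?(gt_eqF s0) ?implybT// powRr1// ltW.
have lebs : leb `]s, 2 * s] = s%:E.
  rewrite lebesgue_measure_itv/= lte_fin s2 -EFinD; congr EFin; ring.
have mpow : measurable_fun `]s, 2 * s] (fun x : mR => (x `^ delta)%:E).
  by apply/measurable_EFinP; exact: measurable_fun_powR.
have xs x : x \in `]s, 2 * s] ->
    (4 `^ `|delta|)^-1 * s `^ delta <= x `^ delta <= 4 `^ `|delta| * s `^ delta.
  rewrite in_itv/= => /andP[h1 h2].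
  have x0 := lt_trans s0 h1.
  have -> : x = x / s * s by rewrite divfK// gt_eqF.
  rewrite (powRM _ (divr_ge0 (ltW x0) (ltW s0)) (ltW s0)).
  have /andP[h3 h4] : (4 `^ `|delta|)^-1 <= (x / s) `^ delta <= 4 `^ `|delta|.
    by apply: powR_ratio; rewrite ler_pdivlMr// ler_pdivrMr//; apply/andP; lra.
  by rewrite !ler_wpM2r ?powR_ge0.
have cE c : (\int[leb]_(x in `]s, (2 * s)%R]) (cst (c * s `^ delta)%:E x) =
    (c * s `^ (delta + 1))%:E)%E.
  by rewrite integral_cst// [X in (_ * X)%E]lebs -EFinM ss mulrA.
rewrite -!cE; apply/andP; split; apply: ge0_le_integral => //.
- by move=> x _; rewrite lee_fin mulr_ge0 ?invr_ge0 ?powR_ge0.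
- by move=> x xI; rewrite lee_fin; have /andP[] := xs x xI.
- by move=> x _; rewrite lee_fin powR_ge0.
- by move=> x xI; rewrite lee_fin; have /andP[] := xs x xI.
Qed.

(** If [E] were infinite on the whole half-line, every level set would contain []1, 2]], and letting
    [l] grow would contradict the bound. The point found feeds [poisson_domI]. *)
Lemma weak_le_fin_point E N : measurable_fun setT E -> weak_le E N ->
  (N < +oo)%E -> exists2 x, 0 < x & (E x < +oo)%E.
Proof.
move=> mE W Noo; apply: contrapT => /forall2NP H.
have Eoo x : 0 < x -> E x = +oo%E.
  move=> x0; have [//|] := H x; rewrite ltNge leye_eq => /negP.
  by rewrite negbK => /eqP.
have K0 : 0 < (4 `^ `|delta|)^-1 :> R by rewrite invr_gt0 powR_gt0.
have low l : 0 < l -> ((l `^ p * (4 `^ `|delta|)^-1)%:E <= N)%E.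
  move=> l0; apply: le_trans (W l l0); rewrite EFinM; apply: lee_wpmul2l.
    by rewrite lee_fin powR_ge0.
  have /andP[+ _] := power_measure_itv (@ltr01 R).
  rewrite powR1 mulr1 => /le_trans; apply; apply: le_measure; rewrite ?inE//.
    exact: measurable_superlevel.
  move=> x /=; rewrite in_itv/= => /andP[x1 _].
  by rewrite Eoo ?ltry//; lra.
have N0 : (0 <= N)%E.
  by apply: le_trans (low 1 ltr01); rewrite lee_fin mulr_ge0 ?powR_ge0// ltW.
have nE : N = (fine N)%:E by rewrite fineK// ge0_fin_numE.
have n0 : 0 <= fine N by exact: fine_ge0.
(* At the level [z ^ (1 / p)] the lower bound reads [N + 1 <= N]. *)
pose z := (fine N + 1) * 4 `^ `|delta|.
have z0 : 0 < z by rewrite mulr_gt0 ?powR_gt0//; lra.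
have := low (z `^ p^-1) (powR_gt0 _ z0); rewrite nE lee_fin.
rewrite -powRrM mulVf ?gt_eqF// powRr1 ?(ltW z0)// /z mulfK ?gt_eqF ?powR_gt0//.
lra.
Qed.

End weak_strong_calculus.

(** * Sufficiency *)

Section sufficiency.
Context {R : realType}.
Local Notation leb := (@lebesgue_measure R).
Local Notation mR := (measurableTypeR R).
Variable nu : R.
Hypothesis nu_lt1 : nu < 1.
Implicit Types (E : mR -> \bar R) (f g : mR -> R) (t x l a : R).

(** The common exit of all sufficiency proofs: a majorant of the model integrals, uniform in [t] and
    finite at one point, yields domain, measurability and estimate at once. *)
Lemma poisson_max_dominated : exists2 C : R, 0 < C & forall f E,
  measurable_fun setT f -> (forall x, 0 <= E x)%E ->
  (forall t x, 0 < t -> 0 < x -> (model_int nu t x (fun y => `|f y|%R) <= E x)%E) ->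
  (exists2 x, 0 < x & (E x < +oo)%E) ->
  [/\ poisson_dom nu f, measurable_fun (setT : set mR) (poisson_max nu f) &
      forall x, (0 <= poisson_max nu f x <= C%:E * E x)%E].
Proof.
have [C C0 HC] := poisson_max_le nu_lt1; exists C => // f E mf E0 fE [x0 x00 Ex0].
have df : poisson_dom nu f.
  by apply: (poisson_domI nu_lt1 mf ltr01 x00); exact: le_lt_trans (fE _ _ ltr01 x00) Ex0.
split => //; first exact: measurable_poisson_max.
by move=> x; apply: HC.
Qed.

Variables delta p : R.
Hypothesis p_ge1 : 1 <= p.
Local Notation mu := (power_measure delta).

Let p_gt0 : 0 < p. Proof. by apply: lt_le_trans p_ge1. Qed.

Definition power_int g : \bar R := (\int[leb]_(y in Rpos) (g y `^ p * y `^ delta)%:E)%E.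

Lemma power_int_ge0 g : (0 <= power_int g)%E.
Proof. by apply: integral_ge0 => y _; rewrite lee_fin mulr_ge0 ?powR_ge0. Qed.

Lemma integral_power_int f : measurable_fun setT f ->
  (\int[mu]_x (`|f x| `^ p)%:E = power_int (fun y => `|f y|%R))%E.
Proof.
move=> mf; rewrite ge0_integral_power_measure//; last first.
  apply/measurable_EFinP; apply: measurable_powRc; exact: measurableT_comp.
by rewrite setTI.
Qed.

Lemma Lnorm_power_int f : measurable_fun setT f ->
  ('N[mu]_p%:E[EFin \o f] = power_int (fun y => `|f y|%R) `^ p^-1)%E.
Proof. by move=> mf; rewrite unlock /= -integral_power_int. Qed.

Lemma Lfun_power_int f : f \in Lfun mu p%:E ->
  measurable_fun setT f /\ (power_int (fun y => `|f y|%R) < +oo)%E.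
Proof.
move=> /andP[]; rewrite !inE/= => mf; rewrite /finite_norm Lnorm_power_int// => fin.
split => //; apply: lty_poweRy fin.
by rewrite invr_eq0 gt_eqF.
Qed.

Let L g : mR -> \bar R := local_max g \_ Rpos.

Section local.
Variable g : mR -> R.
Hypotheses (mg : measurable_fun setT g) (g0 : forall y, 0 <= g y).
Hypothesis fin : (power_int g < +oo)%E.

Let mL : measurable_fun setT (L g).
Proof. by apply: measurable_restrict_pos; exact: (@measurable_local_max R g mg g0 delta p p_ge1 fin). Qed.

Let L0 x : (0 <= L g x)%E.
Proof. by apply: restrict_pos_ge0 => y _; exact: HL_maximal_ge0. Qed.

Lemma measurable_L : measurable_fun setT (L g). Proof. exact: mL. Qed.

Lemma L_ge0 x : (0 <= L g x)%E. Proof. exact: L0. Qed.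

End local.

Lemma strong_local : 1 < p -> exists2 C : R, 0 < C & forall g,
  measurable_fun setT g -> (forall y, 0 <= g y) -> (power_int g < +oo)%E ->
  strong_le delta p (L g) (C%:E * power_int g)%E.
Proof.
move=> p1; have [C C0 HC] := @local_max_strong R delta p p1.
exists C => // g mg g0 fin; apply: strong_le_restrict; last exact: HC.
exact: (@measurable_local_max R g mg g0 delta p p_ge1 fin).
Qed.

Lemma weak_local : exists2 C : R, 0 < C & forall g,
  measurable_fun setT g -> (forall y, 0 <= g y) -> (power_int g < +oo)%E ->
  weak_le delta p (L g) (C%:E * power_int g)%E.
Proof.
have [p_eq1|p_neq1] := eqVneq p 1; last first.
  have p1 : 1 < p by rewrite lt_neqAle eq_sym p_neq1.
  have [C C0 HC] := strong_local p1; exists C => // g mg g0 fin.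
  by apply: strong_le_weak => //; [exact: measurable_L|exact: L_ge0|exact: HC].
have [C C0 HC] := @local_max_weak R delta; exists C => // g mg g0 fin.
have gE : power_int g = (\int[leb]_(y in Rpos) (g y * y `^ delta)%:E)%E.
  by apply: eq_integral => y _; rewrite p_eq1 powRr1.
apply: weak_le_restrict; first exact: (@measurable_local_max R g mg g0 delta p p_ge1 fin).
move=> l l0; rewrite {1}p_eq1 powRr1 ?(ltW l0)// gE; apply: HC => //.
by rewrite -gE.
Qed.

Section hardy.
Variable g : mR -> R.
Hypotheses (mg : measurable_fun setT g) (g0 : forall y, 0 <= g y).

Lemma measurable_lower : measurable_fun setT (hardy_lower g \_ Rpos).
Proof. by apply: measurable_restrict_pos; exact: measurable_hardy_lower. Qed.

Lemma measurable_upper : measurable_fun setT (hardy_upper nu g \_ Rpos).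
Proof. by apply: measurable_restrict_pos; exact: measurable_hardy_upper. Qed.

Lemma lower_ge0 x : (0 <= (hardy_lower g \_ Rpos) x)%E.
Proof. by apply: restrict_pos_ge0 => y; exact: hardy_lower_ge0. Qed.

Lemma upper_ge0 x : (0 <= (hardy_upper nu g \_ Rpos) x)%E.
Proof. by apply: restrict_pos_ge0 => y; exact: hardy_upper_ge0. Qed.

Lemma restrict_posE (F : mR -> \bar R) x : 0 < x -> (F \_ Rpos) x = F x.
Proof. by move=> x0; rewrite patchE mem_set//; exact/RposE. Qed.

End hardy.

Lemma model_int_le_parts : exists2 A : R, 0 < A & forall g E,
  measurable_fun setT g -> (forall y, 0 <= g y) -> (forall x, 0 <= E x)%E ->
  (forall t x, 0 < t -> 0 < x ->
    (\int[leb]_(y in Rpos) (far_kernel nu t x y * g y)%:E <= E x)%E) ->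
  forall t x, 0 < t -> 0 < x -> (model_int nu t x g <= A%:E * (E x + L g x))%E.
Proof.
(* The larger of the two constants, 5 for the far part and 1728 for the local one, in
   [model_int_le_local]. *)
exists 1728; first by rewrite ltr0n.
move=> g E mg g0 E0 fE t x t0 x0.
apply: (le_trans (model_int_le_local mg g0 nu_lt1 t0 x0)).
have L0 : (0 <= L g x)%E by exact: L_ge0.
rewrite [leRHS]ge0_muleDr//; have -> : L g x = local_max g x by exact: restrict_posE.
apply: leeD2r; apply: (@le_trans _ _ (5%:E * E x)%E).
  by apply: lee_wpmul2l => //; exact: fE.
by apply: lee_wpmul2r => //; rewrite lee_fin ler_nat.
Qed.

Let mule_distr (u a b : R) (N : \bar R) : 0 < a -> 0 < b ->
  ((u * (a + b))%:E * N = u%:E * (a%:E * N + b%:E * N))%E.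
Proof.
by move=> a0 b0; rewrite EFinM -muleA EFinD ge0_muleDl ?lee_fin ?(ltW a0) ?(ltW b0).
Qed.

Lemma strong_lower : delta < 2 * p - 1 -> exists2 C : R, 0 < C & forall g,
  measurable_fun setT g -> (forall y, 0 <= g y) ->
  strong_le delta p (hardy_lower g \_ Rpos) (C%:E * power_int g)%E.
Proof.
move=> dp; have [C C0 HC] := hardy_lower_strong p_ge1 dp; exists C => // g mg g0.
by apply: strong_le_restrict; [exact: measurable_hardy_lower|exact: HC].
Qed.

Lemma strong_upper : 2 * nu * p - 1 < delta -> exists2 C : R, 0 < C & forall g,
  measurable_fun setT g -> (forall y, 0 <= g y) ->
  strong_le delta p (hardy_upper nu g \_ Rpos) (C%:E * power_int g)%E.
Proof.
move=> dp; have [C C0 HC] := hardy_upper_strong p_ge1 dp; exists C => // g mg g0.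
by apply: strong_le_restrict; [exact: measurable_hardy_upper|exact: HC].
Qed.

Lemma poisson_max_strong : 1 < p -> 2 * nu * p - 1 < delta < 2 * p - 1 ->
  strong_type mu (poisson_dom nu) (poisson_max nu) p%:E.
Proof.
move=> p1 /andP[dp1 dp2].
have [C1 C10 H1] := strong_lower dp2; have [C2 C20 H2] := strong_upper dp1.
have [C3 C30 H3] := strong_local p1; have [C C0 HC] := poisson_max_dominated.
have [A A0 HA] := model_int_le_parts.
pose K := A `^ p * (2 `^ p * (2 `^ p * (C1 + C2) + C3)).
have K0 : 0 < K by rewrite /K; pos.
have CK0 : 0 <= C `^ p * K by rewrite mulr_ge0 ?powR_ge0// ltW.
exists ((C `^ p * K) `^ p^-1) => f /Lfun_power_int[mf fin].
pose g y := `|f y|.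
have mg : measurable_fun setT g by exact: measurableT_comp.
have g0 y : 0 <= g y by exact: normr_ge0.
pose far x := ((hardy_lower g \_ Rpos) x + (hardy_upper nu g \_ Rpos) x)%E.
have mlo := measurable_lower mg g0; have mup := measurable_upper mg g0.
have lo0 := lower_ge0 g0; have up0 := upper_ge0 g0.
have mfar : measurable_fun setT far by exact: emeasurable_funD.
have far0 x : (0 <= far x)%E by rewrite adde_ge0.
have farP t x : 0 < t -> 0 < x ->
    (\int[leb]_(y in Rpos) (far_kernel nu t x y * g y)%:E <= far x)%E.
  by move=> t0 x0; rewrite /far !restrict_posE//; exact: far_int_le.
have mL := measurable_L mg g0 fin.
have L0 := L_ge0 g.
have [N NE] : exists N, power_int g = N by exists (power_int g).
have S1 := H1 g mg g0; have S2 := H2 g mg g0; have S3 := H3 g mg g0 fin.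
have N0 := power_int_ge0 g.
rewrite NE in S1 S2 S3 N0 fin.
pose E x := (A%:E * (far x + L g x))%E.
have mfL : measurable_fun setT (fun x => far x + L g x)%E by exact: emeasurable_funD.
have mE : measurable_fun setT E by exact: emeasurable_funM.
have fL0 x : (0 <= far x + L g x)%E by rewrite adde_ge0.
have E0 x : (0 <= E x)%E by apply: mule_ge0 => //; rewrite lee_fin ltW.
have C12 : 0 < 2 `^ p * (C1 + C2) by rewrite mulr_gt0 ?powR_gt0// addr_gt0.
have SE : strong_le delta p E (K%:E * N)%E.
  rewrite /K EFinM -muleA mule_distr// mule_distr//.
  apply: strong_le_scale => //; apply: strong_leD => //.
  exact: strong_leD.
have Koo : (K%:E * N < +oo)%E by apply: lte_mul_pinfty => //; rewrite lee_fin ltW.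
have WE := strong_le_weak p_gt0 mE E0 SE.
have [x1 x10 Ex1] := weak_le_fin_point p_gt0 mE WE Koo.
have [df mT TE] := HC f E mf E0
  (HA g far mg g0 far0 farP)
  (ex_intro2 _ _ x1 x10 Ex1).
split => //; rewrite (Lnorm_power_int mf) -/g NE unlock /=.
have T0 x : (0 <= poisson_max nu f x)%E by have /andP[] := TE x.
have -> : (\int[mu]_x `|poisson_max nu f x| `^ p = \int[mu]_x poisson_max nu f x `^ p)%E.
  by apply: eq_integral => x _; rewrite gee0_abs.
rewrite -poweR_EFin -poweRM ?lee_fin//.
apply: gt0_ler_poweR; first by rewrite invr_ge0 ltW.
- by rewrite in_itv/= leey andbT; apply: integral_ge0 => x _; exact: poweR_ge0.
- by rewrite in_itv/= leey andbT mule_ge0// lee_fin.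
rewrite EFinM -muleA.
apply: (@strong_leS _ _ _ p_gt0 _ (fun x => C%:E * E x)%E) => //.
  exact: emeasurable_funM.
exact: strong_le_scale.
Qed.

(* The part of the operator away from the diagonal is what decides the weak
   type; [P] singles out the functions for which an estimate is claimed. *)
Definition far_weak (P : (mR -> R) -> Prop) := exists2 C : R, 0 < C & forall g,
  measurable_fun setT g -> (forall y, 0 <= g y) -> (power_int g < +oo)%E -> P g ->
  exists E, [/\ measurable_fun setT E, (forall x, 0 <= E x)%E,
    forall t x, 0 < t -> 0 < x ->
      (\int[leb]_(y in Rpos) (far_kernel nu t x y * g y)%:E <= E x)%E &
    weak_le delta p E (C%:E * power_int g)%E].

Lemma poisson_max_weak (P : (mR -> R) -> Prop) : far_weak P ->
  exists C : R, forall f, measurable_fun setT f ->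
  (power_int (fun y => `|f y|%R) < +oo)%E -> P (fun y => `|f y|%R) ->
  [/\ poisson_dom nu f, measurable_fun (setT : set mR) (poisson_max nu f) &
      weak_bound mu (poisson_max nu) p C f].
Proof.
move=> [C1 C10 H1]; have [C3 C30 H3] := weak_local; have [C C0 HC] := poisson_max_dominated.
have [A A0 HA] := model_int_le_parts.
pose K := A `^ p * (2 `^ p * (C1 + C3)).
have K0 : 0 < K by rewrite /K; pos.
exists (C `^ p * K) => f mf fin Pf.
pose g y := `|f y|.
have mg : measurable_fun setT g by exact: measurableT_comp.
have g0 y : 0 <= g y by exact: normr_ge0.
have [far [mfar far0 farP Wfar]] := H1 g mg g0 fin Pf.
have mL := measurable_L mg g0 fin.
have L0 := L_ge0 g.
have [N NE] : exists N, power_int g = N by exists (power_int g).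
have W3 := H3 g mg g0 fin.
have N0 := power_int_ge0 g.
rewrite NE in Wfar W3 N0 fin.
pose E x := (A%:E * (far x + L g x))%E.
have mfL : measurable_fun setT (fun x => far x + L g x)%E by exact: emeasurable_funD.
have mE : measurable_fun setT E by exact: emeasurable_funM.
have fL0 x : (0 <= far x + L g x)%E by rewrite adde_ge0.
have E0 x : (0 <= E x)%E by apply: mule_ge0 => //; rewrite lee_fin ltW.
have WE : weak_le delta p E (K%:E * N)%E.
  rewrite /K EFinM -muleA mule_distr//.
  by apply: weak_le_scale => //; exact: weak_leD.
have Koo : (K%:E * N < +oo)%E by apply: lte_mul_pinfty => //; rewrite lee_fin ltW.
have fp := weak_le_fin_point p_gt0 mE WE Koo.
have [df mT TE] := HC f E mf E0
  (HA g far mg g0 far0 farP) fp.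
split => // l l0; rewrite (integral_power_int mf) -/g NE EFinM -muleA.
have T0 x : (0 <= poisson_max nu f x)%E by have /andP[] := TE x.
have -> : [set y | (l%:E < `|poisson_max nu f y|)%E] = [set y | (l%:E < poisson_max nu f y)%E].
  by apply/seteqP; split => x /=; rewrite gee0_abs.
apply: (@weak_leS _ delta p _ (fun x => C%:E * E x)%E _ mT) => //.
- exact: emeasurable_funM.
- by move=> x; have /andP[] := TE x.
- exact: weak_le_scale.
Qed.

Lemma far_weak_interior : 2 * nu * p - 1 < delta < 2 * p - 1 -> far_weak (fun=> True).
Proof.
move=> /andP[dp1 dp2].
have [C1 C10 H1] := strong_lower dp2; have [C2 C20 H2] := strong_upper dp1.
exists (2 `^ p * (C1 + C2)); first by rewrite mulr_gt0 ?powR_gt0// addr_gt0.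
move=> g mg g0 fin _.
exists (fun x => (hardy_lower g \_ Rpos) x + (hardy_upper nu g \_ Rpos) x)%E.
have mlo := measurable_lower mg g0; have mup := measurable_upper mg g0.
have lo0 := lower_ge0 g0; have up0 := upper_ge0 g0.
split => //.
- exact: emeasurable_funD.
- by move=> x; rewrite adde_ge0.
- by move=> t x t0 x0; rewrite !restrict_posE//; exact: far_int_le.
rewrite mule_distr//.
by apply: weak_leD => //; apply: strong_le_weak => //; [exact: H1|exact: H2].
Qed.

Let weak_le_power_int a N : a != 0 -> delta = a * p - 1 -> (0 <= N)%E -> (N < +oo)%E ->
  let E := (fun x : mR => (x `^ (- a))%:E * N `^ p^-1)%E in
  [/\ measurable_fun setT (E \_ Rpos), (forall x, 0 <= (E \_ Rpos) x)%E &
      weak_le delta p (E \_ Rpos) (((`|a| * p)^-1)%:E * N)%E].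
Proof.
move=> a0 da N0 Noo; have -> : N = (fine N)%:E by rewrite fineK// ge0_fin_numE.
have n0 : 0 <= fine N by exact: fine_ge0.
pose B := fine N `^ p^-1.
move=> E; have -> : E = (fun x : mR => (B * x `^ (- a))%:E).
  by apply/funext => x; rewrite /E poweR_EFin -EFinM mulrC.
split.
- by apply: measurable_restrict_pos; exact: measurable_power_bound.
- by apply: restrict_pos_ge0 => x _; rewrite lee_fin mulr_ge0 ?powR_ge0.
have := weak_le_power p_gt0 a0 (powR_ge0 _ _ : 0 <= B) da.
by rewrite -EFinM mulrC /B -powRrM mulVf ?gt_eqF// powRr1.
Qed.

(** The whole far part, on both sides of the diagonal, is below a multiple of [x ^ (- (2 nu))]. The
    condition on [nu] makes this power nonconstant, as [weak_le_power] requires. *)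
Lemma far_weak_left : nu != 0 -> delta = 2 * nu * p - 1 -> far_weak (fun=> True).
Proof.
move=> nu0 dE; have [C C0 HC] := far_int_endpoint nu_lt1 p_ge1.
have a0 : 2 * nu != 0 by rewrite mulf_neq0.
have b0 : 0 < `|2 * nu| * p by rewrite mulr_gt0// normr_gt0.
exists ((`|2 * nu| * p)^-1 * C); first by rewrite mulr_gt0// invr_gt0.
move=> g mg g0 fin _; have N0 := power_int_ge0 g.
have CN0 : (0 <= C%:E * power_int g)%E by apply: mule_ge0 => //; rewrite lee_fin ltW.
have CNoo : (C%:E * power_int g < +oo)%E by apply: lte_mul_pinfty => //; rewrite lee_fin ltW.
have [mE E0 WE] := weak_le_power_int a0 dE CN0 CNoo.
exists ((fun x : mR => (x `^ (- (2 * nu)))%:E * (C%:E * power_int g) `^ p^-1)%E \_ Rpos).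
split => //; last by rewrite EFinM -muleA.
move=> t x t0 x0; rewrite restrict_posE//.
by have := HC g t x mg g0 t0 x0; rewrite -dE.
Qed.

(** Since [nu < 1], the upper Hardy operator is still in its open range here; only the lower one is
    critical. Its bound is left as a hypothesis because it differs between [p = 1] and
    characteristic functions. *)
Lemma far_weak_right (P : (mR -> R) -> Prop) (c : R) : 0 < c -> delta = 2 * p - 1 ->
  (forall g x, measurable_fun setT g -> (forall y, 0 <= g y) -> P g -> 0 < x ->
    (hardy_lower g x <= (x `^ (- 2))%:E * (c%:E * power_int g) `^ p^-1)%E) ->
  far_weak P.
Proof.
move=> c0 dE H.
have dp : 2 * nu * p - 1 < delta by have := nu_lt1; rewrite dE ltrD2r ltr_pM2r//; lra.
have [C2 C20 H2] := strong_upper dp.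
have b0 : 0 < `|2 : R| * p by rewrite mulr_gt0// normr_gt0.
exists (2 `^ p * ((`|2| * p)^-1 * c + C2)).
  by rewrite mulr_gt0 ?powR_gt0// addr_gt0// mulr_gt0// invr_gt0.
move=> g mg g0 fin Pg; have N0 := power_int_ge0 g.
have CN0 : (0 <= c%:E * power_int g)%E by apply: mule_ge0 => //; rewrite lee_fin ltW.
have CNoo : (c%:E * power_int g < +oo)%E by apply: lte_mul_pinfty => //; rewrite lee_fin ltW.
have two_neq0 : 2 != 0 :> R by rewrite pnatr_eq0.
have [mE E0 WE] := weak_le_power_int two_neq0 dE CN0 CNoo.
have mup := measurable_upper mg g0; have up0 := upper_ge0 g0.
exists (fun x => ((fun x : mR => (x `^ (- 2))%:E * (c%:E * power_int g) `^ p^-1) \_ Rpos) x +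
  (hardy_upper nu g \_ Rpos) x)%E.
split.
- exact: emeasurable_funD.
- by move=> x; rewrite adde_ge0.
- move=> t x t0 x0; rewrite !restrict_posE//.
  apply: (le_trans (far_int_le mg g0 nu_lt1 t0 x0)).
  by apply: leeD2r; exact: H.
have b1 : 0 < (`|2| * p)^-1 * c by rewrite mulr_gt0// invr_gt0.
rewrite mule_distr// [X in (X * _ + _)%E]EFinM -[X in (X + _)%E]muleA; apply: weak_leD => //; apply: strong_le_weak => //; exact: H2.
Qed.

Lemma poisson_max_weak_type : nu != 0 ->
  2 * nu * p - 1 <= delta /\ (if p == 1 then delta <= 2 * p - 1 else delta < 2 * p - 1) ->
  weak_type mu (poisson_dom nu) (poisson_max nu) p.
Proof.
move=> nu0 [dp1 dp2].
suff /poisson_max_weak[C HC] : far_weak (fun=> True).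
  by exists C => f /Lfun_power_int[mf fin]; exact: HC.
move: dp1; rewrite le_eqVlt => /predU1P[dE|dp1]; first by apply: far_weak_left.
have [p_eq1|p_neq1] := eqVneq p 1; last first.
  by move: dp2; rewrite (negbTE p_neq1) => dp2; apply: far_weak_interior; rewrite dp1.
move: dp2; rewrite {1}p_eq1 eqxx le_eqVlt => /predU1P[dE|dp2]; last first.
  by apply: far_weak_interior; rewrite dp1.
apply: (far_weak_right ltr01 dE) => g x mg g0 _ x0.
apply: (le_trans (hardy_lower_endpoint1 mg g0 x0)).
rewrite mul1e {1}p_eq1 invr1 poweRe1 ?power_int_ge0//.
rewrite le_eqVlt; apply/orP; left; apply/eqP; congr (_ * _)%E.
apply: eq_integral => y /set_mem/RposE y0; rewrite dE p_eq1 powRr1//.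
by rewrite (_ : 2 * 1 - 1 = 1) ?powRr1 ?(ltW y0)//; ring.
Qed.

Lemma poisson_max_restricted_weak_type : nu != 0 ->
  2 * nu * p - 1 <= delta <= 2 * p - 1 ->
  restricted_weak_type mu (poisson_dom nu) (poisson_max nu) p.
Proof.
move=> nu0 /andP[dp1 dp2].
pose P g := exists2 A : set mR, measurable A & g = \1_A.
suff /poisson_max_weak[C HC] : far_weak P.
  exists C => A mA Afin.
  have mI : measurable_fun setT (\1_A : mR -> R) by exact: measurable_indic.
  have nI : (fun y => `|\1_A y|) = \1_A :> (mR -> R).
    by apply/funext => y; rewrite ger0_norm.
  apply: HC => //; rewrite nI; last by exists A.
  apply: le_lt_trans Afin; rewrite -[X in power_int X]nI -integral_power_int//.
  rewrite [leRHS](_ : _ = \int[mu]_x (\1_A x)%:E)%E; last first.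
    by rewrite (integral_indic mu measurableT mA) setIT.
  rewrite le_eqVlt; apply/orP; left; apply/eqP; apply: eq_integral => y _.
  rewrite ger0_norm// indicE; case: (y \in A); rewrite ?powR1// powR0// gt_eqF//.
move: dp1; rewrite le_eqVlt => /predU1P[dE|dp1].
  have [C C0 HC] := far_weak_left nu0 (esym dE).
  by exists C => // g mg g0 fin _; exact: HC.
move: dp2; rewrite le_eqVlt => /predU1P[dE|dp2]; last first.
  have [|C C0 HC] := far_weak_interior; first by rewrite dp1.
  by exists C => // g mg g0 fin _; exact: HC.
(* Its [p]-th root is the 3/2 of [hardy_lower_endpoint]. *)
have c0 : 0 < (3 / 2 : R) `^ p by rewrite powR_gt0// divr_gt0.
apply: (far_weak_right c0 dE) => _ x _ _ [A mA ->] x0.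
have NE : (\int[leb]_(y in Rpos) (\1_A y * y `^ (2 * p - 1))%:E = power_int \1_A)%E.
  apply: eq_integral => y _; rewrite dE indicE.
  by case: (y \in A); rewrite ?powR1// powR0// gt_eqF.
apply: (le_trans (hardy_lower_endpoint p_ge1 mA x0)); rewrite NE.
have := power_int_ge0 \1_A; move: (power_int \1_A) => N N0.
have c3 : ((((3 / 2) `^ p)%:E * N) `^ p^-1 = (3 / 2)%:E * N `^ p^-1)%E.
  have c30 : (0 <= ((3 / 2 : R) `^ p)%:E)%E by rewrite lee_fin powR_ge0.
  rewrite (poweRM _ c30 N0) poweR_EFin -powRrM mulfV ?gt_eqF//.
  by rewrite powRr1// divr_ge0.
by rewrite c3.
Qed.

End sufficiency.

(** * Bounded functions *)

Section bounded_functions.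
Context {R : realType}.
Local Notation leb := (@lebesgue_measure R).
Local Notation mR := (measurableTypeR R).
Variable nu : R.
Hypothesis nu_lt1 : nu < 1.
Implicit Types (t x y : R).

Let one : mR -> R := cst 1.

Let mone : measurable_fun setT one. Proof. exact: measurable_cst. Qed.

Let one_ge0 y : 0 <= one y. Proof. exact: ler01. Qed.

Lemma HL_maximal_fat_one n x : (HL_maximal (fat_part n one) x <= 1)%E.
Proof.
apply: ge_ereal_sup => _ [r + <-]; rewrite /= in_itv/= andbT => r0.
rewrite /iavg lebesgue_measure_ball ?(ltW r0)// inver mulrn_eq0/= gt_eqF//.
rewrite lee_pdivrMl ?mulrn_wgt0// mule1 -(lebesgue_measure_ball x (ltW r0)).
rewrite -[leRHS]mul1e -integral_cst; last exact: measurable_ball.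
apply: ge0_le_integral => //.
- exact: measurable_ball.
- apply/measurable_EFinP; apply: measurableT_comp => //; apply: measurable_funTS.
  exact: measurable_fat_part.
- move=> y _; rewrite lee_fin ger0_norm ?fat_part_ge0//.
  by rewrite /fat_part mul1r indicE lern1 leq_b1.
Qed.

(** On the constant 1 the lower Hardy operator gives 1/2 and the upper one [1 / (- 2 nu)], the
    latter converging at infinity because [nu < 0]; the local maximal function is at most 1. *)
Lemma model_int_one : nu < 0 -> exists2 K : R, 0 < K &
  forall t x, 0 < t -> 0 < x -> (model_int nu t x one <= K%:E)%E.
Proof.
move=> nu0; have nuinv : 0 < (- (2 * nu))^-1 by rewrite invr_gt0; lra.
exists (5 * (1 / 2 + (- (2 * nu))^-1) + 1728).
  apply: addr_gt0; last by rewrite ltr0n.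
  by rewrite mulr_gt0// addr_gt0.
move=> t x t0 x0; apply: (le_trans (model_int_le_local mone one_ge0 nu_lt1 t0 x0)).
rewrite [leRHS]EFinD [X in (_ <= X + _)%E]EFinM; apply: leeD; last first.
  rewrite -[leRHS]mule1; apply: lee_wpmul2l; first by rewrite lee_fin ler0n.
  exact: HL_maximal_fat_one.
apply: lee_wpmul2l; first by rewrite lee_fin ler0n.
apply: (le_trans (far_int_le mone one_ge0 nu_lt1 t0 x0)).
rewrite EFinD; apply: leeD.
  rewrite /hardy_lower (eq_integral (fun y : mR => (x `^ (- 2) * y `^ 1 * (y <= x)%R%:R)%:E)).
    rewrite (integral_trunc_le (fun y => x `^ (- 2) * y `^ 1) x0).
    rewrite ge0_intZl//; [|exact: powR_ge0|exact: measurable_fun_powR|by move=> y _; exact: powR_ge0].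
    have h1 : -1 < 1 :> R by lra.
    rewrite (integral_powR_0x h1 x0) -EFinM lee_fin mulrA -powRD ?(gt_eqF x0) ?implybT//.
    by rewrite (_ : - 2 + (1 + 1) = 0) ?powRr0//; ring.
  by move=> y /set_mem/RposE y0; rewrite /lower_kernel mulr1 powRr1// ltW.
rewrite /hardy_upper (eq_integral (fun y : mR =>
  (x `^ (- (2 * nu)) * y `^ (2 * nu - 1) * (x < y)%R%:R)%:E)); last first.
  by move=> y _; rewrite mulr1.
rewrite (integral_trunc_gt (fun y => x `^ (- (2 * nu)) * y `^ (2 * nu - 1)) x0).
rewrite ge0_intZl//; [|exact: powR_ge0|exact: measurable_fun_powR|by move=> y _; exact: powR_ge0].
have h1 : 2 * nu - 1 < -1 by lra.
rewrite (integral_powR_xy h1 x0) -EFinM lee_fin mulrA -powRD ?(gt_eqF x0) ?implybT//.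
by rewrite subrK addNr powRr0 mul1r.
Qed.

Lemma power_measure0E (A : set mR) : measurable A ->
  power_measure 0 A = leb (A `&` Rpos).
Proof.
move=> mA; rewrite /power_measure.
under eq_integral do rewrite powRr0.
by rewrite integral_cst ?mul1e//; exact: measurableI.
Qed.

(** The norm with exponent [+oo] unfolds to the essential supremum only for a measure of positive
    total mass. *)
Lemma power_measure0_setT : (0 < power_measure (0 : R) setT)%E.
Proof.
have /andP[+ _] := power_measure_itv 0 (@ltr01 R).
rewrite powR1 mulr1 => h; apply: (@lt_le_trans _ _ (power_measure 0 `]1%R, (2 * 1)%R])).
  by apply: lt_le_trans h; rewrite lte_fin invr_gt0 powR_gt0.
by apply: le_measure; rewrite ?inE.
Qed.

Lemma poisson_max_bounded : nu < 0 ->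
  strong_type (power_measure 0) (poisson_dom nu) (poisson_max nu) +oo%E.
Proof.
move=> nu0; have [K K0 HK] := model_int_one nu0.
have [C C0 HC] := poisson_max_dominated nu_lt1.
exists (C * K) => f /andP[]; rewrite !inE/= => mf; rewrite /finite_norm.
rewrite !unlock power_measure0_setT => fin.
set M := ess_sup _ _ in fin *.
have M0 : (0 <= M)%E.
  by apply: ess_sup_gee; [exact: power_measure0_setT|apply: nearW => y; exact: abse_ge0].
have ME : M = (fine M)%:E by rewrite fineK// ge0_fin_numE.
have m0 : 0 <= fine M by exact: fine_ge0.
have mn : measurable_fun setT (fun y => `|f y|) by exact: measurableT_comp.
(* The essential supremum sees only the half-line, so the Lebesgue statement has to be restricted to
   [Rpos]. *)
have ae : {ae leb, forall y : mR, Rpos y -> `|f y| <= fine M}.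
  have : (\forall y \ae (power_measure (0 : R)), ((abse \o (EFin \o f)) y <= (fine M)%:E)%E).
    by rewrite -ME; exact: ess_sup_ge.
  have mnE : measurable_fun setT (abse \o (EFin \o f)).
    by apply: measurableT_comp => //; exact/measurable_EFinP.
  move/(ae_le_measureP _ _ mnE) => H.
  pose A : set mR := [set y | ((fine M)%:E < (abse \o (EFin \o f)) y)%E].
  have mA : measurable A by exact: measurable_superlevel.
  have A0 : power_measure 0 A = 0%E.
    rewrite -[RHS]H; congr (power_measure 0 _).
    by apply/seteqP; split => y; rewrite /A /= in_itv/= andbT.
  exists (A `&` Rpos); split.
  - exact: measurableI.
  - by rewrite -power_measure0E.
  move=> y /= /not_implyP[Ry /negP]; rewrite -ltNge => h.
  by split => //; rewrite /A /= lte_fin.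
have model_le t x : 0 < t -> 0 < x ->
    (model_int nu t x (fun y => `|f y|%R) <= (K * fine M)%:E)%E.
  move=> t0 x0; apply: (@le_trans _ _ (\int[leb]_(y in Rpos)
      (fine M * (model_kernel nu t x y * one y))%:E)%E).
    have mm := measurable_model nu x t0.
    apply: ae_ge0_le_integral => //.
    - by move=> y /RposE y0; rewrite lee_fin mulr_ge0// model_kernel_ge0// ltW.
    - apply/measurable_EFinP; apply: measurable_funM => //; exact: measurable_funTS.
    - move=> y /RposE y0; rewrite lee_fin; apply: mulr_ge0 => //; apply: mulr_ge0 => //.
      by apply: model_kernel_ge0 => //; exact: ltW.
    - apply/measurable_EFinP; apply: measurable_funM => //; apply: measurable_funM => //.
      exact: measurable_funTS.
    apply: filterS ae => y h Ry; rewrite lee_fin mulr1 mulrC; apply: ler_wpM2r.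
      by rewrite model_kernel_ge0// ltW//; apply/RposE.
    exact: h.
  rewrite ge0_intZl//.
  - rewrite mulrC EFinM; apply: lee_wpmul2l; [by rewrite lee_fin|exact: HK].
  - by apply: measurable_funM; [exact: measurable_model|exact: measurable_funTS].
  - move=> y /RposE y0; apply: mulr_ge0 => //.
    by apply: model_kernel_ge0 => //; exact: ltW.
have KM0 : 0 <= K * fine M by rewrite mulr_ge0// ltW.
have [||df mT TE] := HC f (cst (K * fine M)%:E) mf _ model_le.
- by move=> x; rewrite lee_fin.
- by exists 1 => //; rewrite ltry.
split => //.
apply/ess_supP; apply: nearW => x /=; have /andP[T0 Tle] := TE x.
by rewrite gee0_abs// -/M ME -EFinM -mulrA EFinM.
Qed.

End bounded_functions.

(** * Necessity *)

Section type_comparison.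
Context {R : realType}.
Local Notation mR := (measurableTypeR R).
Variables (delta p : R) (D : set (mR -> R)) (T : (mR -> R) -> mR -> \bar R).
Hypothesis p_ge1 : 1 <= p.
Local Notation mu := (power_measure delta).
Implicit Types f : mR -> R.

Let p_gt0 : 0 < p. Proof. exact: lt_le_trans p_ge1. Qed.

Let p_neq0 : p != 0. Proof. by rewrite gt_eqF. Qed.

Lemma Lfun_powerP f : measurable_fun setT f ->
  (\int[mu]_x (`|f x| `^ p)%:E < +oo)%E -> f \in Lfun mu p%:E.
Proof.
move=> mf fin; apply/andP; split; rewrite inE//=.
by rewrite /finite_norm unlock /=; exact: poweR_lty.
Qed.

Lemma integral_power_indic (A : set mR) : measurable A ->
  (\int[mu]_x (`|\1_A x : R| `^ p)%:E = mu A)%E.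
Proof.
move=> mA; rewrite [RHS](_ : _ = \int[mu]_x (\1_A x)%:E)%E; last first.
  by rewrite (integral_indic mu measurableT mA) setIT.
apply: eq_integral => y _.
by rewrite ger0_norm// indicE; case: (y \in A); rewrite ?powR1// powR0.
Qed.

Lemma weak_type_restricted : weak_type mu D T p -> restricted_weak_type mu D T p.
Proof.
move=> [C H]; exists C => E mE Efin; apply: H; apply: Lfun_powerP.
  exact: measurable_indic.
by rewrite integral_power_indic.
Qed.

Lemma strong_type_integral : strong_type mu D T p%:E ->
  exists2 C : R, 0 <= C & forall f, f \in Lfun mu p%:E ->
  [/\ D f, measurable_fun setT (T f) &
      (\int[mu]_x `|T f x| `^ p <= C%:E * \int[mu]_x (`|f x| `^ p)%:E)%E].
Proof.
(* Nothing excludes a negative [C] in [strong_type], hence the absolute value before taking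
   powers. *)
move=> [C H]; exists (`|C| `^ p); first exact: powR_ge0.
move=> f /H[Df mT le]; split => //.
have -> : (\int[mu]_x (`|f x| `^ p)%:E = 'N[mu]_p%:E[EFin \o f] `^ p)%E.
  by rewrite powR_Lnorm.
have N0 := Lnorm_ge0 mu p%:E (EFin \o f).
rewrite -(powR_Lnorm mu (T f) p_neq0) -poweR_EFin -poweRM//.
apply: gt0_ler_poweR; first exact: ltW.
- by rewrite in_itv/= leey andbT Lnorm_ge0.
- by rewrite in_itv/= leey andbT mule_ge0.
apply: (le_trans le); apply: lee_wpmul2r => //.
by rewrite lee_fin ler_norm.
Qed.

Lemma strong_type_weak : strong_type mu D T p%:E -> weak_type mu D T p.
Proof.
move=> /strong_type_integral[C C0 H]; exists C => f /H[Df mT le]; split => //.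
have mn : measurable_fun setT (fun x => `|T f x|%E) by exact: measurableT_comp.
by move=> l l0; apply: (strong_le_weak p_gt0 mn _ le).
Qed.

End type_comparison.

Section test_functions.
Context {R : realType}.
Local Notation leb := (@lebesgue_measure R).
Local Notation mR := (measurableTypeR R).
Variable nu : R.
Hypothesis nu_lt1 : nu < 1.
Implicit Types (f : mR -> R) (t x y s a c B : R).

(** Serves both ends of the half-line. The bounds 1/2 and 2 keep []s, 2 s]] inside the region,
    [x <= 1] or [x >= 2], where the test function has a lower bound. *)
Lemma powR_unbounded (e B : R) : e != 0 ->
  exists s, [/\ 0 < s, s `^ e > B & if e < 0 then s <= 1 / 2 else 2 <= s].
Proof.
move=> e0; pose u : R := (`|B| + 1) `^ e^-1.
have B1 : 0 < `|B| + 1 by rewrite ltr_wpDl.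
have u0 : 0 < u by exact: powR_gt0.
have ue : u `^ e = `|B| + 1 by rewrite -powRrM mulVf// powRr1// ltW.
have BB : B < `|B| + 1 by rewrite (le_lt_trans (ler_norm B))// ltrDl.
case: (ltrgtP e 0) e0 => // e0 _.
- exists (Num.min (1 / 2) u); split.
  + by rewrite lt_min u0 divr_gt0.
  + apply: (lt_le_trans BB); rewrite -ue; apply: ler_powRn; first exact: ltW.
      by rewrite lt_min u0 divr_gt0.
    by rewrite ge_min lexx orbT.
  + by rewrite ge_min lexx.
- exists (Num.max 2 u); split.
  + by rewrite lt_max ltr0n.
  + apply: (lt_le_trans BB); rewrite -ue; apply: ge0_ler_powR; rewrite ?nnegrE ?(ltW e0) ?(ltW u0)//.
      by rewrite le_max ler0n.
    by rewrite le_max lexx orbT.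
  + by rewrite le_max lexx.
Qed.

(** The weak inequality is tested at a level of order [s ^ (- a)], which [F] exceeds on all of []s,
    2 s]], a set of measure of order [s ^ (delta + 1)]. *)
Lemma weak_le_lower_power (delta p a c : R) : 0 < c -> 1 <= p ->
  exists2 c' : R, 0 < c' & forall s (F : mR -> \bar R) (N : \bar R), 0 < s ->
  measurable_fun setT F -> weak_le delta p F N ->
  (forall x, s < x -> x <= 2 * s -> ((c * x `^ (- a))%:E <= F x)%E) ->
  ((c' * s `^ (delta + 1 - a * p))%:E <= N)%E.
Proof.
move=> c0 p1; have p0 : 0 < p by lra.
pose k : R := 4 `^ `|- a|; have k0 : 0 < k by exact: powR_gt0.
(* [k] accounts for the variation of the power on the interval; the further 2 makes the inequality
   strict, as level sets demand. *)
pose c1 := c / k / 2; have c10 : 0 < c1 by rewrite !divr_gt0.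
exists (c1 `^ p * (4 `^ `|delta|)^-1).
  by rewrite mulr_gt0 ?invr_gt0 ?powR_gt0.
move=> s F N s0 mF W FP.
have l0 : 0 < c1 * s `^ (- a) by rewrite mulr_gt0 ?powR_gt0.
apply: le_trans (W _ l0).
have -> : (c1 `^ p * (4 `^ `|delta|)^-1 * s `^ (delta + 1 - a * p)) =
   (c1 * s `^ (- a)) `^ p * ((4 `^ `|delta|)^-1 * s `^ (delta + 1)).
  rewrite powRM ?powR_ge0 ?(ltW c10)// -powRrM mulNr.
  rewrite powRD ?(gt_eqF s0) ?implybT//; ring.
rewrite EFinM; apply: lee_wpmul2l; first by rewrite lee_fin powR_ge0.
have /andP[h _] := power_measure_itv delta s0; apply: (le_trans h).
apply: le_measure; rewrite ?inE//; first exact: measurable_superlevel.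
move=> x /=; rewrite in_itv/= => /andP[sx xs]; apply: lt_le_trans (FP x sx xs).
have x0 := lt_trans s0 sx.
rewrite lte_fin -(divfK (lt0r_neq0 s0) x) (powRM _ (divr_ge0 (ltW x0) (ltW s0)) (ltW s0)).
have /andP[h3 _] : k^-1 <= (x / s) `^ (- a) <= k.
  by apply: powR_ratio; rewrite ler_pdivlMr// ler_pdivrMr//; apply/andP; lra.
have sa0 : 0 < s `^ (- a) by exact: powR_gt0.
rewrite mulrA ltr_pM2r//.
have : c / k <= c * (x / s) `^ (- a) by apply: ler_wpM2l => //; exact: ltW.
have : 0 < c / k by rewrite divr_gt0.
rewrite /c1; lra.
Qed.

Lemma model_int_ge t x f (A : set mR) (b : R -> R) : 0 < t -> measurable A -> A `<=` Rpos ->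
  measurable_fun setT f -> (forall y, 0 <= f y) -> measurable_fun A b ->
  (forall y, A y -> 0 <= b y <= model_kernel nu t x y * f y) ->
  (\int[leb]_(y in A) (b y)%:E <= model_int nu t x f)%E.
Proof.
move=> t0 mA AR mf f0 mb bP.
have mm : measurable_fun (Rpos : set mR) (fun y => model_kernel nu t x y * f y).
  by apply: measurable_funM; [exact: measurable_model|exact: measurable_funTS].
apply: (@le_trans _ _ (\int[leb]_(y in A) (model_kernel nu t x y * f y)%:E)%E).
  by apply: ge0_le_int => //; exact: measurable_funS mm.
apply: ge0_subset_integral => //; first exact/measurable_EFinP.
move=> y /RposE y0; rewrite lee_fin; apply: mulr_ge0 => //.
by apply: model_kernel_ge0 => //; exact: ltW.
Qed.

Let I : set mR := `]1%R, 2%R]%classic.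

Let phi : mR -> R := \1_I.

Let mI : measurable I. Proof. exact: measurable_itv. Qed.

Let mphi : measurable_fun setT phi. Proof. exact: measurable_indic. Qed.

Let phi0 y : 0 <= phi y. Proof. by []. Qed.

Let IR : I `<=` Rpos.
Proof. by move=> y; rewrite /I/= in_itv/= => /andP[y1 _]; apply/RposE; lra. Qed.

Let lebI : leb I = 1%E.
Proof. by rewrite lebesgue_measure_itv/= lte_fin ltr1n -EFinD; congr EFin; ring. Qed.

Let muI_fin delta : (power_measure delta I < +oo)%E.
Proof.
have /andP[_] := power_measure_itv delta (@ltr01 R); rewrite mulr1 => h.
by apply: le_lt_trans h _; rewrite ltry.
Qed.

Let model_int_phi t x c : 0 < t -> 0 <= c ->
  (forall y, 1 <= y <= 2 -> c <= model_kernel nu t x y) ->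
  (c%:E <= model_int nu t x phi)%E.
Proof.
move=> t0 c0 H.
have -> : (c%:E = \int[leb]_(y in I) (cst c y)%:E)%E.
  rewrite (eq_integral (cst c%:E))// integral_cst//.
  by rewrite [X in (_ * X)%E]lebI mule1.
apply: (model_int_ge t0 mI IR mphi phi0); first exact: measurable_cst.
move=> y Iy; rewrite /phi indicE mem_set// mulr1 c0/=.
by apply: H; move: Iy; rewrite /I/= in_itv/= => /andP[h ->]; rewrite (ltW h).
Qed.

Lemma poisson_max_indic_left : exists2 c : R, 0 < c & poisson_dom nu phi ->
  forall x, 0 < x <= 1 -> ((c * x `^ (- (2 * nu)))%:E <= poisson_max nu phi x)%E.
Proof.
have [c c0 Hc] := model_ge_left nu_lt1; have [d d0 Hd] := poisson_max_ge nu_lt1.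
exists (d * c); first by rewrite mulr_gt0.
move=> dphi x x01; have /andP[x0 x1] := x01.
apply: le_trans (Hd phi mphi phi0 dphi 1 x ltr01 x0).
rewrite -mulrA EFinM; apply: lee_wpmul2l; first by rewrite lee_fin ltW.
by apply: model_int_phi => //; [rewrite mulr_ge0 ?powR_ge0// ltW|move=> y; exact: Hc].
Qed.

Lemma poisson_max_indic_right : exists2 c : R, 0 < c & poisson_dom nu phi ->
  forall x, 2 <= x -> ((c * x `^ (- 2))%:E <= poisson_max nu phi x)%E.
Proof.
have [c c0 Hc] := model_ge_right nu_lt1; have [d d0 Hd] := poisson_max_ge nu_lt1.
exists (d * c); first by rewrite mulr_gt0.
move=> dphi x x2; have x0 : 0 < x by lra.
apply: le_trans (Hd phi mphi phi0 dphi x x x0 x0).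
rewrite -mulrA EFinM; apply: lee_wpmul2l; first by rewrite lee_fin ltW.
apply: model_int_phi => //; first by rewrite mulr_ge0 ?powR_ge0// ltW.
move=> y /andP[y1 y2]; have yx : 0 <= y <= x by apply/andP; lra.
apply: le_trans (Hc x y x0 yx); rewrite ler_pM2l//.
by apply: ler_peMr; [exact: powR_ge0|].
Qed.

Lemma poisson_max_ge0 f x : (0 <= poisson_max nu f x)%E.
Proof.
rewrite /poisson_max patchE; case: ifP => // _.
apply: ereal_sup_ge; exists (`|poisson_op nu 1 f x|%:E); last by rewrite lee_fin.
by exists 1 => //; apply/RposE.
Qed.

Variables (delta p : R).
Hypothesis p_ge1 : 1 <= p.
Local Notation mu := (power_measure delta).

Let weak_bound_le C f : weak_bound mu (poisson_max nu) p C f ->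
  weak_le delta p (poisson_max nu f) (C%:E * \int[mu]_x (`|f x| `^ p)%:E)%E.
Proof.
move=> W l l0; have := W l l0; congr (_ * _ <= _)%E.
by congr (mu _); apply/seteqP; split => x /=; rewrite gee0_abs// poisson_max_ge0.
Qed.

Lemma restricted_weak_type_range :
  restricted_weak_type mu (poisson_dom nu) (poisson_max nu) p ->
  2 * nu * p - 1 <= delta <= 2 * p - 1.
Proof.
move=> [C /(_ I mI (muI_fin delta))[dphi mT /weak_bound_le W]].
move: W; rewrite (integral_power_indic delta p_ge1 mI).
have muIE : mu I = (fine (mu I))%:E by rewrite fineK// ge0_fin_numE.
rewrite [X in weak_le _ _ _ (_ * X)%E]muIE -EFinM; set N := C * _ => W.
apply/andP; split; rewrite leNgt; apply/negP => dp.
- have [c c0 /(_ dphi) Hc] := poisson_max_indic_left.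
  have [c' c'0 Hc'] := weak_le_lower_power delta (2 * nu) c0 p_ge1.
  have e0 : delta + 1 - 2 * nu * p < 0 by lra.
  have [s [s0 sN]] := powR_unbounded (N / c') (ltr0_neq0 e0).
  rewrite e0 => s2; have h x : s < x -> x <= 2 * s ->
      ((c * x `^ (- (2 * nu)))%:E <= poisson_max nu phi x)%E.
    by move=> sx xs; apply: Hc; apply/andP; lra.
  by have := Hc' s _ _ s0 mT W h; rewrite lee_fin -ler_pdivlMl// (mulrC _ N) leNgt sN.
- have [c c0 /(_ dphi) Hc] := poisson_max_indic_right.
  have [c' c'0 Hc'] := weak_le_lower_power delta 2 c0 p_ge1.
  have e0 : 0 < delta + 1 - 2 * p by lra.
  have [s [s0 sN]] := powR_unbounded (N / c') (lt0r_neq0 e0).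
  rewrite ltNge (ltW e0)/= => s2; have h x : s < x -> x <= 2 * s ->
      ((c * x `^ (- 2))%:E <= poisson_max nu phi x)%E.
    by move=> sx xs; apply: Hc; lra.
  by have := Hc' s _ _ s0 mT W h; rewrite lee_fin -ler_pdivlMl// (mulrC _ N) leNgt sN.
Qed.

(** Near 0 the maximal function of [phi] is at least [c x ^ (- (2 nu))], whose [p]-th power times
    the weight is [1 / x] up to a constant, and this is not integrable. *)
Lemma strong_type_neq_left : delta = 2 * nu * p - 1 ->
  ~ strong_type mu (poisson_dom nu) (poisson_max nu) p%:E.
Proof.
move=> dE /(strong_type_integral p_ge1)[C C0 H].
have p0 : 0 < p by have := p_ge1; lra.
have /H[dphi mT] : phi \in Lfun mu p%:E.
  by apply: Lfun_powerP => //; rewrite integral_power_indic.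
rewrite (integral_power_indic delta p_ge1 mI).
have muIE : mu I = (fine (mu I))%:E by rewrite fineK// ge0_fin_numE.
rewrite [X in (_ <= _ * X)%E]muIE -EFinM; set N := C * _ => S.
have [c c0 /(_ dphi) Hc] := poisson_max_indic_left.
(* Instead of a divergent integral, [1 / x] is bounded below on []0, 1]] by [x ^ (e - 1)], with
   integral [1 / e], for every [e > 0]. *)
have low e : 0 < e -> c `^ p / e <= N.
  move=> e0; rewrite -lee_fin; apply: le_trans S.
  rewrite ge0_integral_power_measure//; last 2 first.
  - by apply: (measurableT_comp (measurable_poweR _)); exact: measurableT_comp.
  - by move=> x _; exact: poweR_ge0.
  rewrite setTI.
  have mTp : measurable_fun (Rpos : set mR)
      (fun x : mR => `|poisson_max nu phi x| `^ p * (x `^ delta)%:E)%E.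
    apply: emeasurable_funM; last by apply/measurable_EFinP; exact: measurable_fun_powR.
    apply: measurable_funTS; apply: (measurableT_comp (measurable_poweR _)).
    exact: measurableT_comp.
  have sub : `]0%R, 1%R]%classic `<=` (Rpos : set mR).
    by move=> x /=; rewrite in_itv/= => /andP[x0 _]; apply/RposE.
  apply: (@le_trans _ _ (\int[leb]_(x in `]0%R, 1%R])
      (`|poisson_max nu phi x| `^ p * (x `^ delta)%:E))%E); last first.
    apply: ge0_subset_integral => //.
    by move=> x _; rewrite mule_ge0 ?poweR_ge0// lee_fin powR_ge0.
  have e1 : -1 < e - 1 by lra.
  have -> : ((c `^ p / e)%:E = \int[leb]_(x in `]0%R, 1%R]) (c `^ p * x `^ (e - 1))%:E)%E.
    rewrite ge0_intZl//; [|exact: powR_ge0|exact: measurable_fun_powR|by move=> y _; exact: powR_ge0].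
    by rewrite (integral_powR_0x e1 ltr01) subrK powR1 div1r -EFinM.
  apply: ge0_le_integral => //.
  - by move=> x _; rewrite lee_fin mulr_ge0 ?powR_ge0.
  - by apply/measurable_EFinP; apply: measurable_funM => //; exact: measurable_fun_powR.
  - exact: measurable_funS mTp.
  move=> x /=; rewrite in_itv/= => x01; have /andP[x0 x1] := x01.
  apply: (@le_trans _ _ ((c * x `^ (- (2 * nu)))%:E `^ p * (x `^ delta)%:E)%E).
    rewrite poweR_EFin -EFinM lee_fin powRM ?powR_ge0 ?(ltW c0)// -mulrA -powRrM.
    apply: ler_wpM2l; first exact: powR_ge0.
    rewrite -powRD ?(gt_eqF x0) ?implybT// dE (_ : - (2 * nu) * p + (2 * nu * p - 1) = - 1); last by ring.
    rewrite powRD ?(gt_eqF x0) ?implybT//; apply: ler_piMl; first exact: powR_ge0.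
    have := ge0_ler_powR (ltW e0) (ltW x0 : x \is Num.nneg) (ler01 : 1 \is Num.nneg) x1.
    by rewrite powR1.
  apply: lee_wpmul2r; first by rewrite lee_fin powR_ge0.
  have h := Hc x x01.
  apply: gt0_ler_poweR; first exact: ltW.
  - by rewrite in_itv/= leey andbT lee_fin mulr_ge0 ?powR_ge0// ltW.
  - by rewrite in_itv/= leey andbT.
  - by rewrite gee0_abs ?poisson_max_ge0.
have cp0 : 0 < c `^ p by exact: powR_gt0.
have N1 : 0 < N + 1.
  by have := low 1 ltr01; rewrite divr1; lra.
have := low (c `^ p / (N + 1)) (divr_gt0 cp0 N1).
by rewrite invf_div mulrC divfK ?gt_eqF//; lra.
Qed.

(** For [f = y ^ (-2 + e)] on []0, 1]] the [p]-th power of the norm is [1 / (e p)], while the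
    maximal function is of order at least [1 / e] on []1, 2]]. The weak bound would give [e ^ (- p)]
    at most a multiple of [1 / e]. *)
Lemma weak_type_neq_right : 1 < p -> delta = 2 * p - 1 ->
  ~ weak_type mu (poisson_dom nu) (poisson_max nu) p.
Proof.
move=> p1 dE [C H]; have p0 : 0 < p by lra.
have [c c0 Hc] := model_ge_right nu_lt1; have [d d0 Hd] := poisson_max_ge nu_lt1.
pose A : set mR := `]0%R, 1%R]%classic.
have mA : measurable A by exact: measurable_itv.
have AR : A `<=` Rpos by move=> x; rewrite /A/= in_itv/= => /andP[x0 _]; apply/RposE.
have mu12 : ((4 `^ `|delta|)^-1%:E <= mu `]1%R, 2%R])%E.
  have /andP[h _] := power_measure_itv delta (@ltr01 R).
  by move: h; rewrite powR1 !mulr1.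
set k := (4 `^ `|delta|)^-1 in mu12; have k0 : 0 < k by rewrite invr_gt0 powR_gt0.
(* On []1, 2]] the factor [x ^ (-2)] is at least 1/4; 8 instead of 4 gives the strict inequality. *)
pose b := d * c / 8; have b0 : 0 < b by rewrite divr_gt0// mulr_gt0.
have key e : 0 < e -> b `^ p * k * e `^ (- p) <= C * (e * p)^-1.
  move=> e0; have ep0 : 0 < e * p by rewrite mulr_gt0.
  pose f : mR -> R := fun y => y `^ (- 2 + e) * \1_A y.
  have mf : measurable_fun setT f.
    by apply: measurable_funM; [exact: measurable_fun_powR|exact: measurable_indic].
  have f0 y : 0 <= f y by rewrite mulr_ge0 ?powR_ge0.
  have fN : (\int[mu]_x (`|f x| `^ p)%:E = ((e * p)^-1)%:E)%E.
    rewrite ge0_integral_power_measure//; last first.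
      apply/measurable_EFinP; apply: measurable_powRc; exact: measurableT_comp.
    have ep1 : -1 < e * p - 1 by lra.
    have := integral_powR_0x ep1 ltr01; rewrite subrK powR1 div1r => <-.
    rewrite setTI integral_mkcond [RHS]integral_mkcond; apply: eq_integral => y _.
    rewrite !patchE -/A; have [yA|yA] := boolP (y \in A).
      have y0 : 0 < y by apply/RposE/AR/set_mem.
      rewrite mem_set; last exact/RposE.
      rewrite ger0_norm// /f indicE yA mulr1 -EFinM -powRrM -powRD ?(gt_eqF y0) ?implybT//.
      by congr ((_ `^ _)%:E); rewrite dE; ring.
    case: ifP => // _; rewrite /f indicE (negbTE yA) mulr0 normr0 powR0 ?gt_eqF//.
    by rewrite mul0e.
  have /H[df mT /weak_bound_le W] : f \in Lfun mu p%:E.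
    by apply: Lfun_powerP => //; rewrite fN ltry.
  rewrite fN in W.
  have l0 : 0 < b / e by rewrite divr_gt0.
  have := W _ l0; rewrite -EFinM => Wl; rewrite -lee_fin; apply: le_trans Wl.
  have -> : b `^ p * k * e `^ (- p) = (b / e) `^ p * k.
    by rewrite (powRM _ (ltW b0)) ?invr_ge0 ?(ltW e0)// -powR_inv1 ?(ltW e0)// -powRrM mulN1r mulrAC.
  rewrite EFinM; apply: lee_wpmul2l; first by rewrite lee_fin powR_ge0.
  apply: (le_trans mu12); apply: le_measure; rewrite ?inE//; first exact: measurable_superlevel.
  move=> x /=; rewrite in_itv/= => /andP[x1 x2].
  have x0 : 0 < x by lra.
  apply: lt_le_trans (Hd f mf f0 df x x x0 x0).
  have e1 : -1 < e - 1 by lra.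
  apply: (@lt_le_trans _ _ (d%:E * (c * x `^ (- 2) / e)%:E)%E).
    rewrite -EFinM lte_fin !mulrA ltr_pM2r ?invr_gt0// /b ltr_pM2l ?mulr_gt0//.
    apply: (@lt_le_trans _ _ (2 `^ (- 2))).
      by rewrite powRN powR_mulrn// ltf_pV2 ?posrE//; lra.
    by apply: ler_powRn => //; lra.
  apply: lee_wpmul2l; first by rewrite lee_fin ltW.
  have -> : ((c * x `^ (- 2) / e)%:E = \int[leb]_(y in A) (c * x `^ (- 2) * y `^ (e - 1))%:E)%E.
    rewrite ge0_intZl//; [|by rewrite mulr_ge0 ?powR_ge0// ltW|exact: measurable_fun_powR|by move=> y _; exact: powR_ge0].
    by rewrite (integral_powR_0x e1 ltr01) subrK powR1 div1r -EFinM.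
  apply: model_int_ge => //.
    by apply: measurable_funM => //; exact: measurable_fun_powR.
  move=> y yA; have y0 : 0 < y by apply/RposE/AR.
  rewrite !mulr_ge0 ?powR_ge0 ?(ltW c0)//= /f indicE mem_set// mulr1.
  have -> : y `^ (e - 1) = y * y `^ (- 2 + e).
    rewrite -{2}[y]powRr1 ?(ltW y0)// -powRD ?(gt_eqF y0) ?implybT//.
    by congr (_ `^ _); ring.
  have yx : 0 <= y <= x.
    by move: yA; rewrite /A/= in_itv/= => /andP[_ y1]; apply/andP; lra.
  rewrite mulrA; apply: ler_wpM2r; first exact: powR_ge0.
  by rewrite -mulrA; exact: Hc.
have bk0 : 0 < b `^ p * k by rewrite mulr_gt0 ?powR_gt0.
have e0 : 1 - p < 0 by lra.
(* Multiplied by [e], [key] says that [e ^ (1 - p)] stays bounded, which fails because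
   [1 - p < 0]. *)
have [e [e_gt0 + _]] := powR_unbounded (C / p / (b `^ p * k)) (ltr0_neq0 e0).
rewrite ltNge => /negP; apply; rewrite ler_pdivlMr// mulrC.
have -> : e `^ (1 - p) = e * e `^ (- p).
  by rewrite powRD ?(gt_eqF e_gt0) ?implybT// powRr1// ltW.
have -> : b `^ p * k * (e * e `^ (- p)) = e * (b `^ p * k * e `^ (- p)) by ring.
have -> : C / p = e * (C * (e * p)^-1) by field; rewrite !gt_eqF.
by rewrite ler_pM2l//; exact: key.
Qed.

Lemma integral_inv_shift s : 0 < s < 1 ->
  (\int[leb]_(x in `[(1 + s)%R, 2%R]) ((x - 1)^-1)%:E = (- ln s)%:E)%E.
Proof.
move=> /andP[s0 s1].
have dF x : 1 < x -> is_derive x 1 (fun x : R => ln (x - 1)) (x - 1)^-1.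
  move=> x1; have x10 : 0 < x - 1 by lra.
  rewrite -[X in is_derive _ _ _ X]mulr1.
  apply: (@is_derive1_comp _ _ (fun x : R => x - 1)); first exact: is_derive1_ln.
  by rewrite -[X in is_derive _ _ _ X]subr0; apply: is_deriveB.
have cF x : 1 < x -> {for x, continuous (fun x : R => ln (x - 1))}.
  move=> x1; apply: differentiable_continuous; apply/derivable1_diffP.
  by have [] := dF x x1.
have -> : (- ln s)%:E = ((ln (2 - 1))%:E - (ln (1 + s - 1))%:E)%E.
  rewrite -EFinB; congr EFin; rewrite (_ : 2 - 1 = 1); last by ring.
  by rewrite ln1 (addrC 1 s) addrK sub0r.
apply: (@continuous_FTC2 _ (fun x => (x - 1)^-1) (fun x => ln (x - 1))).
- by lra.
- apply: continuous_in_subspaceT => x; rewrite inE/= in_itv/= => /andP[h _].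
  by apply: cvgV; [rewrite gt_eqF//; lra|apply: cvgB; [exact: cvg_id|exact: cvg_cst]].
- split.
  + move=> x; rewrite in_itv/= => /andP[h _].
    by have [] := dF x (ltac:(lra)).
  + by apply: cvg_at_right_filter; apply: cF; lra.
  + by apply: cvg_at_left_filter; apply: cF; lra.
- move=> x; rewrite in_itv/= => /andP[h _].
  have x1 : 1 < x by lra.
  by rewrite derive1E; have [_ ->] := dF x x1.
Qed.

(* The normalised indicator of []1, 1 + s]] approximates a point mass at 1, for
   which the maximal function decays like [1 / (x - 1)]. *)
Lemma strong_type_gt1 : strong_type mu (poisson_dom nu) (poisson_max nu) p%:E -> 1 < p.
Proof.
move=> S; rewrite lt_neqAle p_ge1 andbT eq_sym; apply/eqP => p_eq1.
have [C C0 H] := strong_type_integral p_ge1 S.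
have [c c0 Hc] := model_ge_diag nu_lt1; have [d d0 Hd] := poisson_max_ge nu_lt1.
pose k : R := 4 `^ `|delta|; have k0 : 0 < k by exact: powR_gt0.
have wP x : 1 <= x <= 2 -> k^-1 <= x `^ delta <= k.
  by move=> /andP[x1 x2]; apply: powR_ratio; apply/andP; lra.
(* The norm of the indicator is at most [k s], and its maximal function is at least a multiple of
   [s / (x - 1)] on [[1 + s, 2]]. Dividing by [s] leaves the logarithm from the integral of
   [1 / (x - 1)]. *)
have key s : 0 < s < 1 -> d * c * k^-1 * (- ln s) <= C * k.
  move=> s01; have /andP[s0 s1] := s01.
  pose A : set mR := `]1%R, (1 + s)%R]%classic.
  have mA : measurable A by exact: measurable_itv.
  have AP y : A y -> 1 < y /\ y <= 1 + s by rewrite /A/= in_itv/= => /andP[].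
  have AR : A `<=` Rpos by move=> y /AP[y1 _]; apply/RposE; lra.
  have lebA : leb A = s%:E.
    by rewrite lebesgue_measure_itv/= lte_fin ltrDl s0 -EFinD; congr EFin; ring.
  have muA : (mu A <= (k * s)%:E)%E.
    rewrite /power_measure setIidl// -[X in (_ <= X)%E](_ : \int[leb]_(x in A) (cst k x)%:E = _)%E.
      apply: ge0_le_int => //; first exact: measurable_fun_powR.
      move=> y /AP[y1 y2]; rewrite powR_ge0/=.
      by have /andP[] := wP y ltac:(apply/andP; lra).
    rewrite (eq_integral (cst k%:E))// integral_cst//.
    by rewrite [X in (_ * X)%E]lebA.
  have mIA : measurable_fun setT (\1_A : mR -> R) by exact: measurable_indic.
  have /H[df mT] : (\1_A : mR -> R) \in Lfun mu p%:E.
    apply: Lfun_powerP => //; rewrite integral_power_indic//.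
    by apply: le_lt_trans muA _; rewrite ltry.
  rewrite (integral_power_indic delta p_ge1 mA) p_eq1 => le.
  have {}le := le_trans le (lee_wpmul2l (_ : (0 <= C%:E)%E) muA).
  have {}le : (\int[mu]_x `|poisson_max nu \1_A x| `^ 1 <= (C * (k * s))%:E)%E.
    by rewrite EFinM; apply: le; rewrite lee_fin.
  rewrite -(ler_pM2r s0) -(mulrA C) -lee_fin; apply: le_trans le.
  under [leRHS]eq_integral do rewrite poweRe1 ?abse_ge0// gee0_abs ?poisson_max_ge0//.
  rewrite ge0_integral_power_measure//; last by move=> x _; exact: poisson_max_ge0.
  rewrite setTI; pose B : set mR := `[(1 + s)%R, 2%R]%classic.
  have mB : measurable B by exact: measurable_itv.
  have BP x : B x -> 1 + s <= x /\ x <= 2 by rewrite /B/= in_itv/= => /andP[].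
  have BR : B `<=` Rpos by move=> x /BP[x1 _]; apply/RposE; lra.
  have mTw : measurable_fun (Rpos : set mR)
      (fun x : mR => poisson_max nu \1_A x * (x `^ delta)%:E)%E.
    apply: emeasurable_funM; first exact: measurable_funTS.
    by apply/measurable_EFinP; exact: measurable_fun_powR.
  apply: (@le_trans _ _ (\int[leb]_(x in B) (poisson_max nu \1_A x * (x `^ delta)%:E))%E); last first.
    apply: ge0_subset_integral => // x _.
    by rewrite mule_ge0 ?poisson_max_ge0// lee_fin powR_ge0.
  have mi : measurable_fun B (fun x : mR => (x - 1)^-1).
    apply: subspace_continuous_measurable_fun => //.
    apply: continuous_in_subspaceT => x; rewrite inE => /BP[x1 _].
    by apply: cvgV; [rewrite gt_eqF//; lra|apply: cvgB; [exact: cvg_id|exact: cvg_cst]].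
  have i0 x : B x -> 0 <= (x - 1)^-1 by move=> /BP[x1 _]; rewrite invr_ge0; lra.
  have dcs0 : 0 <= d * c * k^-1 * s by rewrite !mulr_ge0 ?invr_ge0 ?ltW.
  have -> : ((d * c * k^-1 * - ln s * s)%:E =
      \int[leb]_(x in B) (d * c * k^-1 * s * (x - 1)^-1)%:E)%E.
    rewrite (ge0_intZl mB dcs0 mi i0) (integral_inv_shift s01) -EFinM.
    by congr EFin; ring.
  apply: ge0_le_integral => //.
  - by move=> x Bx; rewrite lee_fin mulr_ge0 ?i0.
  - by apply/measurable_EFinP; exact: measurable_funM.
  - exact: measurable_funS mTw.
  move=> x /BP[xs x2]; have x10 : 0 < x - 1 by lra.
  have x0 : 0 < x by lra.
  have -> : d * c * k^-1 * s * (x - 1)^-1 = d * (c / (x - 1) * s) * k^-1 by ring.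
  rewrite EFinM; apply: lee_pmul; rewrite ?lee_fin ?invr_ge0 ?(ltW k0)//.
  - by rewrite !mulr_ge0 ?invr_ge0 ?ltW.
  - apply: le_trans (Hd _ mIA (fun y => ltac:(by [])) df (x - 1) x x10 x0).
    rewrite EFinM; apply: lee_wpmul2l; first by rewrite lee_fin ltW.
    have -> : ((c / (x - 1) * s)%:E = \int[leb]_(y in A) (cst (c / (x - 1)) y)%:E)%E.
      rewrite (eq_integral (cst (c / (x - 1))%:E))// integral_cst//.
      by rewrite [X in (_ * X)%E]lebA.
    apply: (model_int_ge x10 mA AR mIA); [by []|exact: measurable_cst|].
    move=> y yA; have [y1 y2] := AP y yA; rewrite indicE mem_set// mulr1.
    rewrite divr_ge0 ?(ltW c0) ?(ltW x10)//=.
    by apply: Hc; apply/andP; lra.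
  - by have /andP[] := wP x ltac:(apply/andP; lra).
have dck0 : 0 < d * c * k^-1 by rewrite !mulr_gt0 ?invr_gt0.
(* For [s = expR (- u)] the left side of [key] is [u] times its constant, and [u] exceeds the
   permitted quotient by 1. *)
pose u := C * k / (d * c * k^-1) + 1.
have q0 := divr_ge0 (mulr_ge0 C0 (ltW k0)) (ltW dck0).
have u0 : 0 < u by rewrite /u; lra.
have := key (expR (- u)); rewrite expR_gt0 expRK opprK.
have -> : expR (- u) < 1 by rewrite -expR0 ltr_expR; lra.
by move=> /(_ isT); rewrite mulrC -ler_pdivlMr// /u gerDl ler10.
Qed.

(** For [nu > 0] the maximal function of the bounded function [phi] grows at least like
    [x ^ (- (2 nu))] at 0; above any proposed bound it covers an interval []s / 2, s]], which is not
    a null set. *)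
Lemma bounded_type_neg : nu != 0 ->
  strong_type (power_measure 0) (poisson_dom nu) (poisson_max nu) +oo%E -> nu < 0.
Proof.
move=> nu0 [C H]; rewrite ltNge le_eqVlt eq_sym (negbTE nu0)/=; apply/negP => nu_gt0.
have mu0T := @power_measure0_setT R.
have normI : ('N[power_measure (0 : R)]_+oo[EFin \o phi] <= 1)%E.
  rewrite unlock mu0T; apply/ess_supP; apply: nearW => y.
  by rewrite /= lee_fin ger0_norm// /phi indicE lern1 leq_b1.
have /H[dphi mT le] : phi \in Lfun (power_measure (0 : R)) +oo%E.
  apply/andP; split; rewrite inE//=.
  by rewrite /finite_norm; apply: le_lt_trans normI _; rewrite ltry.
have [c c0 /(_ dphi) Hc] := poisson_max_indic_left.
have TC : ('N[power_measure (0 : R)]_+oo[poisson_max nu phi] <= `|C|%:E)%E.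
  apply: (le_trans le); apply: (@le_trans _ _ (`|C|%:E *
    'N[power_measure (0 : R)]_+oo[EFin \o phi])%E).
    by apply: lee_wpmul2r; rewrite ?Lnorm_ge0// lee_fin ler_norm.
  by rewrite -[leRHS]mule1; apply: lee_wpmul2l.
have e0 : - (2 * nu) < 0 by lra.
have [s [s0 sC]] := powR_unbounded (`|C| / c) (ltr0_neq0 e0).
rewrite e0 => s2.
have mTn : measurable_fun (setT : set mR) (abse \o poisson_max nu phi) by exact: measurableT_comp.
move: TC; rewrite unlock mu0T => /ess_supP ae.
move: ae => /(ae_le_measureP _ _ mTn) null.
have s20 : 0 < s / 2 by rewrite divr_gt0.
have /andP[+ _] := power_measure_itv 0 s20.
rewrite leNgt => /negP; apply; rewrite (_ : power_measure 0 _ = 0%E).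
  by rewrite lte_fin mulr_gt0 ?invr_gt0 ?powR_gt0.
apply: (subset_measure0 _ _ _ null) => //.
- rewrite -[X in measurable X]setTI; apply: mTn => //.
  exact: emeasurable_itv.
- move=> x /=; rewrite !in_itv/= andbT => /andP[sx xs].
  have x0 := lt_trans s20 sx.
  rewrite gee0_abs ?poisson_max_ge0//.
  have x01 : 0 < x <= 1 by apply/andP; lra.
  apply: lt_le_trans (Hc x x01); rewrite lte_fin mulrC -ltr_pdivrMr//.
  by apply: (lt_le_trans sC); apply: ler_powRn => //; lra.
Qed.

End test_functions.

Theorem proposition3p6 (R : realType) (nu p delta : R)
    (hnu : nu < 1) (hnu0 : nu != 0) (hp : 1 <= p) :
  [/\ strong_type (power_measure delta) (poisson_dom nu) (poisson_max nu) p%:E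
        <-> (1 < p /\ 2 * nu * p - 1 < delta < 2 * p - 1),
      weak_type (power_measure delta) (poisson_dom nu) (poisson_max nu) p
        <-> (2 * nu * p - 1 <= delta /\
             (if p == 1 then delta <= 2 * p - 1 else delta < 2 * p - 1)),
      restricted_weak_type (power_measure delta) (poisson_dom nu)
          (poisson_max nu) p
        <-> 2 * nu * p - 1 <= delta <= 2 * p - 1
    & (* the weight x^0 gives Lebesgue measure on (0, oo) *)
      strong_type (power_measure 0) (poisson_dom nu) (poisson_max nu) +oo%E
        <-> nu < 0].
Proof.
have weak_range : weak_type (power_measure delta) (poisson_dom nu) (poisson_max nu) p ->
    2 * nu * p - 1 <= delta <= 2 * p - 1.
  by move=> /(weak_type_restricted hp); exact: restricted_weak_type_range.
split.
- split=> [S|[p1 d]]; last exact: poisson_max_strong.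
  have p1 := strong_type_gt1 hnu hp S; have W := strong_type_weak hp S.
  have /andP[d1 d2] := weak_range W; split => //.
  (* The closed range follows already from the restricted weak type; each endpoint is then excluded
     by its own test function. *)
  rewrite !lt_neqAle d1 d2 !andbT; apply/andP; split; apply/eqP => dE.
    exact: (strong_type_neq_left hnu hp (esym dE) S).
  exact: (weak_type_neq_right hnu p1 dE W).
- split=> [W|]; last exact: poisson_max_weak_type.
  have /andP[d1 d2] := weak_range W; split => //.
  have [//|p_neq1] := eqVneq p 1; rewrite lt_neqAle d2 andbT; apply/eqP => dE.
  have p1 : 1 < p by rewrite lt_neqAle eq_sym p_neq1.
  exact: (weak_type_neq_right hnu p1 dE W).
- split; first exact: restricted_weak_type_range.
  exact: poisson_max_restricted_weak_type.
- split; first exact: bounded_type_neg.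
  exact: poisson_max_bounded.
Qed.
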